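(* For $d\in[0,1]$ and $f\in\mathbb R^2$ let $$\widehat W(d,f)=\inf_{\substack{\tilde d\in BV(\Omega';\{0,1\})\\ \langle\tilde d\rangle=d}}\ \inf_{\tilde\eta|_{\partial\Omega'}=f\cdot x}\ \frac1{|\Omega'|}\int_{\Omega'}\tilde d\,W_1(\nabla\tilde\eta)+(1-\tilde d)\,W_2(\nabla\tilde\eta)\,dx$$ be the relaxed energy of the scalar (anti-plane shear) setting in three space dimensions. Then, with $d_1=d$ and $d_2=1-d$, $$\widehat W(d,f)=d_1W_1(\nabla\eta_1^* )+d_2W_2(\nabla\eta_2^* ),$$ where the vectors $\nabla\eta_1^*,\nabla\eta_2^*\in\mathbb R^2$ are given by $$\nabla\eta_1^*(d,f)=(d_2\alpha_1+d_1\alpha_2)^{-1}\big[\alpha_2f-d_2(\alpha_2f_2^T-\alpha_1f_1^T)\big],$$ $$\nabla\eta_2^*(d,f)=(d_2\alpha_1+d_1\alpha_2)^{-1}\big[\alpha_1f+d_1(\alpha_2f_2^T-\alpha_1f_1^T)\big].$$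
   Context: The scalar setting in three dimensions is given by the ansatz $\mathbf u(x_1,x_2,x_3)=(x_1,x_2,\eta(x_1,x_2))$ with a scalar function $\eta$, so that the vector $f=\nabla\eta\in\mathbb R^2$ plays the role of the strain and the domain of integration $\Omega'\subset\mathbb R^2$ (bounded, Lipschitz boundary) is two-dimensional. For $i=1,2$, $$W_i(f)=\tfrac12\alpha_i(f-f_i^T)\cdot(f-f_i^T)+w_i,\qquad f\in\mathbb R^2,$$ with constant (symmetric) positive definite matrices $\alpha_i\in\mathbb R^{2\times2}$, constant transformation strains $f_i^T\in\mathbb R^2$ (the superscript $T$ is a label, not a transpose), and constants $w_i\ge0$. $\langle\tilde d\rangle=\frac1{|\Omega'|}\int_{\Omega'}\tilde d\,dx$. The inner infimum is over $\tilde\eta\in H^1(\Omega')$ with $\tilde\eta(x)=f\cdot x$ for a.e. $x\in\partial\Omega'$. *)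

(* Defs.v *)
From HB Require Import structures.
From mathcomp Require Import all_boot all_order all_algebra.
From mathcomp Require Import all_classical all_reals all_analysis.

Set Implicit Arguments.
Unset Strict Implicit.
Unset Printing Implicit Defensive.
Import Order.TTheory GRing.Theory Num.Theory.
Import numFieldNormedType.Exports.
Local Open Scope classical_set_scope.
Local Open Scope ring_scope.

(* Points of the plane are pairs in R * R, which carries the topology, the    *)
(* norm and the Lebesgue measure; strains and gradients are column vectors.   *)

Section Vectors.
Context {R : realType}.
Implicit Types (u v : 'cV[R]_2) (x : R * R).

Definition dot u v : R := \sum_(i < 2) u i 0 * v i 0.

Definition vec x : 'cV[R]_2 := \col_(i < 2) (if i == 0 then x.1 else x.2).

Definition sym_posdef (A : 'M[R]_2) : Prop :=
  A^T = A /\ forall v, v != 0 -> 0 < dot (A *m v) v.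

Definition elastic_energy (alpha : 'M[R]_2) (fT : 'cV[R]_2) (w : R)
    (f : 'cV[R]_2) : R :=
  2^-1 * dot (alpha *m (f - fT)) (f - fT) + w.

End Vectors.

Section Sobolev.
Context {R : realType}.
Implicit Types (Omega : set (R * R)) (phi : R * R -> R).

Definition lebesgue2 :
    {measure set (measurableTypeR R * measurableTypeR R) -> \bar R} :=
  (@lebesgue_measure R \x @lebesgue_measure R)%E.

Definition partial (i : 'I_2) phi (x : R * R) : R :=
  'D_(if i == 0 then (1, 0) else (0, 1)) phi x.

Definition C1 phi : Prop :=
  (forall x, differentiable phi x) /\ forall i, continuous (partial i phi).

Definition C1c Omega phi : Prop :=
  [/\ C1 phi, compact (closure [set x | phi x != 0])
    & closure [set x | phi x != 0] `<=` Omega].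

(* Functions on Omega are represented by functions on the whole plane; only  *)
(* their values on Omega are used.                                            *)
Definition L2 Omega phi : Prop :=
  measurable_fun Omega phi /\
  (\int[lebesgue2]_(x in Omega) ((phi x) ^+ 2)%:E < +oo)%E.

(* eta belongs to H^1(Omega) and G is its weak gradient, which is unique up   *)
(* to null sets.                                                              *)
Definition H1 Omega (eta : R * R -> R) (G : R * R -> 'cV[R]_2) : Prop :=
  [/\ L2 Omega eta, forall i, L2 Omega (fun x => G x i 0)
    & forall phi i, C1c Omega phi ->
        \int[lebesgue2]_(x in Omega) (eta x * partial i phi x) =
        - \int[lebesgue2]_(x in Omega) (G x i 0 * phi x)].

Definition bv_variation Omega (chi : R * R -> R) : \bar R :=
  ereal_sup [set (\int[lebesgue2]_(x in Omega)
                   (chi x * \sum_(i < 2) partial i (fun y => Phi y i 0%R) x))%:E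
            | Phi in [set Phi : R * R -> 'cV[R]_2 |
                (forall i, C1c Omega (fun x => Phi x i 0)) /\
                (forall x, dot (Phi x) (Phi x) <= 1)]].

Definition BV Omega (chi : R * R -> R) : Prop :=
  lebesgue2.-integrable Omega (EFin \o chi) /\ (bv_variation Omega chi < +oo)%E.

Definition average Omega phi : R :=
  (fine (lebesgue2 Omega))^-1 * \int[lebesgue2]_(x in Omega) phi x.

End Sobolev.

Section Boundary.
Context {R : realType}.
Implicit Types (Omega : set (R * R)).

Definition boundary Omega : set (R * R) := closure Omega `\` interior Omega.

(* A Lipschitz graph over the line through base in the direction of the unit  *)
(* vector axis; (s, t) are the coordinates with respect to base and the       *)
(* positively oriented orthonormal frame whose first vector is axis.          *)
Record chart := Chart {
  base : R * R;
  axis : R * R;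
  radius : R;
  graph : R -> R
}.

Definition chart_point (c : chart) (s t : R) : R * R :=
  ((base c).1 + s * (axis c).1 - t * (axis c).2,
   (base c).2 + s * (axis c).2 + t * (axis c).1).

Definition boundary_chart Omega (c : chart) : Prop :=
  [/\ boundary Omega (base c),
      (axis c).1 ^+ 2 + (axis c).2 ^+ 2 = 1,
      0 < radius c,
      exists k : R, k.-lipschitz (graph c)
    & forall s t : R, `|s| < radius c -> `|t| < radius c ->
        (Omega (chart_point c s t) <-> graph c s < t)].

Definition lipschitz_boundary Omega : Prop :=
  forall x, boundary Omega x -> exists c, boundary_chart Omega c /\ base c = x.

(* The part of the boundary inside the square of a chart is the image of      *)
(* chart_patch under boundary_point.                                          *)
Definition chart_patch (c : chart) : set R :=
  [set s | `|s| < radius c /\ `|graph c s| < radius c].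

Definition boundary_point (c : chart) (s : R) : R * R :=
  chart_point c s (graph c s).

(* L^2 and almost-everywhere notions on the boundary are taken in local       *)
(* charts. The surface density sqrt(1 + graph'^2) lies between two positive   *)
(* constants, and the boundary of a bounded domain is covered by finitely     *)
(* many charts, so null sets and L^2 convergence are those of the surface     *)
(* measure.                                                                   *)
Definition boundary_ae Omega (P : R * R -> Prop) : Prop :=
  forall c, boundary_chart Omega c ->
    {ae @lebesgue_measure R, forall s, chart_patch c s -> P (boundary_point c s)}.

(* The trace operator is the continuous extension to H^1(Omega), with values  *)
(* in L^2 of the boundary, of the restriction to the boundary of functions    *)
(* that are C^1 up to the boundary; eta has weak gradient G and trace T.      *)
Definition trace Omega (eta : R * R -> R) (G : R * R -> 'cV[R]_2)
    (T : R * R -> R) : Prop :=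
  (forall c, boundary_chart Omega c ->
     measurable_fun (chart_patch c) (T \o boundary_point c)) /\
  exists u : nat -> R * R -> R,
    [/\ forall n, C1 (u n),
        (fun n => \int[lebesgue2]_(x in Omega) ((u n x - eta x) ^+ 2)%:E)%E
          @ \oo --> 0%E,
        forall i,
        (fun n => \int[lebesgue2]_(x in Omega)
                    ((partial i (u n) x - G x i 0%R) ^+ 2)%:E)%E
          @ \oo --> 0%E
      & forall c, boundary_chart Omega c ->
        (fun n => \int[@lebesgue_measure R]_(s in chart_patch c)
                    ((u n (boundary_point c s) - T (boundary_point c s)) ^+ 2)%:E)%E
          @ \oo --> 0%E].

End Boundary.

Arguments chart : clear implicits.

Section Relaxation.
Context {R : realType}.
Variables (Omega : set (R * R)) (W1 W2 : 'cV[R]_2 -> R).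

(* A class in BV(Omega; {0,1}) has a representative with values in {0,1}      *)
(* everywhere on Omega.                                                       *)
Definition phase_distribution (d : R) : set (R * R -> R) :=
  [set chi | [/\ BV Omega chi,
                 forall x, Omega x -> chi x = 0 \/ chi x = 1
               & average Omega chi = d]].

Definition admissible_gradient (f : 'cV[R]_2) : set (R * R -> 'cV[R]_2) :=
  [set G | exists eta, H1 Omega eta G /\
             exists2 T, trace Omega eta G T
                      & boundary_ae Omega (fun x => T x = dot f (vec x))].

Definition energy (chi : R * R -> R) (G : R * R -> 'cV[R]_2) : \bar R :=
  ((fine (lebesgue2 Omega))^-1%:E *
   \int[lebesgue2]_(x in Omega)
     (chi x * W1 (G x) + (1 - chi x) * W2 (G x))%:E)%E.

Definition relaxed_energy (d : R) (f : 'cV[R]_2) : \bar R :=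
  ereal_inf [set ereal_inf [set energy chi G | G in admissible_gradient f]
            | chi in phase_distribution d].

End Relaxation.

(* Main.v *)
(* Put a = grad_eta1 - grad_eta2 and let sigma be the common value of the two
   stresses alpha_i (grad_eta_i - f_i^T).  If chi has average d and G has
   average f, completing the square gives
     energy chi G = d1 W1(grad_eta1) + d2 W2(grad_eta2)
                    + average of (alpha_chi D).D / 2,  D = G - f - (chi - d) a,
   because the term linear in D is the average of sigma.D, which vanishes.

   Lower bound: the last term is nonnegative, so it is enough that every
   admissible G has average f, a divergence theorem on a Lipschitz domain.  It
   follows from a single estimate: for q bounded and w of class C^1 with compact
   support, the integral of q times a partial derivative of w in direction e is
   the limit of the integrals of (q(x - t e) - q(x)) w(x) / t.  For q = 1_Omega
   and w supported in a boundary chart, the integrand lives in a strip of width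
   O(t) around a Lipschitz graph, so the limit is bounded by the L^1 norm of the
   boundary values of w; with a partition of unity the flux of u_n - f.x
   tends to 0.

   Upper bound: D is made small in L^2 by a simple laminate normal to a.  Phase 1
   occupies thin stripes, the potential is a smoothed sawtooth times a cutoff,
   and the proportion c of phase 1 in each period is chosen by the intermediate
   value theorem so that the average of chi is exactly d; integrating by parts
   shows that c is close to d.  The stripes have finite variation by the same
   estimate, with q the indicator function of a half-plane. *)

(* No compatibility condition appears because two vectors are always the gradients on the two sides
   of a line normal to their difference. A laminate thus realizes any pair of strains, and the
   average is the only constraint: the two strains of the statement minimize d1 W1(e1) + d2 W2(e2)
   under d1 e1 + d2 e2 = f, with sigma as Lagrange multiplier.

   The lower bound only needs certain fluxes to tend to zero. An upper bound for the flux is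
   therefore enough, and neither the normal nor the surface measure has to occur. This is what the
   translation estimate provides, since it asks nothing of q but measurability and boundedness.

   In the upper bound the obstacle is that the average of chi must be exactly d although the
   boundary of Omega cuts the stripes. Hence c differs from d in general; the sawtooth is built with
   the slopes of proportion c, so that it closes up after each period, and the gap d - c becomes one
   more error term. *)
From HB Require Import structures.
Require Import Defs.
From mathcomp Require Import all_boot all_order all_algebra.
From mathcomp Require Import all_classical all_reals all_analysis.
From mathcomp Require Import measurable_realfun ring lra.

Set Implicit Arguments.
Unset Strict Implicit.
Unset Printing Implicit Defensive.
Import Order.TTheory GRing.Theory Num.Theory.
Import numFieldNormedType.Exports.
Local Open Scope classical_set_scope.
Local Open Scope ring_scope.

(** * Lebesgue measure on the plane *)

Section Plane.
Context {R : realType}.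
Notation RR := (measurableTypeR R).
Notation mu1 := (@lebesgue_measure R).
Notation mu2 := (@lebesgue2 R).

(** Measurability in the plane refers to the product sigma-algebra, so U has to be written as a
    countable union of rectangles: those with rational centre and half-side that lie in U. *)
Lemma open_measurable2 (U : set (R * R)) : open U -> measurable (U : set (RR * RR)).
Proof.
move=> oU.
pose bx (q : rat * rat * rat) : set (R * R) :=
  `](ratr q.1.1 - ratr q.2 : R), ratr q.1.1 + ratr q.2[ `*`
  `](ratr q.1.2 - ratr q.2 : R), ratr q.1.2 + ratr q.2[.
pose F q := if pselect (bx q `<=` U) then bx q else set0.
have -> : U = \bigcup_q F q.
  apply/seteqP; split => [x Ux|x [q _]]; last first.
    by rewrite /F; case: pselect => [h /h|_ []].
  have /nbhs_ballP[e /= e0 eU] := oU _ Ux.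
  have [r /itvP r0] : exists r : rat, ratr r \in `](0:R), e / 2[.
    by apply: rat_in_itvoo; rewrite divr_gt0.
  have [p1 /itvP p1P] : exists p : rat, ratr p \in `](x.1 - ratr r), x.1 + ratr r[.
    by apply: rat_in_itvoo; rewrite ltrD2l gtrN ?r0.
  have [p2 /itvP p2P] : exists p : rat, ratr p \in `](x.2 - ratr r), x.2 + ratr r[.
    by apply: rat_in_itvoo; rewrite ltrD2l gtrN ?r0.
  have r1 : ratr r < e / 2 by rewrite r0.
  have [a1 a2] : x.1 - ratr r < ratr p1 /\ ratr p1 < x.1 + ratr r by rewrite !p1P.
  have [b1 b2] : x.2 - ratr r < ratr p2 /\ ratr p2 < x.2 + ratr r by rewrite !p2P.
  exists (p1, p2, r) => //; have sb : bx (p1, p2, r) `<=` U.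
    move=> y; rewrite /bx /= !in_itv /= => -[/andP[c1 c2] /andP[d1 d2]].
    by apply: eU; split; rewrite /ball /= ltr_norml; apply/andP; split; lra.
  rewrite /F; case: pselect => //= _.
  by split; rewrite /= in_itv /=; apply/andP; split; lra.
apply: countable_bigcupT_measurable => [|q]; first exact: countableP.
by rewrite /F; case: pselect => //= _; apply: measurableX; exact: measurable_itv.
Qed.

Lemma continuous_measurable2 (f : R * R -> R) :
  continuous f -> measurable_fun [set: RR * RR] (f : RR * RR -> RR).
Proof.
move=> /continuousP cf; apply: (measurability _ (measurable_realfun.RGenOpens.measurableE R)).
move=> _ [_ [a [b ->]] <-]; rewrite setTI; apply: open_measurable2.
by apply: cf; exact: interval_open.
Qed.

Local Open Scope ereal_scope.

(** The pushforward agrees with Lebesgue measure on half-open intervals, and these determine the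
    measure. *)
Lemma lebesgue_measureD (a : R) (A : set R) : measurable A ->
  pushforward mu1 ((fun x => x + a)%R : _ -> RR) A = mu1 A.
Proof.
have mD : measurable_fun setT ((fun x => x + a)%R : RR -> RR).
  exact: measurable_funD.
pose D : {mfun RR >-> RR} := HB.pack ((fun x => x + a)%R : RR -> RR)
  (isMeasurableFun.Build _ _ _ _ _ mD).
move=> mA; apply/esym.
rewrite (@lebesgue_measure_unique R (pushforward mu1 D)) //= => _ [[b c]] _ <-.
rewrite /pushforward /=.
have -> : (fun x : R => (x + a)%R) @^-1` `]b, c]%classic = `](b - a)%R, (c - a)%R]%classic.
  by apply/seteqP; split => x /=; rewrite !in_itv /= ltrBlDr lerBrDr.
rewrite !lebesgue_measure_itv /= !lte_fin ltrD2r; case: ifP => // _.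
by rewrite -!EFinB; congr EFin; ring.
Qed.

Lemma ge0_integral_translate (a : R) (F : R -> \bar R) :
  measurable_fun [set: RR] F -> (forall x, 0 <= F x) ->
  \int[mu1]_x F (x + a)%R = \int[mu1]_x F x.
Proof.
move=> mF F0; have mp : measurable_fun setT ((fun x => x + a)%R : RR -> RR).
  exact: measurable_funD.
have /= := @ge0_integral_pushforward _ _ _ _ R _ mp mu1 setT F measurableT mF
  (fun x _ => F0 x).
rewrite preimage_setT /comp => <-.
by apply: eq_measure_integral => A mA _; exact: lebesgue_measureD.
Qed.

(** Stated with integrals instead of measures of sets: Tonelli yields this form for shears, and it
    is stable under composition at once. *)
Definition mpreserving (T : R * R -> R * R) : Prop :=
  measurable_fun [set: RR * RR] (T : RR * RR -> RR * RR) /\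
  forall F : R * R -> \bar R, measurable_fun [set: RR * RR] F ->
    (forall x, 0 <= F x) -> \int[mu2]_x F (T x) = \int[mu2]_x F x.

Lemma mpreserving_comp (S T : R * R -> R * R) :
  mpreserving S -> mpreserving T -> mpreserving (S \o T).
Proof.
move=> [mS iS] [mT iT]; split; first exact: (measurableT_comp mS mT).
move=> F mF F0 /=; transitivity (\int[mu2]_x (F \o S) x); last exact: iS.
by apply: iT => [|x /=]; [exact: (measurableT_comp mF mS)|exact: F0].
Qed.

(** On each horizontal line the shear is a translation, so Tonelli reduces the claim to dimension
    one. *)
Lemma mpreserving_shear1 (m a : R) :
  mpreserving (fun x => (x.1 + (m * x.2 + a), x.2)%R).
Proof.
have mT : measurable_fun [set: RR * RR]
    ((fun x => (x.1 + (m * x.2 + a), x.2)%R) : RR * RR -> RR * RR).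
  apply: measurable_fun_pair => //; apply: measurable_funD => //.
  by apply: measurable_funD => //; exact: measurable_funM.
split=> // F mF F0.
rewrite !fubini_tonelli2 //=; last exact: measurableT_comp.
apply: eq_integral => y _; rewrite /fubini_G /=.
rewrite (@ge0_integral_translate (m * y + a) (fun x => F (x, y))) //.
exact: measurableT_comp.
Qed.

Lemma mpreserving_shear2 (m a : R) :
  mpreserving (fun x => (x.1, x.2 + (m * x.1 + a))%R).
Proof.
have mT : measurable_fun [set: RR * RR]
    ((fun x => (x.1, x.2 + (m * x.1 + a))%R) : RR * RR -> RR * RR).
  apply: measurable_fun_pair => //; apply: measurable_funD => //.
  by apply: measurable_funD => //; exact: measurable_funM.
split=> // F mF F0.
rewrite !fubini_tonelli1 //=; last exact: measurableT_comp.
apply: eq_integral => y _; rewrite /fubini_F /=.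
rewrite (@ge0_integral_translate (m * y + a) (fun x => F (y, x))) //.
exact: measurableT_comp.
Qed.

Lemma pairD (x y : R * R) : (x + y = (x.1 + y.1, x.2 + y.2))%R.
Proof. by case: x y => [? ?] [? ?]. Qed.

Lemma mpreserving_translate (v : R * R) : mpreserving (fun x => x + v)%R.
Proof.
have := mpreserving_comp (mpreserving_shear1 0 v.1) (mpreserving_shear2 0 v.2).
congr mpreserving; apply/funext => x; rewrite /= [RHS]pairD; congr pair; ring.
Qed.

(* A rotation by an angle other than pi is a product of three shears; for the
   half turn, compose two quarter turns. *)
Lemma mpreserving_rotation (c s : R) : (c ^+ 2 + s ^+ 2 = 1)%R ->
  mpreserving (fun x => (c * x.1 - s * x.2, s * x.1 + c * x.2)%R).
Proof.
have half (c' s' : R) : (s' != 0)%R -> (c' ^+ 2 + s' ^+ 2 = 1)%R ->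
    mpreserving (fun x => (c' * x.1 - s' * x.2, s' * x.1 + c' * x.2)%R).
  (* For the angle with cosine [c'] and sine [s'], [m] is minus the tangent of the half angle. *)
  move=> s0 cs; pose m := ((c' - 1) / s')%R.
  have := mpreserving_comp (mpreserving_shear1 m 0)
    (mpreserving_comp (mpreserving_shear2 s' 0) (mpreserving_shear1 m 0)).
  have m1 : (m * s' = c' - 1)%R by rewrite /m divfK.
  have m2 : (m * (c' + 1) = - s')%R.
    apply: (mulIf s0); rewrite mulrAC m1.
    by rewrite -[in RHS](mulr1 s') mulNr; move: cs; rewrite !expr2 => cs; lra.
  congr mpreserving; apply/funext => -[x1 x2] /=; congr pair => /=.
    transitivity (x1 * (1 + m * s') + x2 * (m * (c' + 1) + m * (m * s' + 1 - c')))%R.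
      by ring.
    by rewrite m2 m1; ring.
  by transitivity (s' * x1 + x2 * (m * s' + 1))%R; [ring|rewrite m1; ring].
move=> cs; have [s0|/half] := eqVneq s 0%R; last exact.
have [c1|] := eqVneq c 1%R.
  have := mpreserving_translate 0%R; congr mpreserving; apply/funext => -[x1 x2].
  by rewrite addr0 c1 s0 /=; congr pair; ring.
move=> c1; have cN1 : c = (-1)%R.
  move: cs; rewrite s0 expr0n addr0 => /eqP; rewrite sqrf_eq1.
  by rewrite (negbTE c1) => /eqP.
have q := half 0%R 1%R (oner_neq0 _) ltac:(by ring).
have := mpreserving_comp q q; congr mpreserving; apply/funext => -[x1 x2] /=.
by rewrite s0 cN1; congr pair; ring.
Qed.

Lemma mpreserving_integral (T : R * R -> R * R) (F : R * R -> \bar R) :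
  mpreserving T -> measurable_fun [set: RR * RR] F ->
  \int[mu2]_x F (T x) = \int[mu2]_x F x.
Proof.
move=> [mT iT] mF; rewrite integralE [RHS]integralE; congr (_ - _).
  rewrite -(iT F^\+) //; last exact: measurable_funepos.
  by apply: eq_integral => x _; rewrite !funeposE.
rewrite -(iT F^\-) //; last exact: measurable_funeneg.
by apply: eq_integral => x _; rewrite !funenegE.
Qed.

Lemma mpreserving_chart (c : chart R) :
  ((axis c).1 ^+ 2 + (axis c).2 ^+ 2 = 1)%R ->
  mpreserving (fun x => chart_point c x.1 x.2).
Proof.
move=> /mpreserving_rotation r.
have := mpreserving_comp (mpreserving_translate (base c)) r.
congr mpreserving; apply/funext => x; rewrite /chart_point /= pairD /=.
by congr pair; ring.
Qed.

End Plane.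

(** * Functions of class C^1 *)

Section C1_functions.
Context {R : realType}.
Implicit Types (u v w : R * R -> R) (x y : R * R).

Definition dir (i : 'I_2) : R * R := if i == 0 then (1, 0) else (0, 1).

(** Carrying the partial derivatives along as data lets the sum, product and chain rules compute
    them. *)
Definition has_grad u (g : 'I_2 -> R * R -> R) : Prop :=
  [/\ forall x, differentiable u x,
      forall i x, partial i u x = g i x & forall i, continuous (g i)].

Lemma C1P u : C1 u <-> has_grad u (fun i => partial i u).
Proof. by split=> [[]|[]]. Qed.

Lemma has_grad_C1 u g : has_grad u g -> C1 u.
Proof.
move=> [du pu cg]; split=> // i.
by rewrite (_ : partial i u = g i) //; exact/funext/pu.
Qed.

Lemma has_grad_continuous u g : has_grad u g -> continuous u.
Proof. by move=> [du _ _] x; exact: differentiable_continuous. Qed.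

Lemma has_grad_ext u v g h : has_grad u g ->
  (forall x, u x = v x) -> (forall i x, g i x = h i x) -> has_grad v h.
Proof.
by move=> ug /funext <- gh; rewrite (_ : h = g) //; apply/funext => i; apply/funext.
Qed.

Lemma has_grad_linear (a b c : R) :
  has_grad (fun x => a * x.1 + b * x.2 + c) (fun i _ => if i == 0 then a else b).
Proof.
pose l (x : R * R) : R^o := a * x.1 + b * x.2.
have linl : linear l.
  move=> k x y; rewrite /l.
  transitivity (a * (k * x.1 + y.1) + b * (k * x.2 + y.2)) => //.
  by rewrite -[RHS]/(k * (a * x.1 + b * x.2) + (a * y.1 + b * y.2)); ring.
pose lL : {linear (R * R)%type -> R^o} :=
  HB.pack l (GRing.isLinear.Build _ _ _ _ l linl).
have cl : continuous lL.
  move=> x; apply: (@continuousD _ _ _ (fun x : R * R => a * x.1) (fun x => b * x.2)).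
  - by apply: continuousM; [exact: cst_continuous|exact: cvg_fst].
  - by apply: continuousM; [exact: cst_continuous|exact: cvg_snd].
have dl x : differentiable lL x by exact: linear_differentiable.
have dx x : is_diff x (fun x => a * x.1 + b * x.2 + c) l.
  have dlx : is_diff x l l by apply: DiffDef; [exact: (dl x)|rewrite (diff_lin x cl)].
  have := is_diffD dlx (is_diff_cst c x).
  by rewrite (_ : l + 0 = l) //; apply/funext => y; exact: addr0.
split=> // [i x|i].
- rewrite /partial deriveE; last by have [] := dx x.
  have [_ ->] := dx x; rewrite /l.
  by case: ifP => _ /=; ring.
- exact: cst_continuous.
Qed.

Lemma has_grad_cst (c : R) : has_grad (cst c) (fun i => cst 0).
Proof.
apply: has_grad_ext (has_grad_linear 0 0 c) _ _ => [x|i x] /=; first by ring.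
by case: ifP.
Qed.

Lemma has_gradD u v g h : has_grad u g -> has_grad v h ->
  has_grad (fun x => u x + v x) (fun i x => g i x + h i x).
Proof.
move=> [du pu cg] [dv pv ch]; split=> [x|i x|i x].
- exact: differentiableD.
- by rewrite -pu -pv -deriveD //; exact: diff_derivable.
- exact: (continuousD (cg i x) (ch i x)).
Qed.

Lemma has_gradM u v g h : has_grad u g -> has_grad v h ->
  has_grad (fun x => u x * v x) (fun i x => u x * h i x + v x * g i x).
Proof.
move=> ug vh; have [du pu cg] := ug; have [dv pv ch] := vh; split=> [x|i x|i x].
- exact: differentiableM.
- by rewrite -pu -pv -deriveM //; exact: diff_derivable.
- apply: (continuousD (continuousM _ (ch i x)) (continuousM _ (cg i x))).
  + exact: (has_grad_continuous ug).
  + exact: (has_grad_continuous vh).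
Qed.

(** Continuity of [f'] is asked only at the values of [u], so that the rule also covers the inverse
    of a positive function. *)
Lemma has_grad_comp u g (f f' : R -> R) : has_grad u g ->
  (forall x, is_derive (u x) 1 f (f' (u x))) -> (forall x, {for u x, continuous f'}) ->
  has_grad (fun x => f (u x)) (fun i x => f' (u x) * g i x).
Proof.
move=> ug df cf; have [du pu cg] := ug.
have dfu x : differentiable f (u x) by apply/derivable1_diffP; have [] := df x.
split=> [x|i x|i x].
- exact: differentiable_comp.
- rewrite /partial deriveE; last exact: differentiable_comp.
  rewrite diff_comp //= -pu /partial (deriveE _ (du x)).
  set k := 'd u x _.
  transitivity (k *: 'd f (u x) 1).
    by rewrite -linearZ; congr ('d f (u x) _); rewrite -[RHS]/(k * 1) mulr1.
  have [_ <-] := df x; rewrite (deriveE _ (dfu x)).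
  by rewrite -[LHS]/(k * _) mulrC.
- have cfu : {for x, continuous (f' \o u)}.
    by apply: continuous_comp; [exact: (has_grad_continuous ug)|exact: cf].
  exact: (continuousM cfu (cg i x)).
Qed.

Lemma has_grad_sum (I : Type) (s : seq I) (u : I -> R * R -> R) g :
  (forall j, has_grad (u j) (g j)) ->
  has_grad (fun x => \sum_(j <- s) u j x) (fun i x => \sum_(j <- s) g j i x).
Proof.
move=> ug; elim: s => [|j s IH].
  by apply: has_grad_ext (has_grad_cst 0) _ _ => *; rewrite big_nil.
by apply: has_grad_ext (has_gradD (ug j) IH) _ _ => *; rewrite big_cons.
Qed.

Lemma has_gradZ (k : R) u g : has_grad u g ->
  has_grad (fun x => k * u x) (fun i x => k * g i x).
Proof.
move=> /(has_gradM (has_grad_cst k)) ug.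
by apply: has_grad_ext ug _ _ => //= i x; ring.
Qed.

Lemma is_derive_line u g i x (t : R) : has_grad u g ->
  is_derive t 1 (fun t => u (x + t *: dir i)) (g i (x + t *: dir i)).
Proof.
move=> [du pu cg].
have E : (fun h : R => h^-1 *: (((fun t => u (x + t *: dir i)) \o shift t) (h *: 1)
      - u (x + t *: dir i))) =
    (fun h => h^-1 *: ((u \o shift (x + t *: dir i)) (h *: dir i) -
      u (x + t *: dir i))).
  apply/funext => h /=; congr (_ *: (u _ - _)).
  by rewrite -[h *: 1]/(h * 1) mulr1 scalerDl addrCA.
split.
  by rewrite /derivable E; apply: diff_derivable.
by rewrite /derive E -pu.
Qed.

Lemma increment_mean u g i x (t : R) : has_grad u g -> 0 <= t ->
  exists2 s, 0 <= s <= t & u (x + t *: dir i) - u x = t * g i (x + s *: dir i).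
Proof.
move=> ug t0.
have [||c] := @MVT_segment R (fun t => u (x + t *: dir i))
   (fun t => g i (x + t *: dir i)) 0 t t0.
- by move=> s _; exact: is_derive_line.
- apply: continuous_subspaceT => s; apply/differentiable_continuous.
  by apply/derivable1_diffP; have [] := is_derive_line i x s ug.
- rewrite in_itv /= => c0; rewrite scale0r addr0 subr0 mulrC => E.
  by exists c.
Qed.

End C1_functions.

(** * Supports, boundedness and integrals over the plane *)

Section Integration.
Context {R : realType}.
Notation RR := (measurableTypeR R).
Notation mu1 := (@lebesgue_measure R).
Notation mu2 := (@lebesgue2 R).
Implicit Types (u v w f q : R * R -> R) (x y : R * R) (S : set (R * R)).

Definition box (M : R) : set (R * R) := [set x | `|x| <= M].

Lemma boxE M : box M = `[- M, M]%classic `*` `[- M, M]%classic.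
Proof.
apply/seteqP; split => x; rewrite /box /= prod_normE ge_max !in_itv /= -!ler_norml.
  by move=> /andP.
by move=> [-> ->].
Qed.

Lemma box_compact M : compact (box M).
Proof. by rewrite boxE; apply: compact_setX; exact: segment_compact. Qed.

Lemma box_closed M : closed (box M).
Proof.
apply: compact_closed; last exact: box_compact.
exact: norm_hausdorff.
Qed.

Lemma box_measurable M : measurable (box M : set (RR * RR)).
Proof. by rewrite boxE; apply: measurableX; exact: measurable_itv. Qed.

Lemma box_measure M : (mu2 (box M) < +oo)%E.
Proof.
have -> : mu2 (box M) = (mu1 `[(- M)%R, M]%classic * mu1 `[(- M)%R, M]%classic)%E.
  by rewrite boxE; apply: product_measure1E; exact: measurable_itv.
rewrite lebesgue_measure_itv /= lte_fin.
by case: ifP => _; rewrite ?mul0e // -EFinB -EFinM ltry.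
Qed.

(** A pointwise condition, without closure: it passes to products immediately. Closedness of [S] is
    only required to pass to derivatives. *)
Definition supp_in S u : Prop := forall x, u x != 0 -> S x.

Lemma continuous_bounded u M : continuous u -> supp_in (box M) u ->
  exists2 C, 0 <= C & forall x, `|u x| <= C.
Proof.
move=> cu su; have [M0|M0] := ltP M 0.
  exists 0 => // x; have [->|/su] := eqVneq (u x) 0; first by rewrite normr0.
  by rewrite /box /= => /(le_trans (normr_ge0 _)); rewrite leNgt M0.
have [||c _ cP] := @compact_EVT_max _ R (fun x => `|u x|) (box M) _ (@box_compact M).
- by exists 0; rewrite /box /= normr0.
- apply: continuous_subspaceT => x.
  by apply: continuous_comp; [exact: cu|exact: norm_continuous].
exists `|u c| => // x.
have [->|/su ux] := eqVneq (u x) 0; first by rewrite normr0.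
by apply: cP; rewrite inE.
Qed.

(** A point outside the closed set [S] has a neighbourhood on which [u] is zero, so the derivative
    there is that of a constant. *)
Lemma grad_supp u g S i : closed S -> has_grad u g -> supp_in S u -> supp_in S (g i).
Proof.
move=> cS [du pu _] su x; apply: contra_neqP => Sx.
rewrite -pu /partial.
rewrite (@near_eq_derive _ _ _ u (cst 0) x); first exact: derive_cst.
have : nbhs x (~` S) by apply: open_nbhs_nbhs; split => //; exact: closed_openC.
by apply: filterS => y Sy /=; apply/eqP; apply: contra_notT Sy => /su.
Qed.

Lemma grad_bounded u g M : has_grad u g -> supp_in (box M) u ->
  exists2 C, 0 <= C & forall i x, `|g i x| <= C.
Proof.
move=> ug su; have [_ _ cg] := ug.
have B i := continuous_bounded (cg i) (grad_supp (@box_closed M) ug su).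
have [C0 C00 C0P] := B 0; have [C1 C10 C1P] := B (lift 0 0).
exists (C0 + C1) => [|i x]; first exact: addr_ge0.
case: (unliftP 0 i) => [j|] ->.
  by rewrite (ord1 j) (le_trans (C1P x)) // lerDr.
by rewrite (le_trans (C0P x)) // lerDl.
Qed.

(** The letters stand for bounded, measurable, (bounded) support. Such functions are integrable, and
    multiplication by a bounded measurable factor preserves the class. *)
Definition bms f : Prop :=
  [/\ measurable_fun [set: RR * RR] (f : RR * RR -> RR),
      exists C, forall x, `|f x| <= C & exists M, supp_in (box M) f].

Lemma bms_integrable f : bms f -> mu2.-integrable setT (EFin \o f).
Proof.
move=> [mf [C fC] [M fM]].
have -> : EFin \o f = (EFin \o f) \_ (box M).
  apply/funext => x; rewrite patchE; case: ifPn => //; rewrite notin_setE => Mx.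
  have /eqP fx0 : f x == 0 by apply/negPn/negP => /fM.
  by rewrite /= fx0.
apply/(integrable_mkcond _ (@box_measurable M)).
apply: measurable_bounded_integrable => //.
- exact: (@box_measurable M).
- exact: (@box_measure M).
- exact: measurable_funTS.
- exists C; split; first exact: num_real.
  by move=> D CD x _; exact: le_trans (fC x) (ltW CD).
Qed.

Lemma bms_continuous u M : continuous u -> supp_in (box M) u -> bms u.
Proof.
move=> cu su; split; [exact: continuous_measurable2| |by exists M].
by have [C _ uC] := continuous_bounded cu su; exists C.
Qed.

Lemma bmsM q f : measurable_fun [set: RR * RR] (q : RR * RR -> RR) ->
  (exists Q, forall x, `|q x| <= Q) -> bms f -> bms (fun x => q x * f x).
Proof.
move=> mq [Q qQ] [mf [C fC] [M fM]]; split; first exact: measurable_funM.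
- exists (Q * C) => x; rewrite normrM; apply: ler_pM => //.
- by exists M => x; rewrite mulf_eq0 negb_or => /andP[_ /fM].
Qed.

Lemma translate_supp u M (v : R * R) : supp_in (box M) u ->
  supp_in (box (M + `|v|)) (fun x => u (x + v)).
Proof.
move=> su x /su; rewrite /box /= => xv.
by rewrite -[x](addrK v) (le_trans (ler_normB _ _)) // lerD2r.
Qed.

Lemma integral_translate f (v : R * R) :
  measurable_fun [set: RR * RR] (f : RR * RR -> RR) ->
  \int[mu2]_x f (x + v) = \int[mu2]_x f x.
Proof.
move=> mf; congr fine.
apply: (mpreserving_integral (F := EFin \o f) (mpreserving_translate v)).
exact: measurableT_comp.
Qed.

Lemma measurable_translate f (v : R * R) :
  measurable_fun [set: RR * RR] (f : RR * RR -> RR) ->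
  measurable_fun [set: RR * RR] ((fun x => f (x + v)) : RR * RR -> RR).
Proof.
by move=> mf; have [mT _] := mpreserving_translate v; exact: (measurableT_comp mf mT).
Qed.

End Integration.

(** * Weak derivatives by translation *)

Section Translation.
Context {R : realType}.
Notation RR := (measurableTypeR R).
Notation mu2 := (@lebesgue2 R).
Implicit Types (u v w f q : R * R -> R) (x y : R * R).

Lemma norm_dir i : `|@dir R i| = 1.
Proof.
rewrite prod_normE /dir; case: ifP => _ /=; rewrite normr0 normr1.
  by rewrite max_l // ler01.
by rewrite max_r // ler01.
Qed.

Variables (q : R * R -> R) (Q : R) (w : R * R -> R) (g : 'I_2 -> R * R -> R) (M : R).
Hypothesis mq : measurable_fun [set: RR * RR] (q : RR * RR -> RR).
Hypothesis qQ : forall x, `|q x| <= Q.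
Hypotheses (wg : has_grad w g) (sw : supp_in (box M) w).

Let bms_qw (v : R * R) : bms (fun x => q x * w (x + v)).
Proof.
apply: bmsM => //; first by exists Q.
have cw := has_grad_continuous wg; have sv := @translate_supp _ _ _ v sw.
apply: bms_continuous sv => x; apply: continuous_comp; last exact: cw.
by apply: continuousD; [exact: cvg_id|exact: cst_continuous].
Qed.

Lemma derivative_under_integral i :
  h^-1 *: (\int[mu2]_x (q x * w (x + h *: dir i)) - \int[mu2]_x (q x * w x))
    @[h --> 0^'] --> \int[mu2]_x (q x * g i x).
Proof.
have [L L0 gL] := grad_bounded wg sw.
have sg := grad_supp (@box_closed _ M) wg sw.
pose f (h : R) x := q x * w (x + h *: dir i).
have dline (h : R) x : is_derive h 1 (f ^~ x) (q x * g i (x + h *: dir i)).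
  have d := is_derive_line i x h wg.
  have := is_deriveM (is_derive_cst (q x) h 1) d.
  by rewrite (_ : q x *: _ + _ = q x * g i (x + h *: dir i)) // scaler0 addr0.
have p1 (h : R) x : partial1of2 f h x = q x * g i (x + h *: dir i).
  by rewrite partial1of2E; have [_ ->] := dline h x.
have Q0 : 0 <= Q by exact: le_trans (qQ 0).
have nbox (h : R) : `](-1 : R), 1[%classic h -> `|h *: @dir R i| <= 1.
  rewrite /= in_itv /= -ltr_norml => /ltW h1.
  by rewrite normrZ norm_dir mulr1.
(* Dominating function for |h| < 1: the translated derivative is then supported in the box enlarged
   by 1. *)
pose G x : R := Q * L * \1_(box (M + 1)) x.
have := @cvg_differentiation_under_integral R _ _ mu2 f setT measurableT 0 (-1) 1.
move=> /(_ _ _ _ G) key.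
have {key} : h^-1 *: ((fun x' : R => \int[mu2]_(y in setT) f x' y) (h + 0) -
   (fun x' : R => \int[mu2]_(y in setT) f x' y) 0) @[h --> 0^'] -->
   \int[mu2]_(y in setT) partial1of2 f 0 y.
  apply: key.
  - by rewrite /= in_itv /= ltrN10 ltr01.
  - by move=> h _; apply: bms_integrable; exact: bms_qw.
  - by move=> h x _ _; have [] := dline h x.
  - by move=> x; rewrite /G !mulr_ge0.
  - apply: bms_integrable; split.
    + apply: measurable_funM => //; apply: measurable_indic.
      exact: (@box_measurable _ (M + 1)).
    + exists (Q * L) => x; rewrite /G normrM ger0_norm ?mulr_ge0 //.
      rewrite ler_piMr ?mulr_ge0 // indicE; case: (_ \in _); rewrite ?normr0 ?normr1 //.
    + exists (M + 1) => x; rewrite /G mulf_eq0 negb_or indicE => /andP[_].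
      by case: (boolP (_ \in _)) => [/set_mem //|]; rewrite eqxx.
  - move=> h x h1 _; rewrite p1 normrM /G.
    have [->|/sg gx] := eqVneq (g i (x + h *: dir i)) 0.
      by rewrite normr0 mulr0 !mulr_ge0.
    rewrite indicE mem_set ?mulr1; first exact: ler_pM.
    rewrite /box /= -[x](addrK (h *: dir i)) (le_trans (ler_normB _ _)) //.
    by rewrite lerD // nbox.
have -> : \int[mu2]_(y in setT) partial1of2 f 0 y = \int[mu2]_x (q x * g i x).
  by apply: eq_Rintegral => x _; rewrite p1 scale0r addr0.
set F := (X in fmap X _ --> _ -> _); set F' := (X in _ -> fmap X _ --> _).
have -> // : F = F'; apply/funext => h; rewrite /F /F' /f addr0.
by congr (_ *: (_ - _)); apply: eq_Rintegral => x _; rewrite scale0r addr0.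
Qed.

(** A change of variables moves the shift from [w] onto [q], so that the difference quotient of the
    smooth function becomes one of the rough function. The slack [C * t] admits estimates with an
    error of order t^2; it vanishes in the limit, and only [B] remains. *)
Lemma weak_derivative_bound i (B C t0 : R) : 0 < t0 ->
  (forall t, 0 < t < t0 ->
     `|\int[mu2]_x ((q (x - t *: dir i) - q x) * w x)| <= t * (B + C * t)) ->
  `|\int[mu2]_x (q x * g i x)| <= B.
Proof.
move=> t00 H.
have D := @derivative_under_integral i.
pose F (h : R) := h^-1 *: (\int[mu2]_x (q x * w (x + h *: dir i)) - \int[mu2]_x (q x * w x)).
have cF : (fun h => `|F h|) @ 0^'+ --> `|\int[mu2]_x (q x * g i x)|.
  have sub : (0 : R)^'+ `=>` (0 : R)^'.
    move=> A; rewrite /dnbhs /at_right /within /=.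
    by apply: filterS => x xA x0; apply: xA; rewrite gt_eqF.
  apply: cvg_norm; apply: cvg_trans D; exact: (cvg_app F sub).
have cB : (fun h : R => B + C * h) @ 0^'+ --> B.
  rewrite -[X in _ --> X]addr0 -[X in _ --> _ + X](mulr0 C).
  apply: cvgD; first exact: cvg_cst.
  apply: cvgM; first exact: cvg_cst.
  exact: cvg_within.
apply: (ler_cvg_to cF cB); near=> t.
have t_gt0 : 0 < t by near: t; exact: nbhs_right_gt.
have t_lt : t < t0 by near: t; exact: nbhs_right_lt.
rewrite /F normrZ (ger0_norm (ltW _ : 0 <= t^-1)) ?invr_gt0 //.
rewrite ler_pdivrMl //.
have bq : bms (fun x => q (x - t *: dir i) * w x).
  apply: bmsM; first exact: measurable_translate.
    by exists Q => x.
  by have := bms_continuous (has_grad_continuous wg) sw.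
have := H t; rewrite t_gt0 t_lt => /(_ isT); congr (`|_| <= _).
transitivity (\int[mu2]_x (q (x - t *: dir i) * w x) - \int[mu2]_x (q x * w x)).
  rewrite -RintegralB //; first by apply: eq_Rintegral => x _; rewrite mulrBl.
  - exact: bms_integrable.
  - by have := bms_integrable (bms_qw 0); under eq_fun do rewrite addr0.
congr (_ - _).
rewrite -(@integral_translate _ _ (t *: dir i)); last by have [] := bq.
by apply: eq_Rintegral => x _; rewrite addrK.
Unshelve. all: by end_near.
Qed.

End Translation.

Section Compact_support.
Context {R : realType}.
Notation RR := (measurableTypeR R).
Notation mu2 := (@lebesgue2 R).

(** For q = 1 the translated difference is zero, so the translation bound holds with B = 0. *)
Lemma integral_grad0 (w : R * R -> R) g M i : has_grad w g -> supp_in (box M) w ->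
  \int[mu2]_x g i x = 0.
Proof.
move=> wg sw; apply/eqP; rewrite -normr_le0.
have := @weak_derivative_bound R (cst 1) 1 w g M _ _ wg sw i 0 0 1 ltr01.
under eq_Rintegral do rewrite /= mul1r.
apply => // [|t _]; first by move=> x; rewrite normr1.
under eq_Rintegral do rewrite /= subrr mul0r.
by rewrite Rintegral_cst // !mul0r addr0 mulr0 normr0.
Qed.

End Compact_support.

Section Indicator_bound.
Context {R : realType}.
Notation RR := (measurableTypeR R).
Notation mu2 := (@lebesgue2 R).

Lemma Rintegral_le_indic (f : R * R -> R) (A : set (R * R)) (C m : R) :
  bms f -> measurable (A : set (RR * RR)) -> 0 <= C ->
  (forall x, `|f x| <= C * \1_A x) -> (mu2 A <= m%:E)%E ->
  `|\int[mu2]_x f x| <= C * m.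
Proof.
move=> bf mA C0 fA Am; have If := bms_integrable bf; have [mf _ _] := bf.
rewrite -lee_fin EFin_normr_Rintegral //.
have mEf : measurable_fun [set: RR * RR] (EFin \o f) by exact/measurable_EFinP.
apply: le_trans (le_abse_integral mu2 measurableT mEf) _.
apply: (@le_trans _ _ (\int[mu2]_x (C%:E * (\1_A x)%:E))%E).
  apply: ge0_le_integral => //.
  - by apply/measurable_EFinP/measurableT_comp.
  - by apply/measurable_EFinP; apply: measurable_funM => //; exact: measurable_indic.
  - by move=> x _; rewrite /= lee_fin.
rewrite ge0_integralZl_EFin //; last by apply/measurable_EFinP; exact: measurable_indic.
by rewrite integral_indic // setIT EFinM lee_wpmul2l.
Qed.

End Indicator_bound.

(** * Strips and half-planes *)

Section Stripes.
Context {R : realType}.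
Notation RR := (measurableTypeR R).
Notation mu1 := (@lebesgue_measure R).
Notation mu2 := (@lebesgue2 R).
Implicit Types (x y : R * R) (w : R * R -> R).

Lemma mpreserving_measure (T : R * R -> R * R) (B : set (R * R)) :
  mpreserving T -> measurable (B : set (RR * RR)) -> mu2 (T @^-1` B) = mu2 B.
Proof.
move=> [mT iT] mB.
have mTB : measurable ((T @^-1` B) : set (RR * RR)).
  by rewrite -[X in measurable X]setTI; exact: mT.
have m1 : measurable_fun setT ((EFin \o \1_B) : RR * RR -> \bar R).
  by apply/measurable_EFinP; exact: measurable_indic.
transitivity (\int[mu2]_x (\1_(T @^-1` B) x)%:E)%E.
  by rewrite integral_indic // setIT.
transitivity (\int[mu2]_x (\1_B x)%:E)%E; last by rewrite integral_indic // setIT.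
by rewrite -(iT (EFin \o \1_B)) // => x; rewrite /= lee_fin.
Qed.

Lemma lebesgue2X (a b c d : R) : a <= b -> c <= d ->
  mu2 (`[a, b]%classic `*` `[c, d]%classic) = ((b - a) * (d - c))%:E.
Proof.
move=> ab cd.
have -> : mu2 (`[a, b]%classic `*` `[c, d]%classic) =
    (mu1 `[a, b]%classic * mu1 `[c, d]%classic)%E.
  by apply: product_measure1E; exact: measurable_itv.
have itv (u v : R) : u <= v -> mu1 `[u, v]%classic = (v - u)%:E.
  move=> uv; rewrite lebesgue_measure_itv /= lte_fin; by case: ltgtP uv => // -> _; rewrite subrr.
by rewrite !itv.
Qed.

Variables (a b : R).
Hypothesis ab0 : (a, b) != (0, 0).
Let l x := a * x.1 + b * x.2.

(** Half-open, so that it is exactly the difference of the open half-planes l > s and l > s + e. *)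
Definition strip (s e : R) : set (R * R) := [set x | s < l x <= s + e].

Lemma continuous_l : continuous l.
Proof.
move=> x; have := has_grad_continuous (has_grad_linear a b 0).
by under eq_fun do rewrite addr0; apply.
Qed.

Lemma measurable_l : measurable_fun [set: RR * RR] (l : RR * RR -> RR).
Proof. exact: continuous_measurable2 continuous_l. Qed.

Lemma strip_measurable s e : measurable (strip s e : set (RR * RR)).
Proof.
rewrite (_ : strip s e = l @^-1` `]s, s + e]%classic); last first.
  by apply/seteqP; split => x; rewrite /strip /= in_itv.
by rewrite -[X in measurable X]setTI; apply: measurable_l => //; exact: measurable_itv.
Qed.

(** If a is nonzero, a shear makes the strip vertical, and the piece in the box fits into a
    rectangle of width e / |a| and height 2 M. Otherwise the strip is already horizontal. The
    constant does not depend on s. *)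
Lemma strip_measure M : 0 <= M -> exists2 K, 0 <= K &
  forall s e, 0 <= e -> (mu2 (box M `&` strip s e) <= (K * e)%:E)%E.
Proof.
move=> M0.
have itvP (k y s e : R) : k != 0 -> s < k * y <= s + e ->
    y \in `[(s + e / 2) / k - e / (2 * `|k|), (s + e / 2) / k + e / (2 * `|k|)].
  move=> k0 /andP[H1 H2]; have nk : 0 < `|k| by rewrite normr_gt0.
  rewrite in_itv /= -ler_distl.
  have -> : y - (s + e / 2) / k = (k * y - (s + e / 2)) / k by field.
  rewrite normrM normfV ler_pdivrMr // invfM mulrA divfK ?gt_eqF //.
  by rewrite ler_norml; apply/andP; split; lra.
have K0 (k : R) : 0 <= 2 * M / `|k| by rewrite divr_ge0 // mulr_ge0.
have le (k s e : R) : k != 0 -> 0 <= e ->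
    (s + e / 2) / k - e / (2 * `|k|) <= (s + e / 2) / k + e / (2 * `|k|).
  by move=> k0 e0; rewrite lerD2l ge0_cp // divr_ge0 // mulr_ge0.
have mMM : - M <= M by rewrite ge0_cp.
have [a0|a0] := eqVneq a 0.
  have b0 : b != 0.
    by move: ab0; apply: contra_neq => b0; rewrite a0 b0.
  exists (2 * M / `|b|) => // s e e0.
  pose B : set (R * R) := `[(- M)%R, M]%classic `*`
    `[((s + e / 2) / b - e / (2 * `|b|))%R, ((s + e / 2) / b + e / (2 * `|b|))%R]%classic.
  apply: (@le_trans _ _ (mu2 B)).
    apply: le_measure; rewrite ?inE.
    - by apply: measurableI; [exact: box_measurable|exact: strip_measurable].
    - by apply: measurableX; exact: measurable_itv.
    - move=> x [+ sx]; rewrite boxE => -[x1 x2]; split => //=.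
      by apply: itvP => //; move: sx; rewrite /strip /l /= a0 mul0r add0r.
  rewrite lebesgue2X ?le // lee_fin.
  rewrite le_eqVlt; apply/orP; left; apply/eqP; field.
  by rewrite normr_eq0 b0.
exists (2 * M / `|a|) => // s e e0.
pose B : set (R * R) :=
  `[((s + e / 2) / a - e / (2 * `|a|))%R, ((s + e / 2) / a + e / (2 * `|a|))%R]%classic
   `*` `[(- M)%R, M]%classic.
have mB : measurable (B : set (RR * RR)) by apply: measurableX; exact: measurable_itv.
pose T x : R * R := (x.1 + (b / a * x.2 + 0), x.2).
have pT : mpreserving T by exact: mpreserving_shear1.
apply: (@le_trans _ _ (mu2 (T @^-1` B))).
  apply: le_measure; rewrite ?inE.
  - by apply: measurableI; [exact: box_measurable|exact: strip_measurable].
  - by have [mT _] := pT; rewrite -[X in measurable X]setTI; exact: mT.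
  - move=> x [+ sx]; rewrite boxE => -[x1 x2]; split => //=.
    apply: itvP => //; move: sx; rewrite /strip /l /=.
    by rewrite (_ : a * (x.1 + _) = a * x.1 + b * x.2) //; field.
rewrite mpreserving_measure // lebesgue2X ?le // lee_fin.
rewrite le_eqVlt; apply/orP; left; apply/eqP; field.
by rewrite normr_eq0 a0.
Qed.

Definition halfplane (s : R) (x : R * R) : R := (s < l x)%R%:R.

Lemma measurable_halfplane s :
  measurable_fun [set: RR * RR] (halfplane s : RR * RR -> RR).
Proof.
rewrite (_ : halfplane s = \1_(l @^-1` `]s, +oo[%classic)).
  apply: measurable_indic; rewrite -[X in measurable X]setTI.
  by apply: measurable_l => //; exact: measurable_itv.
apply/funext => x; rewrite /halfplane indicE; congr (_ %:R); congr nat_of_bool.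
by apply/idP/idP; rewrite inE /= in_itv /= andbT.
Qed.

Lemma norm_halfplane s x : `|halfplane s x| <= 1.
Proof. by rewrite /halfplane; case: (_ < _); rewrite ?normr1 ?normr0. Qed.

(** A shift by t changes l by at most t N, so the indicator function changes only in a strip of
    width 2 t N around the edge. As [K] is independent of s, it serves all edges of a laminate at
    once. *)
Lemma halfplane_variation M : 0 <= M -> exists2 K, 0 <= K &
  forall s w g C i, has_grad w g -> supp_in (box M) w -> 0 <= C ->
    (forall x, `|w x| <= C) -> `|\int[mu2]_x (halfplane s x * g i x)| <= C * K.
Proof.
move=> M0; have [K K0 KP] := strip_measure M0; pose N := `|a| + `|b|.
have N0 : 0 <= N by rewrite addr_ge0.
exists (K * (2 * N)) => [|s w g C i wg sw C0 wC]; first by rewrite !mulr_ge0.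
apply: (weak_derivative_bound (measurable_halfplane s) (norm_halfplane s) wg sw
  (C := 0) ltr01) => t /andP[t0 _].
rewrite mul0r addr0.
have -> : t * (C * (K * (2 * N))) = C * (K * (2 * (t * N))) by ring.
have bw := bms_continuous (has_grad_continuous wg) sw.
apply: (Rintegral_le_indic _ _ _ _ (KP (s - t * N) (2 * (t * N)) _)) => //.
- apply: bmsM => //; first apply: measurable_funB.
  + by apply: (measurable_translate (- (t *: dir i))); exact: measurable_halfplane.
  + exact: measurable_halfplane.
  + exists 2 => x; rewrite (le_trans (ler_normB _ _)) //.
    by rewrite -[2]/(1 + 1) lerD // norm_halfplane.
- by apply: measurableI; [exact: box_measurable|exact: strip_measurable].
- move=> x; have [->|wx] := eqVneq (w x) 0; first by rewrite mulr0 normr0 mulr_ge0.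
  have lN : `|l (t *: dir i)| <= t * N.
    rewrite /l /dir; case: ifP => _ /=.
      rewrite -[t *: 1]/(t * 1) -[t *: 0]/(t * 0) mulr0 mulr0 addr0 mulr1.
      by rewrite normrM (gtr0_norm t0) mulrC ler_pM2l // lerDl.
    rewrite -[t *: 1]/(t * 1) -[t *: 0]/(t * 0) mulr0 mulr0 add0r mulr1.
    by rewrite normrM (gtr0_norm t0) mulrC ler_pM2l // lerDr.
  have lB : l (x - t *: dir i) = l x - l (t *: dir i).
    by rewrite /l /=; ring.
  rewrite normrM mulrC; apply: ler_pM => //.
  have [sx|sx] := boolP (x \in strip (s - t * N) (2 * (t * N))).
    rewrite indicE mem_set; last by split; [exact: sw|exact: set_mem].
    rewrite /halfplane; case: (_ < _); case: (_ < _);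
      by rewrite ?subrr ?subr0 ?sub0r ?normrN ?normr0 ?normr1 ?ler01.
  suff -> : halfplane s (x - t *: dir i) = halfplane s x by rewrite subrr normr0.
  rewrite /halfplane lB; congr (_ %:R); congr nat_of_bool.
  move: sx; rewrite notin_setE /strip /= => /negP; rewrite negb_and -!leNgt -ltNge.
  move: lN; rewrite ler_norml => /andP[l1 l2] /orP[h|h].
    by apply/idP/idP => h'; lra.
  by apply/idP/idP => h'; lra.
- by rewrite !mulr_ge0 // ltW.
Qed.

End Stripes.

(** * Laminates *)

Section Ramp.
Context {R : realType}.
Implicit Types (t e : R) (F G : R -> R).

Definition pos t : R := Num.max t 0.

Lemma pos_le0 t : t <= 0 -> pos t = 0. Proof. exact: max_r. Qed.

Lemma pos_id t : 0 <= t -> pos t = t. Proof. exact: max_l. Qed.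

Lemma pos_lipschitz s t : `|pos s - pos t| <= `|s - t|.
Proof.
have [s0|/ltW s0] := leP s 0; have [t0|/ltW t0] := leP t 0;
  rewrite ?(pos_le0 s0) ?(pos_le0 t0) ?(pos_id s0) ?(pos_id t0) //.
- by rewrite subrr normr0.
- by rewrite sub0r normrN [X in _ <= X]distrC !ger0_norm ?subr_ge0 //; lra.
- by rewrite subr0 !ger0_norm ?subr_ge0 //; lra.
Qed.

Lemma continuous_pos : continuous pos.
Proof.
move=> t; apply/cvgrPdist_le => e e0.
have : \forall s \near t, `|t - s| <= e by apply/nbhs_ballP; exists e => // s /ltW.
by apply: filterS => s; exact: le_trans (pos_lipschitz t s).
Qed.

(** This C^1 function that vanishes on a half-line is the building block of the smoothed sawtooth,
    the cutoffs and the partition of unity. In all four sign cases the difference quotient deviates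
    from [pos t] by at most |h|. *)
Lemma is_derive_pos_sq t : is_derive t 1 (fun t => pos t ^+ 2 / 2) (pos t).
Proof.
pose F h := h^-1 *: (((fun t => pos t ^+ 2 / 2) \o shift t) (h *: 1) - pos t ^+ 2 / 2).
suff cF : F @ 0^' --> pos t.
  by split; [apply/cvg_ex; exists (pos t)|exact/cvg_lim].
apply/cvgrPdist_le => e e0; near=> h.
have h0 : h != 0 by near: h; exact: nbhs_dnbhs_neq.
have he : `|h| <= e.
  near: h; apply: nbhs_dnbhs.
  by apply/nbhs_ballP; exists e => // s /ltW; rewrite distrC subr0.
apply: le_trans he.
rewrite /F /= -[h *: 1]/(h * 1) mulr1 -[_ *: _]/(_ * _).
have -> : pos t - h^-1 * (pos (h + t) ^+ 2 / 2 - pos t ^+ 2 / 2) =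
    h^-1 * (h * pos t - (pos (h + t) ^+ 2 / 2 - pos t ^+ 2 / 2)).
  by rewrite [RHS]mulrBr mulKf.
rewrite normrM normfV ler_pdivrMl ?normr_gt0 // -expr2 real_normK ?num_real //.
have [a0|/ltW a0] := leP t 0; have [b0|/ltW b0] := leP (h + t) 0;
  rewrite ?(pos_le0 a0) ?(pos_le0 b0) ?(pos_id a0) ?(pos_id b0) ler_norml;
  by apply/andP; split; nra.
Unshelve. all: by end_near. Qed.

(** For e > 0 a C^1 smoothing of [pos]: it is 0 for t <= 0, t^2 / (2 e) on [0, e] and t - e / 2
    beyond. Its derivative [step e] rises linearly from 0 to 1 on [0, e]. *)
Definition ramp e t : R := e * (pos (t / e) ^+ 2 / 2 - pos (t / e - 1) ^+ 2 / 2).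

Definition step e t : R := pos (t / e) - pos (t / e - 1).

(** The value 0 at t = 0 makes this the limit of [step e] at every point as e decreases to 0. *)
Definition heaviside t : R := (0 < t)%R%:R.

Lemma is_derive_ramp e t : 0 < e -> is_derive t 1 (ramp e) (step e t).
Proof.
move=> e0.
have d1 : is_derive t 1 (fun t => t / e) e^-1.
  have := @is_deriveZ R R R id e^-1 t 1 1 (is_derive_id _ _).
  rewrite (_ : e^-1 *: 1 = e^-1); last exact: mulr1.
  by congr is_derive; apply/funext => s; exact: mulrC.
have d2 : is_derive t 1 (fun t => t / e - 1) e^-1.
  have := is_deriveB d1 (is_derive_cst (1 : R) t 1).
  by rewrite subr0.
have c1 := @is_derive1_comp R _ (fun t => t / e) t _ _ (is_derive_pos_sq _) d1.
have c2 := @is_derive1_comp R _ (fun t => t / e - 1) t _ _ (is_derive_pos_sq _) d2.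
have := is_deriveZ e (is_deriveB c1 c2).
rewrite (_ : e *: (_ - _) = step e t); first exact.
rewrite -[LHS]/(e * (pos (t / e) / e - pos (t / e - 1) / e)) /step.
by field; rewrite gt_eqF.
Qed.

Lemma continuous_step e : continuous (step e).
Proof.
move=> t; apply: (@continuousB _ _ _ (fun t => pos (t / e)) (fun t => pos (t / e - 1))).
  apply: continuous_comp; last exact: continuous_pos.
  by apply: continuousM; [exact: cvg_id|exact: cst_continuous].
apply: continuous_comp; last exact: continuous_pos.
apply: (@continuousB _ _ _ (fun t => t / e) (cst 1)); last exact: cst_continuous.
by apply: continuousM; [exact: cvg_id|exact: cst_continuous].
Qed.

Lemma ramp_pos e t : 0 < e -> `|ramp e t - pos t| <= e.
Proof.
move=> e0; set s := t / e; have ts : t = e * s by rewrite /s mulrC divfK // gt_eqF.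
have -> : pos t = e * pos s.
  rewrite ts; have [s0|/ltW s0] := leP s 0.
    by rewrite !pos_le0 ?mulr0 // pmulr_rle0.
  by rewrite !pos_id // mulr_ge0 // ltW.
rewrite /ramp -/s -mulrBr normrM (gtr0_norm e0); apply: (ler_piMr (ltW e0)).
have [s0|/ltW s0] := leP s 0.
  have s1 : s - 1 <= 0 by lra.
  by rewrite (pos_le0 s0) (pos_le0 s1) ler_norml; apply/andP; split; lra.
have [s1|/ltW s1] := leP s 1.
  have s2 : s - 1 <= 0 by lra.
  rewrite (pos_id s0) (pos_le0 s2) ler_norml.
  by apply/andP; split; nra.
have s2 : 0 <= s - 1 by lra.
rewrite (pos_id s0) (pos_id s2) ler_norml.
by apply/andP; split; nra.
Qed.

Lemma step_le0 e t : 0 < e -> t <= 0 -> step e t = 0.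
Proof.
move=> e0 t0; have s0 : t / e <= 0 by rewrite pmulr_lle0 ?invr_gt0.
have s1 : t / e - 1 <= 0 by lra.
by rewrite /step (pos_le0 s0) (pos_le0 s1) subrr.
Qed.

Lemma step_ge e t : 0 < e -> e <= t -> step e t = 1.
Proof.
move=> e0 et; have s0 : 1 <= t / e by rewrite ler_pdivlMr // mul1r.
have [s1 s2] : 0 <= t / e /\ 0 <= t / e - 1 by split; lra.
by rewrite /step (pos_id s1) (pos_id s2); lra.
Qed.

Lemma step_itv e t : 0 <= step e t <= 1.
Proof.
rewrite /step; set s := t / e.
have [s0|/ltW s0] := leP s 0.
  have s1 : s - 1 <= 0 by lra.
  by rewrite (pos_le0 s0) (pos_le0 s1); lra.
have [s1|/ltW s1] := leP s 1.
  have s2 : s - 1 <= 0 by lra.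
  by rewrite (pos_id s0) (pos_le0 s2); lra.
have s2 : 0 <= s - 1 by lra.
by rewrite (pos_id s0) (pos_id s2); lra.
Qed.

End Ramp.

(** * Periodic stripes and the sawtooth in one variable *)

Section Comb.
Context {R : realType}.
Implicit Types (t e : R) (F G : R -> R).
Variables (N : nat) (h c : R).
Hypotheses (h0 : 0 <= h) (c01 : 0 <= c <= 1).

(** Since [g] lives on (0, h], at most one of its translates is nonzero at a given t, and the sum is
    either 0 or a single value of [g]. *)
Lemma sum_cells (P : R -> Prop) (g : R -> R) t : P 0 -> (forall s, P (g s)) ->
  (forall s, s <= 0 -> g s = 0) -> (forall s, h < s -> g s = 0) ->
  P (\sum_(j < N) g (t - j%:R * h)).
Proof.
move=> P0 Pg g0 gh; elim: N => [|n IH]; first by rewrite big_ord0.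
rewrite big_ord_recr /=; have [tn|tn] := leP (t - n%:R * h) 0.
  by rewrite g0 // addr0.
rewrite big1 ?add0r // => j _; apply: gh.
have jn : j.+1%:R * h <= n%:R * h by rewrite ler_wpM2r // ler_nat ltn_ord.
by move: jn; rewrite -natr1 mulrDl mul1r => jn; lra.
Qed.

(* For F the Heaviside function, comb F is [phase - c] on N periods of length h,
   where [phase] has proportion c of each period; for F = pos it is the
   corresponding sawtooth, with values in [0, h]. *)
Definition cell F t : R := F t - F (t - c * h) - c * (F t - F (t - h)).

Definition comb F t : R := \sum_(j < N) cell F (t - j%:R * h).

Definition phase t : R :=
  \sum_(j < N) (heaviside (t - j%:R * h) - heaviside (t - j%:R * h - c * h)).

(** Each cell is a tent: it rises with slope 1 - c up to c h, then falls with slope -c and is back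
    at 0 at h. *)
Lemma comb_pos t : 0 <= comb pos t <= h.
Proof.
have /andP[c0 c1] := c01.
have ch0 : 0 <= c * h by exact: mulr_ge0.
have ch1 : c * h <= h by rewrite ler_piMl.
apply: (sum_cells (P := fun y => 0 <= y <= h)) => [|s|s s0|s hs].
- by rewrite lexx.
- rewrite /cell.
  have [s0|/ltW s0] := leP s 0.
    have [s1 s2] : s - c * h <= 0 /\ s - h <= 0 by split; lra.
    by rewrite (pos_le0 s0) (pos_le0 s1) (pos_le0 s2) !subrr mulr0 subr0 lexx.
  have [s1|/ltW s1] := leP s (c * h).
    rewrite (pos_id s0) (pos_le0 (_ : s - c * h <= 0)) ?subr_le0 //.
    rewrite (pos_le0 (_ : s - h <= 0)) ?subr_le0 ?(le_trans s1) //.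
    have cs0 : 0 <= c * s by exact: mulr_ge0.
    have cs1 : c * s <= s by rewrite ler_piMl.
    by rewrite !subr0; lra.
  rewrite (pos_id s0) (pos_id (_ : 0 <= s - c * h)) ?subr_ge0 //.
  have [s2|/ltW s2] := leP s h.
    rewrite (pos_le0 (_ : s - h <= 0)) ?subr_le0 //.
    have cs0 : 0 <= c * s by exact: mulr_ge0.
    have cs1 : c * s <= c * h by rewrite ler_wpM2l.
    by rewrite !subr0; lra.
  rewrite (pos_id (_ : 0 <= s - h)) ?subr_ge0 //.
  have -> : s - (s - h) = h by ring.
  have -> : s - (s - c * h) = c * h by ring.
  by rewrite lexx subrr.
- have [s1 s2] : s - c * h <= 0 /\ s - h <= 0 by split; lra.
  by rewrite /cell (pos_le0 s0) (pos_le0 s1) (pos_le0 s2) !subrr mulr0 subr0.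
- have [s0 s1 s2] : [/\ 0 <= s, 0 <= s - c * h & 0 <= s - h] by split; lra.
  by rewrite /cell (pos_id s0) (pos_id s1) (pos_id s2); ring.
Qed.

Lemma phase01 t : phase t = 0 \/ phase t = 1.
Proof.
have /andP[c0 c1] := c01.
have ch0 : 0 <= c * h by exact: mulr_ge0.
have ch1 : c * h <= h by rewrite ler_piMl.
apply: (sum_cells (P := fun y => y = 0 \/ y = 1)
  (g := fun s => heaviside s - heaviside (s - c * h))) => [|s|s s0|s hs].
- by left.
- rewrite /heaviside; case: ltP => s0; case: ltP => s1;
    rewrite ?subrr ?subr0; [by left|by right|lra|by left].
- by rewrite /heaviside !ltNge s0 (_ : s - c * h <= 0) ?subrr //; lra.
- have [s0 s1] : 0 < s /\ 0 < s - c * h by split; lra.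
  by rewrite /heaviside s0 s1 subrr.
Qed.

(** The subtracted terms telescope over the periods to the indicator function of (0, N h], so within
    that range exactly c is subtracted. *)
Lemma comb_heaviside t : 0 < t -> t <= N%:R * h -> comb heaviside t = phase t - c.
Proof.
move=> t0 tN; rewrite /comb /cell sumrB -/(phase t) -mulr_sumr.
have -> : \sum_(j < N) (heaviside (t - j%:R * h) - heaviside (t - j%:R * h - h)) =
    heaviside t - heaviside (t - N%:R * h).
  elim: N => [|n IH]; first by rewrite big_ord0 mul0r subr0 subrr.
  rewrite big_ord_recr /= IH -natr1.
  rewrite (_ : t - (n%:R + 1) * h = t - n%:R * h - h); first by ring.
  by ring.
by rewrite /heaviside t0 ltNge subr_le0 tN subr0 mulr1.
Qed.

(** A cell evaluates [F] in four terms with coefficients of size at most 1, whence 4 d per cell. The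
    factor [N] is harmless because the number of periods is fixed before the smoothing width. *)
Lemma comb_dist F G d t : (forall s, `|F s - G s| <= d) ->
  `|comb F t - comb G t| <= N%:R * (4 * d).
Proof.
move=> FG; have /andP[c0 c1] := c01.
have d0 : 0 <= d by exact: le_trans (FG 0).
rewrite /comb -sumrB (le_trans (ler_norm_sum _ _ _)) //.
apply: (@le_trans _ _ (\sum_(j < N) (4 * d))); last first.
  by rewrite sumr_const card_ord -[X in X <= _]mulr_natl lexx.
apply: ler_sum => j _; set s := t - _; rewrite /cell.
move: (FG s) (FG (s - c * h)) (FG (s - h)).
move: (F s) (F (s - c * h)) (F (s - h)) (G s) (G (s - c * h)) (G (s - h)).
move=> f1 f2 f3 g1 g2 g3 a1 a2 a3.
have -> : f1 - f2 - c * (f1 - f3) - (g1 - g2 - c * (g1 - g3)) =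
  (f1 - g1) - (f2 - g2) - c * ((f1 - g1) - (f3 - g3)) by ring.
have a4 : `|c * ((f1 - g1) - (f3 - g3))| <= d + d.
  rewrite normrM (ger0_norm c0) (le_trans (ler_piMl _ c1)) //.
  by rewrite (le_trans (ler_normB _ _)) // lerD.
rewrite (le_trans (ler_normB _ _)) // (_ : 4 * d = d + d + (d + d)); last by ring.
by rewrite lerD // (le_trans (ler_normB _ _)) // lerD.
Qed.

Lemma comb_cvg (F : nat -> R -> R) G t : (forall s, F ^~ s @ \oo --> G s) ->
  (fun n => comb (F n) t) @ \oo --> comb G t.
Proof.
move=> FG; rewrite /comb; elim: N => [|n IH].
  rewrite big_ord0; under eq_fun do rewrite big_ord0; exact: cvg_cst.
rewrite big_ord_recr /=; under eq_fun do rewrite big_ord_recr /=.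
apply: cvgD => //; rewrite /cell; apply: cvgB; first by apply: cvgB; exact: FG.
by apply: cvgM; [exact: cvg_cst|apply: cvgB; exact: FG].
Qed.

End Comb.

Lemma phase0 {R : realType} N (h t : R) : phase N h 0 t = 0.
Proof. by rewrite /phase big1 // => j _; rewrite mul0r subr0 subrr. Qed.

Lemma step_cvg {R : realType} (t : R) :
  (fun n => step n.+1%:R^-1 t) @ \oo --> heaviside t.
Proof.
rewrite /heaviside; case: ltP => t0; last first.
  by under eq_fun do rewrite step_le0 ?invr_gt0 //; exact: cvg_cst.
apply: cvg_near_cst; near=> n; rewrite step_ge ?invr_gt0 //.
by apply/ltW; near: n; exact: near_infty_natSinv_lt (PosNum t0).
Unshelve. all: by end_near. Qed.

(** * Disc bumps and cutoff functions *)

Section Cutoff.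
Context {R : realType}.
Notation RR := (measurableTypeR R).
Notation mu2 := (@lebesgue2 R).
Implicit Types (u v w : R * R -> R) (x y : R * R) (Omega : set (R * R)).

Lemma has_gradV u g : has_grad u g -> (forall x, 0 < u x) ->
  has_grad (fun x => (u x)^-1) (fun i x => - (u x) ^- 2 * g i x).
Proof.
move=> ug u0; apply: (has_grad_comp (f := fun t => t^-1) (f' := fun t => - t ^- 2) ug) => x.
  have := is_deriveV (lt0r_neq0 (u0 x)) (is_derive_id (u x) (1 : R)).
  by rewrite (_ : _ *: 1 = - u x ^- 2) //; exact: mulr1.
have ux : u x ^+ 2 != 0 by rewrite expf_neq0 // gt_eqF.
apply: (@continuousN _ _ _ (fun t : R => t ^- 2)).
apply: (@continuousV _ _ (fun t : R => t ^+ 2)) => //.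
exact: exprn_continuous.
Qed.

Lemma supp_in_sub (A B : set (R * R)) u : A `<=` B -> supp_in A u -> supp_in B u.
Proof. by move=> AB su x /su; exact: AB. Qed.

Lemma C1c_supp Omega u : C1c Omega u ->
  supp_in Omega u /\ forall i, supp_in Omega (partial i u).
Proof.
move=> [/C1P ug _ sO]; split; first by move=> x ux; apply: sO; exact: subset_closure.
move=> i; apply: (supp_in_sub sO).
have := @grad_supp R u _ _ i (@closed_closure _ [set x | u x != 0]) ug.
by apply=> x ux; exact: subset_closure.
Qed.

Lemma has_grad_C1c Omega u g (K : set (R * R)) : has_grad u g -> compact K ->
  K `<=` Omega -> supp_in K u -> C1c Omega u.
Proof.
move=> ug cK KO su.
have clK : closed K by apply: compact_closed => //; exact: norm_hausdorff.
have sub : closure [set x | u x != 0] `<=` K.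
  by rewrite closureE; apply: smallest_sub => // x /su.
split; [exact: has_grad_C1 ug| |by apply: subset_trans KO].
by apply: subclosed_compact cK sub; exact: closed_closure.
Qed.

Lemma Rintegral_supp (D : set (R * R)) (f : R * R -> R) : supp_in D f ->
  \int[mu2]_(x in D) f x = \int[mu2]_x f x.
Proof.
move=> sf; rewrite Rintegral_mkcond; apply: eq_Rintegral => x _.
rewrite patchE; case: ifPn => //; rewrite notin_setE => Dx.
by apply/esym/eqP/negPn/negP => /sf.
Qed.

Lemma bounded_box (A : set (R * R)) : bounded_set A -> exists2 M, 0 < M & A `<=` box M.
Proof.
move=> [M [_ MP]]; exists (`|M| + 1); first exact: ltr_wpDl.
by apply: MP; rewrite (le_lt_trans (ler_norm _)) // ltrDl.
Qed.

(** Euclidean, whereas the norm of the plane is the maximum norm: this one is smooth and invariant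
    under the rotation in a chart. *)
Definition sqdist x y : R := (x.1 - y.1) * (x.1 - y.1) + (x.2 - y.2) * (x.2 - y.2).

Definition disc y (r : R) : set (R * R) := [set x | sqdist x y <= r ^+ 2].

Definition disc_bump y (r : R) x : R := pos (r ^+ 2 - sqdist x y) ^+ 2 / 2.

Lemma has_grad_sqdist y : exists g, has_grad (sqdist ^~ y) g.
Proof.
have l1 : has_grad (fun x => x.1 - y.1) (fun i _ => if i == 0 then 1 else 0).
  by apply: has_grad_ext (has_grad_linear 1 0 (- y.1)) _ _ => // x; ring.
have l2 : has_grad (fun x => x.2 - y.2) (fun i _ => if i == 0 then 0 else 1).
  by apply: has_grad_ext (has_grad_linear 0 1 (- y.2)) _ _ => // x; ring.
by eexists; exact: (has_gradD (has_gradM l1 l1) (has_gradM l2 l2)).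
Qed.

Lemma continuous_sqdist y : continuous (sqdist ^~ y).
Proof. by have [g /has_grad_continuous] := has_grad_sqdist y. Qed.

Lemma has_grad_bump y r : exists g, has_grad (disc_bump y r) g.
Proof.
have [g sg] := has_grad_sqdist y; eexists.
have dg := has_gradD (has_grad_cst (r ^+ 2)) (has_gradZ (-1) sg).
apply: has_grad_ext (has_grad_comp (f := fun t => pos t ^+ 2 / 2) (f' := pos) dg _ _) _ _.
- by move=> x; exact: is_derive_pos_sq.
- by move=> x; exact: continuous_pos.
- by move=> x; rewrite /= mulN1r.
- by [].
Qed.

Lemma bump_ge0 y r x : 0 <= disc_bump y r x.
Proof. by rewrite /disc_bump divr_ge0 // sqr_ge0. Qed.

Lemma bump_gt0 y r x : (0 < disc_bump y r x) = (sqdist x y < r ^+ 2).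
Proof.
rewrite /disc_bump pmulr_lgt0 ?invr_gt0 //; have [s|s] := ltP (sqdist x y) (r ^+ 2).
  by rewrite pos_id ?subr_ge0 ?ltW // exprn_gt0 // subr_gt0.
by rewrite pos_le0 ?subr_le0 // expr0n ltxx.
Qed.

Lemma bump_supp y r : supp_in (disc y r) (disc_bump y r).
Proof.
by move=> x bx; apply: ltW; rewrite -bump_gt0 lt_neqAle eq_sym bx bump_ge0.
Qed.

Lemma norm_le_of_sum_sqr (u v r : R) : 0 <= r -> u ^+ 2 + v ^+ 2 <= r ^+ 2 -> `|u| <= r.
Proof.
move=> r0 uv; rewrite -(ler_pXn2r (n := 2)) ?nnegrE // real_normK ?num_real //.
by apply: le_trans uv; rewrite lerDl sqr_ge0.
Qed.

Lemma sqdist_norm x y r : 0 <= r -> sqdist x y <= r ^+ 2 -> `|x - y| <= r.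
Proof.
move=> r0; rewrite /sqdist -!expr2 => xr.
rewrite prod_normE ge_max (norm_le_of_sum_sqr r0 xr) /=.
by apply: (norm_le_of_sum_sqr (v := x.1 - y.1)) => //; rewrite addrC.
Qed.

Lemma disc_box y r : 0 <= r -> disc y r `<=` box (`|y| + r).
Proof.
move=> r0 x /(sqdist_norm r0) xr; rewrite /box /=.
by rewrite -[x](subrK y) (le_trans (ler_normD _ _)) // addrC lerD2l.
Qed.

Lemma disc_compact y r : 0 <= r -> compact (disc y r).
Proof.
move=> r0; apply: subclosed_compact (@box_compact _ _) (disc_box r0).
rewrite (_ : disc y r = (sqdist ^~ y) @^-1` [set t | t <= r ^+ 2]) //.
apply: closed_comp; last exact: closed_le.
by move=> x _; exact: continuous_sqdist.
Qed.

Lemma finite_measure_box Omega M : measurable (Omega : set (RR * RR)) ->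
  Omega `<=` box M -> (mu2 Omega < +oo)%E.
Proof.
move=> mO OM; apply: le_lt_trans (@box_measure R M).
by apply: le_measure; rewrite ?inE //; exact: box_measurable.
Qed.

Lemma bounded_integrable (D : set (R * R)) (f : R * R -> R) C :
  measurable (D : set (RR * RR)) -> (mu2 D < +oo)%E ->
  measurable_fun (D : set (RR * RR)) (f : RR * RR -> RR) ->
  (forall x, D x -> `|f x| <= C) -> mu2.-integrable D (EFin \o f).
Proof.
move=> mD Doo mf fC; apply: measurable_bounded_integrable => //.
exists C; split; first exact: num_real.
by move=> C' CC' x Dx; exact: le_trans (fC x Dx) (ltW CC').
Qed.

Lemma Rintegral_cvg0 (D : set (R * R)) (f : nat -> R * R -> R) C :
  measurable (D : set (RR * RR)) -> (mu2 D < +oo)%E ->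
  (forall n, measurable_fun (D : set (RR * RR)) (f n : RR * RR -> RR)) ->
  (forall n x, D x -> `|f n x| <= C) -> (forall x, D x -> f ^~ x @ \oo --> 0) ->
  (fun n => \int[mu2]_(x in D) f n x) @ \oo --> 0.
Proof.
move=> mD Doo mf fC f0.
have [||||| _ _ cvg] := @dominated_convergence _ _ R mu2 D mD
    (fun n => EFin \o f n) (cst 0%E) (cst C%:E).
- by move=> n; apply/measurable_EFinP; exact: mf.
- exact: measurable_cst.
- by apply: aeW => x Dx; apply: cvg_EFin; [exact: nearW|exact: f0].
- exact: (@bounded_integrable D (cst C) `|C| mD Doo).
- by apply: aeW => x n Dx; rewrite /= lee_fin fC.
have {}cvg : (fun n => \int[mu2]_(x in D) (EFin \o f n) x)%E @ \oo --> 0%:E.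
  by move: cvg; rewrite integral0.
exact: (fine_cvg cvg).
Qed.

(** With S_n the sum of the first n bumps on rational discs inside Omega, theta is 1 - 1 / (1 + n
    S_n) for a large n. Every point of Omega lies in one of these discs, so n S_n tends to infinity
    there, and the integral of 1 - theta tends to 0 by dominated convergence. Each S_n involves
    finitely many discs and is thus compactly supported in Omega. *)
Lemma cutoff Omega M (e : R) : open Omega -> Omega `<=` box M -> 0 < e ->
  exists theta, [/\ C1c Omega theta, forall x, 0 <= theta x <= 1
    & \int[mu2]_(x in Omega) (1 - theta x) <= e].
Proof.
move=> oO OM e0; have mO := open_measurable2 oO.
have Ooo := finite_measure_box mO OM.
pose ctr (p : rat * rat * rat) : R * R := (ratr p.1.1, ratr p.1.2).
pose r (p : rat * rat * rat) : R := ratr p.2.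
pose good p := 0 <= r p /\ disc (ctr p) (r p) `<=` Omega.
(* The discs are enumerated by the codes of rational triples; a number that codes no disc inside
   Omega contributes the zero function. *)
pose B n x : R := if unpickle n is Some p then
  (if `[< good p >] then disc_bump (ctr p) (r p) x else 0) else 0.
have B0 n x : 0 <= B n x.
  by rewrite /B; case: unpickle => // p; case: asboolP => // _; exact: bump_ge0.
have Bg n : exists g, has_grad (B n) g.
  have z : exists g, has_grad (fun _ : R * R => 0 : R) g by eexists; exact: has_grad_cst.
  by rewrite /B; case: unpickle => // p; case: asboolP => // _; exact: has_grad_bump.
have BK n : exists K, [/\ compact K, K `<=` Omega & supp_in K (B n)].
  have z : exists K, [/\ compact K, K `<=` Omega & supp_in K (fun _ : R * R => 0 : R)].
    by exists set0; split; [exact: compact0| |move=> x; rewrite eqxx].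
  rewrite /B; case: unpickle => // p; case: asboolP => // -[r0 sub].
  by exists (disc (ctr p) (r p)); split => //; [exact: disc_compact|exact: bump_supp].
pose S n x : R := \sum_(k < n) B k x.
have S0 n x : 0 <= S n x by exact: sumr_ge0.
have Sg n : exists g, has_grad (S n) g.
  elim: n => [|n [g IH]].
    exists (fun i => cst 0); apply: has_grad_ext (has_grad_cst 0) _ _ => //= x.
    by rewrite /S big_ord0.
  have [h Bh] := Bg n; eexists; apply: has_grad_ext (has_gradD IH Bh) _ _ => //= x.
  by rewrite /S big_ord_recr.
have SK n : exists K, [/\ compact K, K `<=` Omega & supp_in K (S n)].
  elim: n => [|n [K [cK KO sK]]].
    exists set0; split; [exact: compact0|by []|].
    by move=> x; rewrite /S big_ord0 eqxx.
  have [L [cL LO sL]] := BK n; exists (K `|` L); split.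
  - exact: compactU.
  - by rewrite subUset.
  - move=> x; rewrite /S big_ord_recr /= -/(S n x).
    have [Sx|/sK Kx _] := eqVneq (S n x) 0; last by left.
    by rewrite Sx add0r => /sL; right.
have Spos x : Omega x -> exists n, forall m, (n < m)%N -> B n x <= S m x /\ 0 < B n x.
  move=> Ox; have /nbhs_ballP[eps /= eps0 epsO] := oO _ Ox.
  (* Take a rational radius q < eps / 4 and a rational centre within q / 2 of x in each coordinate.
     Then x is inside the disc, as q^2 / 2 < q^2, and the disc stays within 3 q / 2 < eps of x. *)
  have [q /itvP qP] : exists q : rat, ratr q \in `](0 : R), eps / 4[.
    by apply: rat_in_itvoo; rewrite divr_gt0.
  have [q0 q4] : 0 < ratr q :> R /\ ratr q < eps / 4 by rewrite !qP.
  have [p1 /itvP p1P] : exists p : rat, ratr p \in `](x.1 - ratr q / 2), x.1 + ratr q / 2[.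
    by apply: rat_in_itvoo; lra.
  have [p2 /itvP p2P] : exists p : rat, ratr p \in `](x.2 - ratr q / 2), x.2 + ratr q / 2[.
    by apply: rat_in_itvoo; lra.
  have [a1 a2] : x.1 - ratr q / 2 < ratr p1 /\ ratr p1 < x.1 + ratr q / 2 by rewrite !p1P.
  have [b1 b2] : x.2 - ratr q / 2 < ratr p2 /\ ratr p2 < x.2 + ratr q / 2 by rewrite !p2P.
  pose p := (p1, p2, q).
  have gp : good p.
    split; first by rewrite /r /= ltW.
    move=> y yp; apply: epsO; rewrite ball_prod_normE /ball_ /=.
    have yc : `|y - ctr p| <= ratr q by apply: sqdist_norm => //; exact: ltW.
    have xc : `|x - ctr p| <= ratr q / 2.
      by rewrite prod_normE ge_max /= !ler_norml; apply/andP; split; apply/andP; split; lra.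
    rewrite -[x](subrK (ctr p)) -addrA (le_lt_trans (ler_normD _ _)) //.
    by rewrite [X in _ + X]distrC; lra.
  have Bp : B (pickle p) x = disc_bump (ctr p) (r p) x.
    by rewrite /B pickleK; case: asboolP.
  exists (pickle p) => m pm; rewrite Bp; split.
    rewrite -Bp /S (bigD1 (Ordinal pm)) //= lerDl.
    by apply: sumr_ge0 => k _; exact: B0.
  rewrite bump_gt0 /sqdist /ctr /r /=.
  by nra.
have S1 n x : 1 <= 1 + n%:R * S n x by rewrite lerDl mulr_ge0.
have S1pos n x : 0 < 1 + n%:R * S n x by exact: lt_le_trans (S1 n x).
have invg n : exists g, has_grad (fun x => (1 + n%:R * S n x)^-1) g.
  have [g Sng] := Sg n; eexists; apply: has_gradV (S1pos n).
  exact: (has_gradD (has_grad_cst 1) (has_gradZ n%:R Sng)).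
have inv01 n x : 0 <= (1 + n%:R * S n x)^-1 <= 1.
  by rewrite invr_ge0 ltW ?S1pos //= invf_le1.
have cvg : (fun n => \int[mu2]_(x in Omega) (1 + n%:R * S n x)^-1) @ \oo --> 0.
  apply: (Rintegral_cvg0 (C := 1)) => //.
  - move=> n; apply: measurable_funTS; apply: continuous_measurable2.
    by have [g /has_grad_continuous] := invg n.
  - by move=> n x _; have /andP[i0 i1] := inv01 n x; rewrite ger0_norm.
  - move=> x /Spos[n nP]; have [_ B1] := nP n.+1 (ltnSn n).
    apply/cvgrPdist_le => d d0; near=> m.
    have [nm _] : B n x <= S m x /\ 0 < B n x by apply: nP; near: m; exact: nbhs_infty_gt.
    have /andP[i0 i1] := inv01 m x.
    rewrite sub0r normrN ger0_norm // -[d]invrK lef_pV2 ?posrE ?invr_gt0 ?S1pos //.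
    have md : (d * B n x)^-1 <= m%:R.
      by near: m; exact: nbhs_infty_ger.
    rewrite ler_wpDl //; apply: le_trans (ler_wpM2l _ nm) => //.
    by rewrite -ler_pdivrMr // -invfM.
have /cvgrPdist_le/(_ e e0)[n _ /(_ n (leqnn n))] := cvg.
rewrite /= sub0r normrN => /(le_trans (ler_norm _)) ne.
have [g Sg'] := invg n; have [K [cK KO sK]] := SK n.
have tg := has_gradD (has_grad_cst 1) (has_gradZ (-1) Sg').
exists (fun x => 1 - (1 + n%:R * S n x)^-1); split.
- apply: (has_grad_C1c (K := K) (has_grad_ext tg _ _)) => //.
    by move=> x /=; rewrite mulN1r.
  move=> x; have [->|/sK//] := eqVneq (S n x) 0.
  by rewrite mulr0 addr0 invr1 subrr eqxx.
- by move=> x; have /andP[i0 i1] := inv01 n x; lra.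
- apply: le_trans ne; rewrite le_eqVlt; apply/orP; left; apply/eqP.
  by apply: eq_Rintegral => x _; rewrite opprB addrC subrK.
Unshelve. all: by end_near. Qed.

End Cutoff.

(** * Stripes in a planar domain: volume and variation *)

Section Laminate.
Context {R : realType}.
Notation RR := (measurableTypeR R).
Notation mu2 := (@lebesgue2 R).
Implicit Types (u v w : R * R -> R) (x y : R * R).

Lemma Rintegral_sum (D : set (R * R)) n (F : nat -> R * R -> R) :
  measurable (D : set (RR * RR)) ->
  (forall j, mu2.-integrable D (EFin \o F j)) ->
  mu2.-integrable D (EFin \o (fun x => \sum_(j < n) F j x)) /\
  \int[mu2]_(x in D) (\sum_(j < n) F j x) = \sum_(j < n) \int[mu2]_(x in D) F j x.
Proof.
move=> mD iF; elim: n => [|n [iS IH]].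
  rewrite (_ : EFin \o _ = cst 0%E).
    split; first exact: integrable0.
    by under eq_Rintegral do rewrite big_ord0; rewrite big_ord0 Rintegral_cst // mul0r.
  by apply/funext => x; rewrite /= big_ord0.
rewrite big_ord_recr /= -IH -RintegralD //; split.
  rewrite (_ : EFin \o _ = ((EFin \o (fun x => (\sum_(j < n) F j x)%R)) \+ (EFin \o F n))%E).
    exact: integrableD.
  by apply/funext => x; rewrite /= big_ord_recr /= EFinD.
by apply: eq_Rintegral => x _; rewrite big_ord_recr.
Qed.

Lemma open_measure_gt0 (Omega : set (R * R)) :
  open Omega -> Omega !=set0 -> (0 < mu2 Omega)%E.
Proof.
move=> oO [x Ox]; have /nbhs_ballP[e /= e0 eO] := oO _ Ox.
pose A : set (R * R) := `[x.1, (x.1 + e / 2)]%classic `*` `[x.2, (x.2 + e / 2)]%classic.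
have e2 : 0 < e / 2 by rewrite divr_gt0.
apply: (@lt_le_trans _ _ (mu2 A)).
  rewrite lebesgue2X ?lerDl ?ltW // lte_fin ![_ + e / 2]addrC !addrK.
  by rewrite mulr_gt0.
apply: le_measure; rewrite ?inE.
- by apply: measurableX; exact: measurable_itv.
- exact: open_measurable2.
- move=> y [/=]; rewrite !in_itv /= => /andP[a1 a2] /andP[b1 b2].
  by apply: eO; split; rewrite /ball /= ltr_norml; apply/andP; split; lra.
Qed.

Variables (Omega : set (R * R)) (M : R).
Hypotheses (oO : open Omega) (M0 : 0 < M) (OM : Omega `<=` box M).
Variables (a b : R).
Hypothesis ab0 : (a, b) != (0, 0).
Let l x := a * x.1 + b * x.2.

Let mO : measurable (Omega : set (RR * RR)). Proof. exact: open_measurable2. Qed.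
Let Ooo : (mu2 Omega < +oo)%E. Proof. exact: finite_measure_box OM. Qed.

Lemma halfplane_integrable s : mu2.-integrable Omega (EFin \o halfplane a b s).
Proof.
apply: (bounded_integrable (C := 1)) => //.
  apply: measurable_funTS; exact: measurable_halfplane.
by move=> x _; exact: norm_halfplane.
Qed.

(** Moving the threshold from s to t changes the integrand only on a strip of width |t - s|, so the
    volume is even Lipschitz in s. *)
Lemma halfplane_volume_continuous :
  continuous (fun s => \int[mu2]_(x in Omega) halfplane a b s x).
Proof.
have [K K0 KP] := strip_measure ab0 (ltW M0).
have mono s t : s <= t -> `|\int[mu2]_(x in Omega) halfplane a b s x -
    \int[mu2]_(x in Omega) halfplane a b t x| <= K * (t - s).
  move=> st; rewrite -RintegralB //; try exact: halfplane_integrable.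
  rewrite Rintegral_mkcond -[leRHS]mul1r.
  apply: (Rintegral_le_indic (A := box M `&` strip a b s (t - s))) => //.
  - split.
    + apply/(measurable_restrictT _ mO); apply: measurable_funTS.
      by apply: measurable_funB; exact: measurable_halfplane.
    + exists 2 => x; rewrite patchE; case: ifP => _; last by rewrite normr0.
      rewrite (le_trans (ler_normB _ _)) //.
      by rewrite -[2]/(1 + 1) lerD // norm_halfplane.
    + exists M => x; rewrite patchE; case: ifP => [/set_mem /OM //|]; by rewrite eqxx.
  - by apply: measurableI; [exact: box_measurable|exact: strip_measurable].
  - move=> x; rewrite patchE mul1r; case: ifPn => [/set_mem Ox|_]; last first.
      by rewrite normr0.
    rewrite indicE; case: (boolP (x \in _)) => [_|].
      by rewrite /halfplane; case: (_ < _); case: (_ < _);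
        rewrite ?subrr ?subr0 ?sub0r ?normrN ?normr0 ?normr1.
    rewrite notin_setE /strip /= => nx; rewrite normr_le0 subr_eq0 /halfplane.
    apply/eqP; congr (_ %:R); congr nat_of_bool; apply/idP/idP => H; last first.
      exact: le_lt_trans H.
    by rewrite ltNge; apply/negP => H'; apply: nx; split; [exact: OM|rewrite H [leRHS]addrC subrK].
  - by apply: KP; rewrite subr_ge0.
move=> s; apply/cvgrPdist_le => e e0.
have d0 : 0 < e / (K + 1) by rewrite divr_gt0 // ltr_wpDl.
apply/nbhs_ballP; exists (e / (K + 1)) => // t; rewrite /ball /= => st.
apply: (@le_trans _ _ (K * `|s - t|)).
  have [le|/ltW le] := leP s t.
    by rewrite distrC (distrC s) [X in _ * X]ger0_norm ?subr_ge0 // distrC mono.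
  by rewrite distrC [X in _ * X]ger0_norm ?subr_ge0 // mono.
apply: (@le_trans _ _ ((K + 1) * (e / (K + 1)))).
  by apply: ler_pM => //; [rewrite lerDl|exact: ltW].
by rewrite mulrC divfK // gt_eqF // ltr_wpDl.
Qed.

Variables (N : nat) (h t0 : R).

Lemma phaseE c x : phase N h c (l x - t0) =
  \sum_(j < N) (halfplane a b (t0 + j%:R * h) x - halfplane a b (t0 + j%:R * h + c * h) x).
Proof.
by apply: eq_bigr => j _; rewrite /heaviside /halfplane !subr_gt0 -/(l x);
  congr (_%:R - _%:R); congr nat_of_bool; apply/idP/idP; lra.
Qed.

Let integrable_slab c j : mu2.-integrable Omega
  (EFin \o (fun x => halfplane a b (t0 + j%:R * h) x - halfplane a b (t0 + j%:R * h + c * h) x)).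
Proof.
rewrite (_ : EFin \o _ = ((EFin \o halfplane a b (t0 + j%:R * h)) \-
  (EFin \o halfplane a b (t0 + j%:R * h + c * h)))%E) //.
by apply: integrableB => //; exact: halfplane_integrable.
Qed.

Lemma measurable_phase c :
  measurable_fun [set: RR * RR] ((fun x => phase N h c (l x - t0)) : RR * RR -> RR).
Proof.
rewrite (_ : (fun x => _) = fun x : RR * RR => \sum_(j < N) (halfplane a b (t0 + j%:R * h) x -
  halfplane a b (t0 + j%:R * h + c * h) x)); last by apply/funext => x; rewrite phaseE.
apply: measurable_sum => j; apply: measurable_funB; exact: measurable_halfplane.
Qed.

(** The stripes are empty at c = 0 and fill the whole range of l on Omega at c = 1. Their edges move
    continuously with c, so every intermediate volume occurs. *)
Lemma phase_volume d : 0 <= h -> (forall x, Omega x -> 0 < l x - t0 <= N%:R * h) ->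
  0 <= d <= 1 -> exists2 c, 0 <= c <= 1 &
    \int[mu2]_(x in Omega) phase N h c (l x - t0) = d * fine (mu2 Omega).
Proof.
move=> h0 range /andP[d0 d1].
pose m c := \int[mu2]_(x in Omega) phase N h c (l x - t0).
have mE c : m c = \sum_(j < N) (\int[mu2]_(x in Omega) halfplane a b (t0 + j%:R * h) x -
    \int[mu2]_(x in Omega) halfplane a b (t0 + j%:R * h + c * h) x).
  rewrite /m; under eq_Rintegral do rewrite phaseE.
  have [_ ->] := Rintegral_sum N mO (integrable_slab c).
  by apply: eq_bigr => j _; rewrite RintegralB //; exact: halfplane_integrable.
have m_cont : continuous m.
  rewrite (_ : m = fun c => \sum_(j < N) (\int[mu2]_(x in Omega) halfplane a b (t0 + j%:R * h) x -
    \int[mu2]_(x in Omega) halfplane a b (t0 + j%:R * h + c * h) x)); last exact/funext.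
  elim: N => [|n IH] c.
    by under eq_fun do rewrite big_ord0; exact: cst_continuous.
  under eq_fun do rewrite big_ord_recr /=.
  pose arg (s : R) : R := t0 + n%:R * h + s * h.
  have c1 : {for c, continuous arg}.
    apply: continuousD; first exact: cst_continuous.
    by apply: continuousM; [exact: cvg_id|exact: cst_continuous].
  have c2 : {for c, continuous ((fun s => \int[mu2]_(x in Omega) halfplane a b s x) \o arg)}.
    by apply: continuous_comp => //; exact: halfplane_volume_continuous.
  apply: (continuousD (IH c)); apply: (continuousB _ c2); exact: cst_continuous.
have m0 : m 0 = 0.
  by rewrite /m; under eq_Rintegral do rewrite phase0; rewrite Rintegral_cst // mul0r.
(* At c = 1 every cell cancels identically, so [comb_heaviside] reads 0 = phase - 1. *)
have m1 : m 1 = fine (mu2 Omega).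
  rewrite /m -[RHS]mul1r -Rintegral_cst //; apply: eq_Rintegral => x /set_mem Ox.
  have /andP[r0 r1] := range x Ox; have := comb_heaviside 1 r0 r1.
  rewrite /comb big1 => [/esym/eqP|j _]; last by rewrite /cell !mul1r subrr.
  by rewrite subr_eq0 => /eqP.
have V0 : 0 <= fine (mu2 Omega) by apply: fine_ge0; exact: measure_ge0.
have [||c] := @IVT R m 0 1 (d * fine (mu2 Omega)) ler01.
- exact: continuous_subspaceT.
- rewrite m0 m1 min_l // max_r // mulr_ge0 //= ler_piMl //.
- by rewrite in_itv /= => c01 mc; exists c.
Qed.

(** Each of the [N] stripes has two edges and the test field has two components; every combination
    of an edge and a component costs at most [K]. *)
Lemma phase_BV c : 0 <= h -> 0 <= c <= 1 -> BV Omega (fun x => phase N h c (l x - t0)).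
Proof.
move=> h0 c01; split.
  apply: (bounded_integrable (C := 1)) => //.
    apply: measurable_funTS; exact: measurable_phase.
  by move=> x _; have [->|->] := phase01 N h0 c01 (l x - t0); rewrite ?normr0 ?normr1.
have [K K0 KP] := halfplane_variation ab0 (ltW M0).
apply: (@le_lt_trans _ _ (N%:R * (K + K) + N%:R * (K + K))%:E); last exact: ltry.
apply: ge_ereal_sup => _ [Phi [PhiC Phi1] <-]; rewrite lee_fin.
have pg i : has_grad (fun y => Phi y i 0) (fun j => partial j (fun y => Phi y i 0)).
  by have [/C1P] := PhiC i.
have sup i : supp_in Omega (fun y => Phi y i 0) /\
    supp_in Omega (partial i (fun y => Phi y i 0)).
  by have [s0 s1] := C1c_supp (PhiC i).
have bp i : bms (partial i (fun y => Phi y i 0)).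
  have [_ _ cp] := pg i; have [_ s1] := sup i.
  exact: bms_continuous (cp i) (supp_in_sub OM s1).
have bh i s : mu2.-integrable setT
    (EFin \o (fun x => halfplane a b s x * partial i (fun y => Phi y i 0) x)).
  apply/bms_integrable/bmsM => //; first exact: measurable_halfplane.
  by exists 1; exact: norm_halfplane.
have Phi_le1 i x : `|Phi x i 0| <= 1.
  rewrite -(expr_le1 (n := 2)) // -normrX ger0_norm ?sqr_ge0 //.
  apply: le_trans (Phi1 x); rewrite /dot (bigD1 i) //= expr2 lerDl.
  by apply: sumr_ge0 => j _; rewrite -expr2 sqr_ge0.
have bd i : `|\int[mu2]_(x in Omega)
    (phase N h c (l x - t0) * partial i (fun y => Phi y i 0) x)| <= N%:R * (K + K).
  rewrite Rintegral_supp; last first.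
    by move=> x; rewrite mulf_eq0 negb_or => /andP[_]; have [_] := sup i; apply.
  pose F (j : nat) x := halfplane a b (t0 + j%:R * h) x * partial i (fun y => Phi y i 0) x
    - halfplane a b (t0 + j%:R * h + c * h) x * partial i (fun y => Phi y i 0) x.
  have iF j : mu2.-integrable setT (EFin \o F j).
    rewrite (_ : EFin \o F j = ((EFin \o (fun x => halfplane a b (t0 + j%:R * h) x *
       partial i (fun y => Phi y i 0) x)%R) \- (EFin \o (fun x =>
       halfplane a b (t0 + j%:R * h + c * h) x * partial i (fun y => Phi y i 0) x)%R))%E) //.
    by apply: integrableB.
  have [_ E] := Rintegral_sum N measurableT iF.
  rewrite (_ : \int[mu2]_x _ = \sum_(j < N) \int[mu2]_x F j x); last first.
    rewrite -E; apply: eq_Rintegral => x _; rewrite phaseE mulr_suml.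
    by apply: eq_bigr => j _; rewrite mulrBl.
  apply: (le_trans (ler_norm_sum _ _ _)).
  apply: (@le_trans _ _ (\sum_(j < N) (K + K))); last first.
    by rewrite sumr_const card_ord -[X in X <= _]mulr_natl lexx.
  apply: ler_sum => j _; rewrite RintegralB //.
  have KP1 s := KP s _ _ 1 i (pg i) (supp_in_sub OM (sup i).1) ler01 (Phi_le1 i).
  by rewrite (le_trans (ler_normB _ _)) // lerD // (le_trans (KP1 _)) // mul1r.
have int i : mu2.-integrable Omega
    (EFin \o (fun x => phase N h c (l x - t0) * partial i (fun y => Phi y i 0) x)).
  apply: (@integrableS _ _ _ _ setT) => //.
  apply/bms_integrable/bmsM => //; first exact: measurable_phase.
  by exists 1 => x; have [->|->] := phase01 N h0 c01 (l x - t0); rewrite ?normr0 ?normr1.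
under eq_Rintegral do rewrite big_ord_recl big_ord1 mulrDr.
rewrite RintegralD // (le_trans (ler_norm _)) // (le_trans (ler_normD _ _)) // lerD //.
Qed.

End Laminate.

(** * Admissible gradients *)

Section Admissible.
Context {R : realType}.
Notation RR := (measurableTypeR R).
Notation mu2 := (@lebesgue2 R).
Implicit Types (u v w : R * R -> R) (x y : R * R).
Variables (Omega : set (R * R)) (M : R).
Hypotheses (oO : open Omega) (OM : Omega `<=` box M).

Let mO : measurable (Omega : set (RR * RR)). Proof. exact: open_measurable2. Qed.
Let Ooo : (mu2 Omega < +oo)%E. Proof. exact: finite_measure_box OM. Qed.

Lemma dotE (u v : 'cV[R]_2) : dot u v = u 0 0 * v 0 0 + u 1 0 * v 1 0.
Proof. by rewrite /dot big_ord_recl big_ord1; congr (_ + u _ _ * v _ _); exact: val_inj. Qed.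

Lemma dot_vecE (f : 'cV[R]_2) x : dot f (vec x) = f 0 0 * x.1 + f 1 0 * x.2.
Proof. by rewrite dotE /vec !mxE. Qed.

Lemma has_grad_affine (f : 'cV[R]_2) :
  has_grad (fun x => dot f (vec x)) (fun i _ => f i 0).
Proof.
apply: has_grad_ext (has_grad_linear (f 0 0) (f 1 0) 0) _ _ => [x|i x].
  by rewrite dot_vecE addr0.
case: (unliftP 0 i) => [j|] -> //; rewrite (ord1 j) /=.
by congr (f _ _); exact: val_inj.
Qed.

Lemma continuous_bounded_on u : continuous u -> exists C, forall x, Omega x -> `|u x| <= C.
Proof.
move=> cu; have [M0|M0] := ltP M 0.
  exists 0 => x /OM; rewrite /box /= => /(le_trans (normr_ge0 _)).
  by rewrite leNgt M0.
have [||c _ cP] := @compact_EVT_max _ R (fun x => `|u x|) (box M) _ (@box_compact _ M).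
- by exists 0; rewrite /box /= normr0.
- apply: continuous_subspaceT => x.
  by apply: continuous_comp; [exact: cu|exact: norm_continuous].
by exists `|u c| => x /OM xM; apply: cP; rewrite inE.
Qed.

Lemma continuous_L2 u : continuous u -> L2 Omega u.
Proof.
move=> cu; have mu : measurable_fun (Omega : set (RR * RR)) (u : RR * RR -> RR).
  by apply: measurable_funTS; exact: continuous_measurable2.
split=> //; have [C uC] := continuous_bounded_on cu.
have /integrableP[_] : mu2.-integrable Omega (EFin \o (fun x => u x ^+ 2)).
  apply: (bounded_integrable (C := C ^+ 2)) => //; first exact: measurable_funX.
  by move=> x /uC ux; rewrite normrX ler_pXn2r ?nnegrE // (le_trans _ ux).
by under eq_integral do rewrite /= ger0_norm ?sqr_ge0 //.
Qed.

(** The function [w] is C^1 on the whole plane and zero off Omega. This is thus [integral_grad0] for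
    the product, and no boundary term can arise, whatever the boundary is like. *)
Lemma integration_by_parts0 u g w h i : has_grad u g -> has_grad w h ->
  supp_in Omega w -> (forall i, supp_in Omega (h i)) ->
  \int[mu2]_(x in Omega) (u x * h i x) = - \int[mu2]_(x in Omega) (g i x * w x).
Proof.
move=> ug wh sw sh.
have s1 : supp_in Omega (fun x => u x * h i x).
  by move=> x; rewrite mulf_eq0 negb_or => /andP[_ /sh].
have s2 : supp_in Omega (fun x => g i x * w x).
  by move=> x; rewrite mulf_eq0 negb_or => /andP[_ /sw].
rewrite (Rintegral_supp s1) (Rintegral_supp s2); apply/eqP; rewrite -subr_eq0 opprK; apply/eqP.
have [_ _ cg] := ug; have [_ _ ch] := wh.
rewrite -RintegralD //.
- have sm : supp_in (box M) (fun x => u x * w x).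
    by move=> x; rewrite mulf_eq0 negb_or => /andP[_ /sw/OM].
  rewrite -[RHS](integral_grad0 i (has_gradM ug wh) sm).
  by apply: eq_Rintegral => x _; rewrite [g i x * _]mulrC.
- apply/bms_integrable/(bms_continuous (M := M)); last exact: supp_in_sub s1.
  by move=> x; apply: continuousM; [exact: (has_grad_continuous ug)|exact: ch].
- apply/bms_integrable/(bms_continuous (M := M)); last exact: supp_in_sub s2.
  by move=> x; apply: continuousM; [exact: cg|exact: (has_grad_continuous wh)].
Qed.

Lemma graph_continuous (c : chart R) : boundary_chart Omega c -> continuous (graph c).
Proof.
move=> [_ _ _ [k kP] _] s; apply/cvgrPdist_le => e e0.
have k0 : 0 < `|k| + 1 by rewrite ltr_wpDl.
apply/nbhs_ballP; exists (e / (`|k| + 1)); rewrite /= ?divr_gt0 // => t st.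
have := kP (s, t) (conj I I); rewrite /= => /le_trans; apply.
apply: (@le_trans _ _ ((`|k| + 1) * (e / (`|k| + 1)))); last first.
  by rewrite mulrC divfK // gt_eqF.
apply: (@le_trans _ _ ((`|k| + 1) * `|s - t|)).
  by rewrite ler_wpM2r // ler_wpDr // ler_norm.
by rewrite ler_wpM2l // ltW.
Qed.

Lemma boundary_point_notin (c : chart R) s : boundary_chart Omega c ->
  chart_patch c s -> ~ Omega (boundary_point c s).
Proof. by move=> [_ _ _ _ cP] [s1 s2] /(cP _ _ s1 s2); rewrite ltxx. Qed.

Lemma affine_boundary_measurable (c : chart R) (f : 'cV[R]_2) :
  boundary_chart Omega c ->
  measurable_fun (chart_patch c : set RR)
    ((fun x => dot f (vec x)) \o boundary_point c : RR -> RR).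
Proof.
move=> cc; apply: measurable_funTS.
have mg : measurable_fun [set: RR] (graph c : RR -> RR).
  by apply: continuous_measurable_fun; exact: graph_continuous.
rewrite (_ : _ \o _ = fun s : R => f 0 0 * ((base c).1 + s * (axis c).1 - graph c s * (axis c).2) +
    f 1 0 * ((base c).2 + s * (axis c).2 + graph c s * (axis c).1)); last first.
  by apply/funext => s; rewrite /= dot_vecE.
apply: measurable_funD; apply: measurable_funM => //.
  apply: measurable_funB; last exact: measurable_funM.
  by apply: measurable_funD => //; exact: measurable_funM.
apply: measurable_funD; last exact: measurable_funM.
by apply: measurable_funD => //; exact: measurable_funM.
Qed.

(** The potential f.x + zeta is C^1 on the plane and serves as its own approximating sequence. Its
    trace is f.x because zeta vanishes outside Omega, in particular at boundary points. *)
Lemma admissible_C1c (f : 'cV[R]_2) (zeta : R * R -> R) : C1c Omega zeta ->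
  admissible_gradient Omega f (fun x => \col_i (f i 0 + partial i zeta x)).
Proof.
move=> Cz; have [/C1P zg _ _] := Cz; have [sz sz'] := C1c_supp Cz.
have ug := has_gradD (has_grad_affine f) zg; set u := fun x => _ in ug.
have [_ pu cu] := ug.
have uC1 : C1 u by exact: has_grad_C1 ug.
exists u; split; first split.
- exact/continuous_L2/(has_grad_continuous ug).
- move=> i; apply: continuous_L2; rewrite (_ : (fun x => _) = fun x => f i 0 + partial i zeta x).
    exact: cu.
  by apply/funext => x; rewrite mxE.
- move=> phi i Cphi; have [/C1P pg _ _] := Cphi; have [sp sp'] := C1c_supp Cphi.
  rewrite (integration_by_parts0 i ug pg sp sp'); congr (- _).
  by apply: eq_Rintegral => x _; rewrite mxE.
exists (fun x => dot f (vec x)); last first.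
  by move=> c _; apply: aeW.
split; first by move=> c; exact: affine_boundary_measurable.
exists (fun=> u); split => //.
- rewrite (_ : (fun n => _) = fun=> 0%E); first exact: cvg_cst.
  apply/funext => n; rewrite -[RHS](@integral0 _ _ R mu2 Omega); apply: eq_integral => x _.
  by rewrite subrr expr0n.
- move=> i; rewrite (_ : (fun n => _) = fun=> 0%E); first exact: cvg_cst.
  apply/funext => n; rewrite -[RHS](@integral0 _ _ R mu2 Omega); apply: eq_integral => x _.
  by rewrite mxE pu subrr expr0n.
- move=> c cc; rewrite (_ : (fun n => _) = fun=> 0%E); first exact: cvg_cst.
  apply/funext => n.
  rewrite -[RHS](@integral0 _ _ R (@lebesgue_measure R) (chart_patch c)).
  apply: eq_integral => s /set_mem sc.
  have /eqP z0 : zeta (boundary_point c s) == 0.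
    by apply/negPn/negP => /sz; exact: boundary_point_notin.
  by rewrite /u z0 addr0 subrr expr0n.
Qed.

End Admissible.

Section Bounded_on.
Context {R : realType}.
Notation RR := (measurableTypeR R).
Notation mu2 := (@lebesgue2 R).
Variables (Omega : set (R * R)).
Hypotheses (mO : measurable (Omega : set (RR * RR))) (Ooo : (mu2 Omega < +oo)%E).

Definition bounded_measurable (f : R * R -> R) : Prop :=
  measurable_fun (Omega : set (RR * RR)) (f : RR * RR -> RR) /\
  exists C, forall x, Omega x -> `|f x| <= C.

Lemma bounded_measurable_integrable f : bounded_measurable f ->
  mu2.-integrable Omega (EFin \o f).
Proof. by move=> [mf [C fC]]; exact: bounded_integrable fC. Qed.

Lemma bounded_measurable_cst (c : R) : bounded_measurable (fun=> c).
Proof. by split; [exact: measurable_cst|exists `|c|]. Qed.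

Lemma bounded_measurableD f g : bounded_measurable f -> bounded_measurable g ->
  bounded_measurable (fun x => f x + g x).
Proof.
move=> [mf [C fC]] [mg [D gD]]; split; first exact: measurable_funD.
by exists (C + D) => x Ox; rewrite (le_trans (ler_normD _ _)) // lerD ?fC ?gD.
Qed.

Lemma bounded_measurableM f g : bounded_measurable f -> bounded_measurable g ->
  bounded_measurable (fun x => f x * g x).
Proof.
move=> [mf [C fC]] [mg [D gD]]; split; first exact: measurable_funM.
by exists (C * D) => x Ox; rewrite normrM ler_pM ?fC ?gD.
Qed.

Lemma bounded_measurableN f : bounded_measurable f ->
  bounded_measurable (fun x => - f x).
Proof.
move=> /(bounded_measurableM (bounded_measurable_cst (-1))).
by under eq_fun do rewrite mulN1r.
Qed.

Lemma bounded_measurableB f g : bounded_measurable f -> bounded_measurable g ->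
  bounded_measurable (fun x => f x - g x).
Proof. by move=> bf /bounded_measurableN; exact: bounded_measurableD. Qed.

Lemma bounded_measurable_norm f : bounded_measurable f ->
  bounded_measurable (fun x => `|f x|).
Proof.
move=> [mf [C fC]]; split; first exact: measurableT_comp.
by exists C => x Ox; rewrite normr_id fC.
Qed.

Lemma bounded_measurable_continuous M (f : R * R -> R) :
  Omega `<=` box M -> continuous f -> bounded_measurable f.
Proof.
move=> OM cf; split; last exact: (continuous_bounded_on OM).
by apply: measurable_funTS; exact: continuous_measurable2.
Qed.

Lemma bounded_RintegralD f g : bounded_measurable f -> bounded_measurable g ->
  \int[mu2]_(x in Omega) (f x + g x) =
  \int[mu2]_(x in Omega) f x + \int[mu2]_(x in Omega) g x.
Proof. by move=> bf bg; rewrite RintegralD //; exact: bounded_measurable_integrable. Qed.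

Lemma bounded_RintegralB f g : bounded_measurable f -> bounded_measurable g ->
  \int[mu2]_(x in Omega) (f x - g x) =
  \int[mu2]_(x in Omega) f x - \int[mu2]_(x in Omega) g x.
Proof. by move=> bf bg; rewrite RintegralB //; exact: bounded_measurable_integrable. Qed.

Lemma bounded_RintegralZ f (c : R) : bounded_measurable f ->
  \int[mu2]_(x in Omega) (c * f x) = c * \int[mu2]_(x in Omega) f x.
Proof. by move=> bf; rewrite RintegralZl //; exact: bounded_measurable_integrable. Qed.

Lemma Rintegral_csts (c : R) : \int[mu2]_(x in Omega) c = c * fine (mu2 Omega).
Proof. by rewrite (@Rintegral_cst _ _ _ mu2 Omega mO c). Qed.

Lemma bounded_le_Rintegral f g : bounded_measurable f -> bounded_measurable g ->
  (forall x, Omega x -> f x <= g x) ->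
  \int[mu2]_(x in Omega) f x <= \int[mu2]_(x in Omega) g x.
Proof. by move=> bf bg fg; apply: le_Rintegral => //; exact: bounded_measurable_integrable. Qed.

Lemma bounded_norm_Rintegral f g : bounded_measurable f -> bounded_measurable g ->
  (forall x, Omega x -> `|f x| <= g x) ->
  `|\int[mu2]_(x in Omega) f x| <= \int[mu2]_(x in Omega) g x.
Proof.
move=> bf bg fg; apply: le_trans (le_normr_Rintegral _ _) _ => //.
  exact: bounded_measurable_integrable.
by apply: bounded_le_Rintegral => //; exact: bounded_measurable_norm.
Qed.

End Bounded_on.

(** * The laminate as an approximate gradient *)

Lemma has_grad_comb {R : realType} (N : nat) (h c p q t0 : R) (F F' : R -> R) :
  (forall t : R, is_derive t 1 F (F' t)) -> continuous F' ->
  has_grad (fun x : R * R => comb N h c F (p * x.1 + q * x.2 - t0))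
    (fun i x => comb N h c F' (p * x.1 + q * x.2 - t0) * (if i == 0 then p else q)).
Proof.
move=> dF cF.
have shift s : has_grad (fun x : R * R => F (p * x.1 + q * x.2 - s))
    (fun i x => F' (p * x.1 + q * x.2 - s) * (if i == 0 then p else q)).
  have lin := has_grad_linear p q (- s).
  by apply: (has_grad_comp (f := F) (f' := F') lin) => x; exact: cF.
have cellg s : has_grad (fun x : R * R => cell h c F (p * x.1 + q * x.2 - s))
    (fun i x => cell h c F' (p * x.1 + q * x.2 - s) * (if i == 0 then p else q)).
  have g1 := has_gradD (shift s) (has_gradZ (-1) (shift (s + c * h))).
  have g2 := has_gradD (shift s) (has_gradZ (-1) (shift (s + h))).
  apply: has_grad_ext (has_gradD g1 (has_gradZ (- c) g2)) _ _ => [x|i x];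
    by rewrite /cell !opprD !addrA; ring.
apply: has_grad_ext (has_grad_sum (index_enum 'I_N) (fun j : 'I_N => cellg (t0 + j%:R * h))) _ _.
  by move=> x; apply: eq_bigr => j _; congr cell; ring.
by move=> i x; rewrite /comb mulr_suml; apply: eq_bigr => j _; congr (cell _ _ _ _ * _); ring.
Qed.

Lemma sqr_sum4 {R : realType} (a b c p : R) :
  (a + b + c + p) ^+ 2 <= 4 * (a ^+ 2 + b ^+ 2 + c ^+ 2 + p ^+ 2).
Proof.
rewrite -subr_ge0.
have -> : 4 * (a ^+ 2 + b ^+ 2 + c ^+ 2 + p ^+ 2) - (a + b + c + p) ^+ 2 =
  (a - b) ^+ 2 + (a - c) ^+ 2 + (a - p) ^+ 2 + (b - c) ^+ 2 + (b - p) ^+ 2 + (c - p) ^+ 2.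
  by ring.
by rewrite !addr_ge0 ?sqr_ge0.
Qed.

(** The error of the laminate at a point has four sources: the smoothing error D, the gap e = d - c,
    the cutoff loss T - 1, and the term P where the derivative falls on the cutoff. Separating their
    squares costs the factor 4. *)
Lemma laminate_error_bound {R : realType} (kap nu nn T D e X d P B E : R) :
  0 <= T <= 1 -> nu ^+ 2 <= nn -> X = 0 \/ X = 1 -> 0 <= d <= 1 ->
  `|P| <= B -> e ^+ 2 <= E ->
  (kap * (nu * (T * D) + nu * (T * e) + nu * ((T - 1) * (X - d)) + P)) ^+ 2 <=
  4 * kap ^+ 2 * (nn * (D * D) + (nn * (1 - T) + (nn * E + B ^+ 2))).
Proof.
move=> /andP[T0 T1] nun X01 /andP[d0 d1] PB eE.
have nn0 : 0 <= nn by exact: le_trans (sqr_ge0 _) nun.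
have T2 : T ^+ 2 <= 1 by rewrite expr_le1.
rewrite exprMn -[leRHS]mulrA [leRHS]mulrCA ler_wpM2l ?sqr_ge0 //.
apply: (le_trans (sqr_sum4 _ _ _ _)); rewrite ler_pM2l // !addrA.
have B0 : 0 <= B by exact: le_trans (normr_ge0 _) PB.
have h1 : (nu * (T * D)) ^+ 2 <= nn * (D * D).
  rewrite exprMn; apply: ler_pM => //; rewrite ?sqr_ge0 // exprMn -expr2.
  by rewrite ler_piMl ?sqr_ge0.
have h2 : (nu * (T * e)) ^+ 2 <= nn * E.
  rewrite exprMn; apply: ler_pM => //; rewrite ?sqr_ge0 // exprMn.
  by rewrite (le_trans _ eE) // ler_piMl ?sqr_ge0.
have h3 : (nu * ((T - 1) * (X - d))) ^+ 2 <= nn * (1 - T).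
  rewrite exprMn; apply: ler_pM => //; rewrite ?sqr_ge0 // exprMn.
  have X2 : (X - d) ^+ 2 <= 1.
    by rewrite -real_normK ?num_real // expr_le1 // ler_norml; case: X01 => ->; apply/andP; split; lra.
  have T3 : (T - 1) ^+ 2 <= 1 - T.
    rewrite -[(T - 1) ^+ 2]sqrrN opprB expr2 ler_piMl //; lra.
  by rewrite -[1 - T]mulr1 ler_pM ?sqr_ge0.
have h4 : P ^+ 2 <= B ^+ 2 by rewrite -real_normK ?num_real // ler_pXn2r ?nnegrE.
lra.
Qed.

Section Laminate_approximation.
Context {R : realType}.
Notation RR := (measurableTypeR R).
Notation mu2 := (@lebesgue2 R).
Variables (Omega : set (R * R)) (M : R).
Hypotheses (oO : open Omega) (O0 : Omega !=set0) (M0 : 0 < M) (OM : Omega `<=` box M).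
Variables (d : R) (d01 : 0 <= d <= 1).

Let mO : measurable (Omega : set (RR * RR)). Proof. exact: open_measurable2. Qed.
Let Ooo : (mu2 Omega < +oo)%E. Proof. exact: finite_measure_box OM. Qed.
Let V := fine (mu2 Omega).
Let V0 : 0 < V. Proof. by apply: fine_gt0; rewrite Ooo open_measure_gt0. Qed.

Section Direction.
Variables (p q kappa : R).
Hypothesis pq0 : (p, q) != (0, 0).
Let n (i : 'I_2) : R := if i == 0 then p else q.

(** The order of the choices matters. The cutoff theta comes first and fixes the bound [L] on its
    gradient. Then [N] is taken so large that the height h of the sawtooth satisfies h L <= eta,
    which controls the term in which the derivative falls on theta. Next c gives the exact volume,
    and last the smoothing index m is chosen, depending on all of these. *)
Lemma laminate_direction : exists2 K, 0 <= K & forall eta, 0 < eta <= 1 ->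
  exists chi zeta, [/\ phase_distribution Omega d chi, C1c Omega zeta &
    forall i, \int[mu2]_(x in Omega) (partial i zeta x - (chi x - d) * (kappa * n i)) ^+ 2
      <= K * eta].
Proof.
have [i0 ni0] : exists i0, n i0 != 0.
  have [p0|p0] := eqVneq p 0; last by exists 0.
  exists (lift 0 0); rewrite /n /=; apply: contra_neq pq0 => q0.
  by rewrite p0 q0.
(* [K1 * eta] is going to bound |d - c|; the numerator collects two errors of size [|n i0| * eta]
   and one of size [2 * eta * V]. *)
pose K1 := (2 * `|n i0| + 2 * V) / (`|n i0| * V).
pose nn := p ^+ 2 + q ^+ 2.
have nn_ge i : n i ^+ 2 <= nn by rewrite /n /nn; case: ifP => _; rewrite ?lerDl ?lerDr sqr_ge0.
have nn0 : 0 <= nn by rewrite addr_ge0 // sqr_ge0.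
have K10 : 0 <= K1 by rewrite divr_ge0 ?addr_ge0 ?mulr_ge0 // ltW.
exists (4 * kappa ^+ 2 * (2 * nn + nn * K1 * V + 4 * V)).
  have V0' := ltW V0; apply: mulr_ge0; first by rewrite mulr_ge0 ?sqr_ge0.
  apply: addr_ge0; last exact: mulr_ge0.
  by apply: addr_ge0; [exact: mulr_ge0|exact: mulr_ge0 (mulr_ge0 nn0 K10) V0'].
move=> eta /andP[eta0 eta1].
have [theta [thetaC theta01 thetae]] := cutoff oO OM eta0.
have [/C1P tg _ _] := thetaC; have [st st'] := C1c_supp thetaC.
have [L L0 tL] := grad_bounded tg (supp_in_sub OM st).
(* On Omega |l| is at most W - 1, so l + W stays in (0, 2 W], which the [N] periods of length h fill
   exactly. *)
pose W := (`|p| + `|q|) * M + 1.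
have W0 : 0 < W by rewrite ltr_wpDl // mulr_ge0 ?addr_ge0 // ltW.
pose N := (Num.truncn (2 * W * L / eta)).+1.
pose h := 2 * W / N%:R.
have N0 : 0 < N%:R :> R by rewrite ltr0n.
have h0 : 0 < h by rewrite divr_gt0 // mulr_gt0.
have hL : h * L <= eta.
  rewrite /h mulrAC ler_pdivrMr // (mulrC eta) -ler_pdivrMr //.
  by apply/ltW; rewrite /N truncnS_gt.
have range x : Omega x -> 0 < p * x.1 + q * x.2 - - W <= N%:R * h.
  move=> /OM; rewrite /box /= prod_normE ge_max => /andP[x1 x2].
  have : `|p * x.1 + q * x.2| <= (`|p| + `|q|) * M.
    rewrite (le_trans (ler_normD _ _)) // !normrM mulrDl lerD //.
      by rewrite ler_wpM2l.
    by rewrite ler_wpM2l.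
  have -> : N%:R * h = 2 * W by rewrite /h mulrC divfK // gt_eqF.
  by rewrite /W ler_norml => /andP[b1 b2]; apply/andP; split; lra.
have [c c01 cV] := phase_volume oO M0 OM pq0 (ltW h0) range d01.
pose chi x := phase N h c (p * x.1 + q * x.2 - - W).
have chi01 x : chi x = 0 \/ chi x = 1 by exact: (phase01 _ (ltW h0) c01).
pose psi m x := comb N h c (ramp m.+1%:R^-1) (p * x.1 + q * x.2 - - W).
pose sig m x := comb N h c (step m.+1%:R^-1) (p * x.1 + q * x.2 - - W).
(* The smoothing error: on Omega [chi x - c] is the value of [sig m x] with the Heaviside function
   in place of [step]. *)
pose D m x := sig m x - (chi x - c).
have ps m : has_grad (psi m) (fun i x => sig m x * n i).
  apply: has_grad_comb; last exact: continuous_step.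
  by move=> t; apply: is_derive_ramp; rewrite invr_gt0.
have pq_cont : continuous (fun x : R * R => p * x.1 + q * x.2 - - W).
  exact: (has_grad_continuous (has_grad_linear p q (- - W))).
have bm_chi : bounded_measurable Omega chi.
  split; first by apply: measurable_funTS; exact: measurable_phase.
  by exists 1 => x _; have [->|->] := chi01 x; rewrite ?normr0 ?normr1.
have bm_c t : bounded_measurable Omega (fun=> t) by exact: bounded_measurable_cst.
have D4 m x : Omega x -> `|D m x| <= N%:R * (4 * 1).
  move=> Ox; rewrite /D /chi; have /andP[r1 r2] := range x Ox.
  rewrite -(comb_heaviside c r1 r2); apply: comb_dist => // s.
  have /andP[s0 s1] := step_itv m.+1%:R^-1 s.
  by rewrite /heaviside; case: (_ < _); rewrite /= ?mulr1n ?mulr0n ler_norml;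
    by apply/andP; split; lra.
have D0 x : Omega x -> (fun m => D m x) @ \oo --> 0.
  move=> Ox; have /andP[r1 r2] := range x Ox; rewrite -(subrr (chi x - c)).
  apply: cvgB; last exact: cvg_cst.
  rewrite /chi -(comb_heaviside c r1 r2); apply: comb_cvg => // s.
  exact: step_cvg.
have bm_D m : bounded_measurable Omega (D m).
  split; last by exists (N%:R * (4 * 1)); exact: D4.
  have [mchi _] := bm_chi.
  apply: measurable_funB; last by apply: measurable_funB => //; exact: measurable_cst.
  apply: measurable_funTS; apply: continuous_measurable2.
  have [_ _ /(_ i0) cs] := ps m.
  (* Continuity of [sig m] is read off from the partial derivative [sig m * n i0] of [psi m],
     divided by the nonzero [n i0]. *)
  rewrite (_ : sig m = fun x => sig m x * n i0 * (n i0)^-1).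
    move=> x; have cx : {for x, continuous (fun=> (n i0)^-1 : R)} by exact: cst_continuous.
    exact: (continuousM (cs x) cx).
  by apply/funext => x; rewrite mulfK.
have D1cvg : (fun m => \int[mu2]_(x in Omega) `|D m x|) @ \oo --> 0.
  apply: (Rintegral_cvg0 (C := N%:R * (4 * 1))) => //.
  - by move=> m; have [] := bounded_measurable_norm (bm_D m).
  - by move=> m x Ox; rewrite normr_id D4.
  - by move=> x Ox; rewrite -(normr0 R); apply: cvg_norm; exact: D0.
have D2cvg : (fun m => \int[mu2]_(x in Omega) (D m x * D m x)) @ \oo --> 0.
  apply: (Rintegral_cvg0 (C := N%:R * (4 * 1) * (N%:R * (4 * 1)))) => //.
  - by move=> m; have [] := bounded_measurableM (bm_D m) (bm_D m).
  - by move=> m x Ox; rewrite normrM ler_pM // D4.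
  - by move=> x Ox; rewrite -(mulr0 0); apply: cvgM; exact: D0.
have [m [m1 m2 m3]] : exists m, [/\ \int[mu2]_(x in Omega) `|D m x| <= eta,
    \int[mu2]_(x in Omega) (D m x * D m x) <= eta &
    N%:R * (4 * m.+1%:R^-1) * L <= eta].
  have near_le (f : nat -> R) : f @ \oo --> 0 -> \forall m \near \oo, f m <= eta.
    move=> /cvgrPdist_le/(_ eta eta0); apply: filterS => m.
    by rewrite sub0r normrN; exact: le_trans (ler_norm _).
  have e3 : (fun m => N%:R * (4 * m.+1%:R^-1) * L) @ \oo --> 0.
    rewrite (_ : (fun m => _) = fun m => m.+1%:R^-1 * (N%:R * 4 * L)).
      rewrite -[X in _ --> X](mul0r (N%:R * 4 * L)); apply: cvgM; last exact: cvg_cst.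
      exact: cvg_harmonic.
    by apply/funext => m; ring.
  near \oo => m; exists m; split; near: m; exact: near_le.
have psi_bd x i : `|psi m x * partial i theta x| <= 2 * eta.
  have /andP[r0 r1] := comb_pos N (ltW h0) c01 (p * x.1 + q * x.2 - - W).
  have m0 : 0 < m.+1%:R^-1 :> R by rewrite invr_gt0.
  have dist : `|psi m x - comb N h c pos (p * x.1 + q * x.2 - - W)| <= N%:R * (4 * m.+1%:R^-1).
    by apply: comb_dist => // s; exact: ramp_pos.
  have pbd : `|psi m x| <= h + N%:R * (4 * m.+1%:R^-1).
    rewrite -[psi m x](subrK (comb N h c pos (p * x.1 + q * x.2 - - W))).
    by rewrite (le_trans (ler_normD _ _)) // addrC lerD // ger0_norm.
  rewrite normrM; apply: (@le_trans _ _ ((h + N%:R * (4 * m.+1%:R^-1)) * L)).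
    by apply: ler_pM.
  by rewrite mulrDl (_ : 2 * eta = eta + eta) ?lerD //; ring.
have bm_t : bounded_measurable Omega theta.
  exact: (bounded_measurable_continuous OM (has_grad_continuous tg)).
have bm_pt i : bounded_measurable Omega (partial i theta).
  by have [_ _ ct] := tg; exact: (bounded_measurable_continuous OM (ct i)).
have bm_psi : bounded_measurable Omega (psi m).
  exact: (bounded_measurable_continuous OM (has_grad_continuous (ps m))).
have bm_sig : bounded_measurable Omega (sig m).
  rewrite (_ : sig m = fun x => D m x + (chi x - c)).
    apply: (bounded_measurableD (bm_D m)); exact: bounded_measurableB.
  by apply/funext => x; rewrite /D subrK.
have /andP[d0 d1] := d01; have /andP[c0 c1] := c01.
have chi_c x : `|chi x - c| <= 1.
  by have [->|->] := chi01 x; rewrite ler_norml; apply/andP; split; lra.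
have bm_chic : bounded_measurable Omega (fun x => chi x - c) by exact: bounded_measurableB.
have bm_1t : bounded_measurable Omega (fun x => 1 - theta x) by exact: bounded_measurableB.
have bm_nD : bounded_measurable Omega (fun x => `|D m x|).
  by apply: bounded_measurable_norm; exact: bm_D.
(* The integral of chi - c is (d - c) V. Up to the cutoff and smoothing errors it equals the
   integral of theta * sig, and [n i0] times the latter becomes, by parts, minus the integral of psi
   times a derivative of theta, which is small. *)
have cd : `|d - c| <= K1 * eta.
  have I0 : \int[mu2]_(x in Omega) (chi x - c) = (d - c) * V.
    by rewrite bounded_RintegralB // cV Rintegral_csts // mulrBl.
  have I1 : `|\int[mu2]_(x in Omega) ((1 - theta x) * (chi x - c))| <= eta.
    apply: le_trans thetae; apply: bounded_norm_Rintegral => //.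
      exact: bounded_measurableM.
    move=> x _; have /andP[t0 t1] := theta01 x.
    by rewrite normrM ger0_norm ?subr_ge0 // ler_piMr ?subr_ge0.
  have I3 : `|\int[mu2]_(x in Omega) (theta x * D m x)| <= eta.
    apply: le_trans m1; apply: bounded_norm_Rintegral => //.
      by apply: bounded_measurableM.
    move=> x _; have /andP[t0 t1] := theta01 x.
    by rewrite normrM ger0_norm // ler_piMl.
  have I2 : `|n i0 * \int[mu2]_(x in Omega) (theta x * sig m x)| <= 2 * eta * V.
    rewrite -bounded_RintegralZ //; last exact: bounded_measurableM.
    rewrite -normrN -Rintegral_csts //.
    rewrite (_ : - _ = \int[mu2]_(x in Omega) (psi m x * partial i0 theta x)).
      apply: bounded_norm_Rintegral => //; exact: bounded_measurableM.
    rewrite (integration_by_parts0 OM i0 (ps m) tg st st'); congr (- _).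
    by apply: eq_Rintegral => x _; ring.
  have E : (d - c) * V = \int[mu2]_(x in Omega) ((1 - theta x) * (chi x - c)) +
      (\int[mu2]_(x in Omega) (theta x * sig m x) - \int[mu2]_(x in Omega) (theta x * D m x)).
    have bm1 := bounded_measurableM bm_1t bm_chic.
    have bm2 := bounded_measurableM bm_t bm_sig.
    have bm3 := bounded_measurableM bm_t (bm_D m).
    rewrite -I0 -bounded_RintegralB // -bounded_RintegralD //.
      by apply: eq_Rintegral => x _; rewrite /D; ring.
    exact: bounded_measurableB.
  have nV : 0 < `|n i0| * V by rewrite mulr_gt0 ?normr_gt0.
  rewrite /K1 mulrAC ler_pdivlMr //.
  rewrite -[V in X in X <= _]gtr0_norm // mulrCA -!normrM E mulrDr mulrBr.
  rewrite (le_trans (ler_normD _ _)) // (_ : (2 * `|n i0| + 2 * V) * eta =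
    `|n i0| * eta + (2 * eta * V + `|n i0| * eta)); last by ring.
  apply: lerD; first by rewrite normrM ler_wpM2l.
  rewrite (le_trans (ler_normB _ _)) // lerD //.
  by rewrite normrM ler_wpM2l.
have cd2 : (d - c) ^+ 2 <= K1 * eta.
  apply: le_trans cd; rewrite -real_normK ?num_real // expr2 ler_piMr //.
  by rewrite ler_norml; apply/andP; split; lra.
pose zeta x := kappa * (theta x * psi m x).
have zg := has_gradZ kappa (has_gradM tg (ps m)).
have zetaC : C1c Omega zeta.
  have [_ cK KO] := thetaC.
  apply: (has_grad_C1c zg cK KO) => x; rewrite !mulf_eq0 !negb_or => /and3P[_ tx _].
  exact: subset_closure.
exists chi, zeta; split => //.
  split; [exact: (phase_BV oO M0 OM pq0 _ _ (ltW h0) c01)|by move=> x _|].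
  by rewrite /average cV mulrCA mulVf ?mulr1 // gt_eqF.
move=> i; have [_ zp _] := zg.
pose A := 4 * kappa ^+ 2.
have A0 : 0 <= A by rewrite mulr_ge0 // sqr_ge0.
have bmDD := bounded_measurableM (bm_D m) (bm_D m).
have bmZ (k : R) g : bounded_measurable Omega g -> bounded_measurable Omega (fun x => k * g x).
  by move=> bg; exact: (bounded_measurableM (bm_c k) bg).
have bmR1 : bounded_measurable Omega (fun x => nn * (1 - theta x) + (nn * (K1 * eta) + (2 * eta) ^+ 2)).
  by apply: bounded_measurableD => //; exact: bmZ.
have bmR2 : bounded_measurable Omega (fun x => nn * (D m x * D m x) +
    (nn * (1 - theta x) + (nn * (K1 * eta) + (2 * eta) ^+ 2))).
  by apply: bounded_measurableD => //; exact: bmZ.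
have bmL : bounded_measurable Omega
    (fun x => (partial i zeta x - (chi x - d) * (kappa * n i)) ^+ 2).
  have bmpz : bounded_measurable Omega (partial i zeta).
    have /C1P[_ _ cz] := has_grad_C1 zg.
    exact: (bounded_measurable_continuous OM (cz i)).
  have bm1 := bounded_measurableB bmpz
    (bounded_measurableM (bounded_measurableB bm_chi (bm_c d)) (bm_c (kappa * n i))).
  exact: (bounded_measurableM bm1 bm1).
apply: (@le_trans _ _ (\int[mu2]_(x in Omega)
    (A * (nn * (D m x * D m x) + (nn * (1 - theta x) + (nn * (K1 * eta) + (2 * eta) ^+ 2)))))).
  apply: bounded_le_Rintegral => //; first exact: bmZ.
  move=> x Ox; rewrite zp.
  have := @laminate_error_bound _ kappa (n i) nn (theta x) (D m x) (d - c) (chi x) d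
    (psi m x * partial i theta x) (2 * eta) (K1 * eta) (theta01 x) (nn_ge i) (chi01 x)
    d01 (psi_bd x i) cd2.
  congr (_ ^+ 2 <= _); rewrite /D; ring.
rewrite bounded_RintegralZ // bounded_RintegralD //; last exact: bmZ.
rewrite bounded_RintegralD //; last exact: bmZ.
rewrite !bounded_RintegralZ // Rintegral_csts // -/V -[leRHS]mulrA; apply: ler_wpM2l => //.
(* Here eta <= 1 makes the quadratic error linear in eta. *)
have e2 : (2 * eta) ^+ 2 <= 4 * eta.
  by rewrite exprMn [_ ^+ 2 as X in X * _]expr2 -natrM ler_wpM2l // expr2 ler_piMr // ltW.
have V0' := ltW V0.
have b1 : nn * \int[mu2]_(x in Omega) (D m x * D m x) <= nn * eta by rewrite ler_wpM2l.
have b2 : nn * \int[mu2]_(x in Omega) (1 - theta x) <= nn * eta by rewrite ler_wpM2l.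
have b3 : (nn * (K1 * eta) + (2 * eta) ^+ 2) * V <= (nn * (K1 * eta) + 4 * eta) * V.
  by rewrite ler_wpM2r // lerD2l.
apply: (le_trans (lerD b1 (lerD b2 b3))).
by rewrite le_eqVlt; apply/orP; left; apply/eqP; ring.
Unshelve. all: by end_near.
Qed.

End Direction.
End Laminate_approximation.

(** Writing a as kappa (p, q) with (p, q) nonzero covers a = 0: the phases must still be mixed with
    average d, so stripes in an arbitrary direction are combined with the amplitude kappa = 0. *)
Lemma laminate_approximation {R : realType} (Omega : set (R * R)) (M d : R) (a : 'cV[R]_2) :
  open Omega -> Omega !=set0 -> 0 < M -> Omega `<=` box M -> 0 <= d <= 1 ->
  exists2 K, 0 <= K & forall eta, 0 < eta <= 1 ->
  exists chi zeta, [/\ phase_distribution Omega d chi, C1c Omega zeta &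
    forall i, \int[@lebesgue2 R]_(x in Omega)
      (partial i zeta x - (chi x - d) * a i 0) ^+ 2 <= K * eta].
Proof.
move=> oO O0 M0 OM d01.
have [p [q [kappa [pq0 aE]]]] : exists p q kappa, (p, q) != (0, 0) /\
    forall i, a i 0 = kappa * (if i == 0 then p else q).
  have [a0|a0] := eqVneq a 0.
    by exists 1, 0, 0; split=> [|i]; rewrite ?a0 ?mxE ?mul0r // xpair_eqE oner_eq0.
  exists (a 0 0), (a 1 0), 1; split=> [|i].
    apply: contra_neq a0 => -[a0 a1]; apply/matrixP => i j; rewrite (ord1 j) mxE.
    case: (unliftP 0 i) => [k|] -> //; rewrite (ord1 k) -[RHS]a1.
    by congr (a _ _); exact: val_inj.
  rewrite mul1r; case: (unliftP 0 i) => [k|] -> //; rewrite (ord1 k).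
  by congr (a _ _); exact: val_inj.
have [K K0 KP] := laminate_direction oO O0 M0 OM d01 kappa pq0.
exists K => // eta /KP[chi [zeta [chiP zetaC le]]]; exists chi, zeta; split => // i.
by rewrite aE; exact: le.
Qed.

(** * The divergence theorem on a Lipschitz domain *)

Section Chart.
Context {R : realType}.
Notation RR := (measurableTypeR R).
Notation mu1 := (@lebesgue_measure R).
Notation mu2 := (@lebesgue2 R).

(** The corner [(y.1, x.2)] splits the displacement into two coordinate segments, and the mean value
    theorem applies on each. *)
Lemma has_grad_lipschitz (w : R * R -> R) g (L : R) x y : has_grad w g ->
  (forall i z, `|g i z| <= L) -> `|w x - w y| <= L * (`|x.1 - y.1| + `|x.2 - y.2|).
Proof.
move=> wg gL.
have line i z (t : R) : `|w (z + t *: dir i) - w z| <= L * `|t|.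
  have pos_t z' (t' : R) : 0 <= t' -> `|w (z' + t' *: dir i) - w z'| <= L * `|t'|.
    move=> t0; have [s _ ->] := increment_mean i z' wg t0.
    by rewrite normrM mulrC ler_wpM2r.
  have [t0|/ltW t0] := leP 0 t; first exact: pos_t.
  have := pos_t (z + t *: dir i) (- t); rewrite oppr_ge0 => /(_ t0).
  by rewrite scaleNr addrK normrN distrC.
have d0 z (t : R) : z + t *: dir 0 = (z.1 + t, z.2) :> R * R.
  by rewrite pairD /dir /= -[t *: 1]/(t * 1) -[t *: 0]/(t * 0) mulr1 mulr0 addr0.
have d1 z (t : R) : z + t *: dir (lift 0 0) = (z.1, z.2 + t) :> R * R.
  by rewrite pairD /dir /= -[t *: 1]/(t * 1) -[t *: 0]/(t * 0) mulr1 mulr0 addr0.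
have l0 := line 0 (y.1, x.2) (x.1 - y.1).
have l1 := line (lift 0 0) y (x.2 - y.2).
move: l0 l1; rewrite d0 d1 /= ![_ + (_ - _)]addrC !subrK -surjective_pairing.
move=> l0 l1; rewrite -[w x](subrK (w (y.1, x.2))) -addrA mulrDr.
by rewrite (le_trans (ler_normD _ _)) // lerD.
Qed.

Lemma Rintegral_indicM (D : set (R * R)) (f : R * R -> R) :
  \int[mu2]_(x in D) f x = \int[mu2]_x (\1_D x * f x).
Proof.
rewrite Rintegral_mkcond; apply: eq_Rintegral => x _.
by rewrite patchE indicE; case: ifP => _; rewrite ?mul1r ?mul0r.
Qed.

Lemma interior_flux (Omega : set (R * R)) y r (w : R * R -> R) g i : 0 <= r ->
  disc y r `<=` Omega -> has_grad w g -> supp_in (disc y r) w ->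
  \int[mu2]_(x in Omega) g i x = 0.
Proof.
move=> r0 dO wg sw.
have cd : closed (disc y r).
  by apply: compact_closed; [exact: norm_hausdorff|exact: disc_compact].
rewrite Rintegral_supp; last first.
  exact: supp_in_sub dO (@grad_supp R w g _ i cd wg sw).
by apply: (integral_grad0 i wg); exact: supp_in_sub (disc_box r0) sw.
Qed.

Lemma chart_sqdist (c : chart R) s t : (axis c).1 ^+ 2 + (axis c).2 ^+ 2 = 1 ->
  sqdist (chart_point c s t) (base c) = s ^+ 2 + t ^+ 2.
Proof.
move=> a1; rewrite /sqdist /chart_point /=.
transitivity ((s ^+ 2 + t ^+ 2) * ((axis c).1 ^+ 2 + (axis c).2 ^+ 2)); first by ring.
by rewrite a1 mulr1.
Qed.

(** In the rotated frame of the chart a shift along a coordinate axis is a shift along a unit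
    vector; only the bounds on its components matter later. *)
Lemma chart_point_shift (c : chart R) i : (axis c).1 ^+ 2 + (axis c).2 ^+ 2 = 1 ->
  exists al be, [/\ `|al| <= 1, `|be| <= 1 & forall s t h,
    chart_point c s t - h *: dir i = chart_point c (s - h * al) (t - h * be)].
Proof.
move=> a1.
have n1 : `|(axis c).1| <= 1 /\ `|(axis c).2| <= 1.
  have le (u v : R) : u ^+ 2 + v ^+ 2 = 1 -> `|u| <= 1.
    by move=> uv; apply: (norm_le_of_sum_sqr (v := v)) => //; rewrite uv expr1n.
  by split; [exact: le a1|apply: (le _ (axis c).1); rewrite addrC].
have {n1} [n1 n2] := n1.
have E s t h al be (v : R * R) :
   (al * (axis c).1 - be * (axis c).2 = v.1) ->
   (al * (axis c).2 + be * (axis c).1 = v.2) ->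
   chart_point c s t - h *: v = chart_point c (s - h * al) (t - h * be).
  move=> e1 e2; have -> : - (h *: v) = (- (h * v.1), - (h * v.2)) by [].
  rewrite [LHS]pairD /chart_point /= -e1 -e2.
  by congr pair; ring.
case: (eqVneq i 0) => [->|i0].
  exists (axis c).1, (- (axis c).2); split => // [|s t h]; first by rewrite normrN.
  by apply: E; rewrite /dir /=; [rewrite -a1|]; ring.
exists (axis c).2, (axis c).1; split => // s t h.
by apply: E; rewrite /dir (negbTE i0) /=; [|rewrite -a1]; ring.
Qed.

Lemma boundary_point_continuous (Omega : set (R * R)) (c : chart R) :
  boundary_chart Omega c -> continuous (boundary_point c).
Proof.
move=> cO s; have cg := graph_continuous cO.
pose f1 (s : R) : R := (base c).1 + s * (axis c).1 - graph c s * (axis c).2.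
pose f2 (s : R) : R := (base c).2 + s * (axis c).2 + graph c s * (axis c).1.
have c1 : f1 @ s --> f1 s.
  apply: cvgB; last by apply: cvgM; [exact: cg|exact: cvg_cst].
  by apply: cvgD; [exact: cvg_cst|apply: cvgM; [exact: cvg_id|exact: cvg_cst]].
have c2 : f2 @ s --> f2 s.
  apply: cvgD; last by apply: cvgM; [exact: cg|exact: cvg_cst].
  by apply: cvgD; [exact: cvg_cst|apply: cvgM; [exact: cvg_id|exact: cvg_cst]].
exact: (cvg_pair c1 c2).
Qed.

Lemma measurable_chart_patch (Omega : set (R * R)) (c : chart R) : boundary_chart Omega c ->
  measurable (chart_patch c : set RR).
Proof.
move=> cO.
have mD : measurable ([set s | `|s| < Defs.radius c] : set RR).
  rewrite (_ : [set s | _] = `]- Defs.radius c, Defs.radius c[%classic).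
    exact: measurable_itv.
  by apply/seteqP; split => s; rewrite /= in_itv /= ltr_norml.
rewrite (_ : chart_patch c = [set s | `|s| < Defs.radius c] `&`
    graph c @^-1` [set s | `|s| < Defs.radius c]) //.
apply: measurableI => //; rewrite -[X in measurable X]setTI.
have mgr : measurable_fun [set: RR] (graph c : RR -> RR).
  by apply: continuous_measurable_fun; exact: graph_continuous cO.
exact: mgr.
Qed.

Variables (Omega : set (R * R)) (oO : open Omega) (c : chart R) (rho : R).
Hypotheses (cO : boundary_chart Omega c) (rho0 : 0 <= rho) (rho_lt : rho < Defs.radius c).

(** In chart coordinates Omega is t > graph s. A shift of length h can change the side only if |t -
    graph s| <= ka h, where ka adds 1 for the vertical part of the shift to the slope |k| of the
    graph. This strip has height 2 ka h, which gives K = 2 ka after division by h. *)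
Lemma boundary_flux : exists2 K, 0 <= K & forall (w : R * R -> R) g i J,
  has_grad w g -> supp_in (disc (base c) rho) w ->
  (\int[mu1]_(s in chart_patch c) `|w (boundary_point c s)|%:E <= J%:E)%E ->
  `|\int[mu2]_(x in Omega) g i x| <= K * J.
Proof.
have [_ a1 r0 [k kP] cP] := cO.
have cg := graph_continuous cO.
have mO : measurable (Omega : set (RR * RR)) by exact: open_measurable2.
have glip s t : `|graph c s - graph c t| <= `|k| * `|s - t|.
  have := kP (s, t) (conj I I); rewrite /= => /le_trans; apply.
  by rewrite ler_wpM2r // ler_norm.
pose ka := `|k| + 1.
have ka0 : 0 < ka by rewrite ltr_wpDl.
exists (2 * ka); first by rewrite mulr_ge0 // ltW.
move=> w g i J wg sw wJ.
have [L L0 gL] := grad_bounded wg (supp_in_sub (disc_box rho0) sw).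
have q1 x : `|\1_Omega x : R| <= 1.
  by rewrite indicE; case: (_ \in _); rewrite ?normr1 ?normr0.
have mq : measurable_fun [set: RR * RR] (\1_Omega : RR * RR -> RR).
  exact: measurable_indic.
rewrite Rintegral_indicM.
(* A disc of radius rho moved by less than [radius c - rho] stays in the square where the chart
   describes Omega. The constant [C] pays for replacing w by its boundary value: an error 2 L ka h
   on a strip of height 2 ka h and length 2 [radius c]. *)
apply: (weak_derivative_bound mq q1 wg (supp_in_sub (disc_box rho0) sw)
  (C := 2 * ka * (2 * Defs.radius c * (2 * L * ka))) (t0 := Defs.radius c - rho)).
  by rewrite subr_gt0.
move=> h /andP[h0 hr].
have [al [be [al1 be1 shift]]] := chart_point_shift i a1.
pose T (y : R * R) := chart_point c y.1 y.2.
have pT : mpreserving T by exact: mpreserving_chart.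
pose S : set (R * R) := [set y | `|y.2 - graph c y.1| <= ka * h].
(* [S] contains the points where the indicator function changes under the shift,
   and [H] bounds [w] on [S]. *)
pose H (s : R) : R := \1_[set s | `|s| < Defs.radius c] s *
  (`|w (boundary_point c s)| + 2 * L * (ka * h)).
have H0 s : 0 <= H s.
  rewrite /H mulr_ge0 ?addr_ge0 ?mulr_ge0 //; exact: ltW.
have key y : `|(\1_Omega (T y - h *: dir i) - \1_Omega (T y)) * w (T y)| <=
    H y.1 * \1_S y.
  have [w0|/sw] := eqVneq (w (T y)) 0; first by rewrite w0 mulr0 normr0 mulr_ge0.
  rewrite /disc /= chart_sqdist // => st.
  have s_rho : `|y.1| <= rho by exact: norm_le_of_sum_sqr st.
  have t_rho : `|y.2| <= rho.
    by apply: (@norm_le_of_sum_sqr _ _ y.1) => //; rewrite addrC; exact: st.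
  have shift1 (z e : R) : `|z| <= rho -> `|e| <= 1 -> `|z - h * e| < Defs.radius c.
    move=> z1 e1; apply: (le_lt_trans (ler_normB _ _)).
    have : `|h * e| <= h by rewrite normrM gtr0_norm // ler_piMr // ltW.
    by lra.
  have in1 : (T y \in Omega) = (graph c y.1 < y.2).
    apply/idP/idP => [/set_mem|] H'; [apply/(cP y.1 y.2)|apply/mem_set/(cP y.1 y.2)] => //;
      by lra.
  have in2 : (T y - h *: dir i \in Omega) = (graph c (y.1 - h * al) < y.2 - h * be).
    rewrite /T shift; apply/idP/idP => [/set_mem|] H';
      [apply/(cP (y.1 - h * al) (y.2 - h * be))|apply/mem_set/(cP (y.1 - h * al) (y.2 - h * be))] => //;
      exact: shift1.
  have sr : `|y.1| < Defs.radius c by lra.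
  have [yS|yS] := boolP (y \in S).
    have -> : H y.1 = `|w (boundary_point c y.1)| + 2 * L * (ka * h).
      by rewrite /H indicE mem_set ?mul1r.
    rewrite [\1_S y]indicE yS mulr1 normrM.
    have d1 : `|\1_Omega (T y - h *: dir i) - \1_Omega (T y) : R| <= 1.
      by rewrite !indicE; case: (_ \in _); case: (_ \in _);
        rewrite ?subrr ?subr0 ?sub0r ?normrN ?normr0 ?normr1.
    apply: (le_trans (ler_piMl (normr_ge0 _) d1)).
    have lip := has_grad_lipschitz (T y) (boundary_point c y.1) wg gL.
    have a2 : `|(axis c).1| <= 1 /\ `|(axis c).2| <= 1.
      split; [apply: (@norm_le_of_sum_sqr _ _ (axis c).2) => //; rewrite a1 expr1n //|].
      by apply: (@norm_le_of_sum_sqr _ _ (axis c).1) => //; rewrite addrC a1 expr1n.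
    have d2 : `|(T y).1 - (boundary_point c y.1).1| <= ka * h.
      rewrite (_ : _ - _ = - ((y.2 - graph c y.1) * (axis c).2)); last first.
        by rewrite /T /boundary_point /chart_point /=; ring.
      rewrite normrN normrM; have := set_mem yS; rewrite /S /=.
      by apply: le_trans; apply: ler_piMr => //; case: a2.
    have d3 : `|(T y).2 - (boundary_point c y.1).2| <= ka * h.
      rewrite (_ : _ - _ = (y.2 - graph c y.1) * (axis c).1); last first.
        by rewrite /T /boundary_point /chart_point /=; ring.
      rewrite normrM; have := set_mem yS; rewrite /S /=.
      by apply: le_trans; apply: ler_piMr => //; case: a2.
    have : L * (`|(T y).1 - (boundary_point c y.1).1| +
        `|(T y).2 - (boundary_point c y.1).2|) <= L * (ka * h + ka * h).
      by rewrite ler_wpM2l // lerD.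
    move=> /(le_trans lip) {}lip.
    rewrite -[w (T y)](subrK (w (boundary_point c y.1))) (le_trans (ler_normD _ _)) //.
    rewrite addrC lerD2l (le_trans lip) // le_eqVlt; apply/orP; left; apply/eqP; ring.
  have -> : \1_Omega (T y - h *: dir i) = \1_Omega (T y) :> R.
    rewrite !indicE in1 in2; congr (_ %:R); congr nat_of_bool.
    move: yS; rewrite notin_setE /S /= => /negP; rewrite -ltNge.
    have gl := glip (y.1 - h * al) y.1.
    have hal : `|h * al| <= h by rewrite normrM gtr0_norm // ler_piMr // ltW.
    have hbe : `|h * be| <= h by rewrite normrM gtr0_norm // ler_piMr // ltW.
    have {}gl : `|graph c (y.1 - h * al) - graph c y.1| <= `|k| * h.
      apply: (le_trans gl); rewrite ler_wpM2l // (_ : _ - _ = - (h * al)) ?normrN //.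
      by ring.
    rewrite /ka mulrDl mul1r; move: (`|k| * h) gl hbe => kh.
    move: (graph c (y.1 - h * al)) (graph c y.1) (h * be) (y.2) => g1 g2 hb t.
    rewrite !ler_norml ltr_normr => /andP[? ?] /andP[? ?] /orP[?|?];
      apply/idP/idP => ?; lra.
  by rewrite subrr mul0r normr0 mulr_ge0.
have bdiff : bms (fun x => (\1_Omega (x - h *: dir i) - \1_Omega x) * w x).
  apply: bmsM; last exact: bms_continuous (has_grad_continuous wg) (supp_in_sub (disc_box rho0) sw).
    apply: measurable_funB => //.
    by apply: (measurable_translate (- (h *: dir i))).
  exists 2 => x; rewrite (le_trans (ler_normB _ _)) //.
  by rewrite -[2]/(1 + 1) lerD.
have [mdiff _ _] := bdiff.
have DE : [set s | `|s| < Defs.radius c] = `]- Defs.radius c, Defs.radius c[%classic.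
  by apply/seteqP; split => s; rewrite /= in_itv /= ltr_norml.
have mDs : measurable ([set s | `|s| < Defs.radius c] : set RR).
  by rewrite DE; exact: measurable_itv.
have mwb : measurable_fun [set: RR] ((fun s => `|w (boundary_point c s)|) : RR -> RR).
  apply: measurableT_comp => //; apply: continuous_measurable_fun => s.
  apply: continuous_comp; first exact: (boundary_point_continuous cO).
  exact: (has_grad_continuous wg).
have mH : measurable_fun [set: RR] (H : RR -> RR).
  apply: measurable_funM; first exact: measurable_indic.
  by apply: measurable_funD => //; exact: measurable_cst.
have mS : measurable (S : set (RR * RR)).
  have mg : measurable_fun [set: RR * RR] ((fun y => `|y.2 - graph c y.1|) : RR * RR -> RR).
    apply: measurableT_comp => //; apply: measurable_funB => //.
    apply: (measurableT_comp _ (@measurable_fst _ _ RR RR)).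
    by apply: continuous_measurable_fun.
  rewrite (_ : S = (fun y => `|y.2 - graph c y.1|) @^-1` `]-oo, (ka * h)]%classic).
    by rewrite -[X in measurable X]setTI; apply: mg => //; exact: measurable_itv.
  by apply/seteqP; split => y; rewrite /S /= in_itv.
have mpatch := measurable_chart_patch cO.
rewrite -lee_fin EFin_normr_Rintegral //; last exact: bms_integrable.
have mEf : measurable_fun [set: RR * RR]
  (EFin \o (fun x => (\1_Omega (x - h *: dir i) - \1_Omega x) * w x)).
  exact/measurable_EFinP.
apply: le_trans (le_abse_integral mu2 measurableT mEf) _.
rewrite -(mpreserving_integral pT); last exact: measurableT_comp.
apply: (@le_trans _ _ (\int[mu2]_y (H y.1 * \1_S y)%:E)%E).
  apply: ge0_le_integral => //.
  - have [mT _] := pT; apply: measurableT_comp => //; exact: (measurableT_comp mEf mT).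
  - apply/measurable_EFinP; apply: measurable_funM; last exact: measurable_indic.
    exact: (measurableT_comp mH).
  - by move=> y _; rewrite /= lee_fin key.
have mHS : measurable_fun [set: RR * RR]
    ((fun y => (H y.1 * \1_S y)%:E) : RR * RR -> \bar R).
  apply/measurable_EFinP; apply: measurable_funM; last exact: measurable_indic.
  exact: (measurableT_comp mH).
have kh0 : 0 <= ka * h by rewrite mulr_ge0 // ltW.
have -> : (\int[mu2]_y (H y.1 * \1_S y)%:E = \int[mu1]_s ((2 * (ka * h)) * H s)%:E)%E.
  rewrite (fubini_tonelli1 _ mHS) => [|y]; last by rewrite lee_fin mulr_ge0.
  apply: eq_integral => s _; rewrite /fubini_F /=.
  transitivity (\int[mu1]_t ((H s)%:E * (\1_(`[(graph c s - ka * h)%R, (graph c s + ka * h)%R]%classic) t)%:E))%E.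
    apply: eq_integral => t _; rewrite -EFinM !indicE; congr (_ * _%:R)%:E.
    by congr nat_of_bool; apply/idP/idP; rewrite !inE /S /= in_itv /= -ler_distl distrC.
  have mI : measurable (`[graph c s - ka * h, graph c s + ka * h]%classic : set RR).
    exact: measurable_itv.
  rewrite ge0_integralZl_EFin //; last 1 first.
    by apply/measurable_EFinP; exact: measurable_indic.
  rewrite integral_indic //.
  have mu1I : mu1 `[(graph c s - ka * h)%R, (graph c s + ka * h)%R]%classic =
      (2 * (ka * h))%:E.
    rewrite lebesgue_measure_itv /= lte_fin ltrD2l gtrN ?mulr_gt0 //.
    by rewrite -EFinB; congr EFin; ring.
  by rewrite setIT [X in (_ * X)%E]mu1I -EFinM mulrC.
pose C0 := 2 * L * (ka * h).
have C00 : 0 <= C0 by rewrite mulr_ge0 // mulr_ge0.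
have HE s : H s = (fun s => `|w (boundary_point c s)|) \_ (chart_patch c) s +
    C0 * \1_[set s | `|s| < Defs.radius c] s.
  rewrite /H patchE -/C0; have [sr|sr] := boolP (`|s| < Defs.radius c); last first.
    rewrite indicE memNset; last exact/negP.
    rewrite mul0r mulr0 addr0; case: ifPn => // /set_mem[sr' _].
    by rewrite sr' in sr.
  rewrite indicE mem_set // mul1r mulr1; congr (_ + _).
  (* Here |s| < [radius c] but |graph s| >= [radius c] > rho, so the boundary point is outside the
     support of w. *)
  case: ifPn => //; rewrite notin_setE => np.
  have [->|/sw] := eqVneq (w (boundary_point c s)) 0; first by rewrite normr0.
  rewrite /disc /boundary_point /= chart_sqdist // => st; exfalso; apply: np.
  split => //.
  apply: le_lt_trans rho_lt; apply: (@norm_le_of_sum_sqr _ _ s) => //.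
  by rewrite addrC; exact: st.
have mwp : measurable_fun [set: RR]
    ((fun s => `|w (boundary_point c s)|) \_ (chart_patch c) : RR -> RR).
  by apply/(measurable_restrictT _ mpatch); exact: measurable_funTS.
have IH : (\int[mu1]_s (H s)%:E <= (J + C0 * (2 * Defs.radius c))%:E)%E.
  under eq_integral do rewrite HE EFinD.
  rewrite ge0_integralD //; last 1 first.
  - by apply/measurable_EFinP; apply: measurable_funM => //; exact: measurable_indic.
  - rewrite EFinD; apply: leeD.
      apply: le_trans wJ; rewrite [leRHS]integral_mkcond le_eqVlt; apply/orP; left; apply/eqP.
      by apply: eq_integral => s _; rewrite !patchE; case: ifP.
    under eq_integral do rewrite EFinM.
    rewrite ge0_integralZl_EFin //; last first.
      by apply/measurable_EFinP; exact: measurable_indic.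
    have mu1D : mu1 `](- Defs.radius c)%R, (Defs.radius c)%R[%classic =
        (2 * Defs.radius c)%:E.
      rewrite lebesgue_measure_itv /= lte_fin gtrN //.
      by rewrite -EFinB; congr EFin; ring.
    by rewrite integral_indic // setIT DE [X in (_ * X)%E]mu1D -EFinM.
  - by move=> s _; rewrite lee_fin patchE; case: ifP.
  - exact/measurable_EFinP.
  - by move=> s _; rewrite lee_fin mulr_ge0.
under eq_integral do rewrite EFinM.
rewrite ge0_integralZl_EFin //.
- apply: le_trans (lee_wpmul2l _ IH) _; first by rewrite lee_fin mulr_ge0.
  rewrite -EFinM lee_fin /C0 le_eqVlt; apply/orP; left; apply/eqP; ring.
- by move=> s _; rewrite lee_fin.
- exact/measurable_EFinP.
- by rewrite mulr_ge0.
Qed.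

End Chart.

(** * Partition of unity on a compact set *)

Section Partition.
Context {R : realType}.
Notation RR := (measurableTypeR R).
Notation mu2 := (@lebesgue2 R).

Lemma plane_cover_compact (K : set (R * R)) : compact K -> cover_compact K.
Proof.
pose T : ptopologicalType := HB.pack (R * R)%type (Topological.class (R * R)%type).
move=> cK; have : @compact T K by exact: cK.
by rewrite compact_cover.
Qed.

Lemma has_grad_exists_sum (s : seq (R * R)) (u : R * R -> R * R -> R) :
  (forall z, exists g, has_grad (u z) g) ->
  exists g, has_grad (fun x => \sum_(z <- s) u z x) g.
Proof.
by move=> /choice[g ug]; eexists; exact: (has_grad_sum s ug).
Qed.

(** Finitely many bumps cover K, but their sum S may vanish away from K, so dividing by S would not
    give functions that are C^1 on the plane. The denominator is therefore modified where S is below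
    its positive minimum on K. The predicate [P] records what makes a disc usable. *)
Lemma partition_of_unity (K : set (R * R)) (P : R * R -> R -> Prop) :
  compact K -> K !=set0 -> (forall x, K x -> exists r, 0 < r /\ P x r) ->
  exists (s : seq (R * R)) (r : R * R -> R) (phi : R * R -> R * R -> R),
  [/\ forall z, z \in s -> 0 < r z /\ P z (r z),
      forall z, exists g, has_grad (phi z) g,
      forall z, supp_in (disc z (r z)) (phi z)
    & forall x, K x -> \sum_(z <- s) phi z x = 1].
Proof.
move=> cK K0 KP.
have /choice[r rP] : forall z, exists r, K z -> 0 < r /\ P z r.
  by move=> z; have [/KP[r rP]|nK] := pselect (K z); [exists r|exists 0].
have := plane_cover_compact cK.
move=> /(_ (R * R)%type K (fun z => [set x | 0 < disc_bump z (r z) x])).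
have bo z : K z -> open [set x | 0 < disc_bump z (r z) x].
  move=> _; have [g /has_grad_continuous cb] := has_grad_bump z (r z).
  by move/continuousP: cb => /(_ _ (@open_gt R 0)).
move=> /(_ bo) [|D DK Dc].
  move=> z Kz; exists z => //=; rewrite bump_gt0 /sqdist !subrr mulr0 addr0.
  by rewrite exprn_gt0 //; have [] := rP z Kz.
pose s : seq (R * R) := finmap.enum_fset D.
pose S x := \sum_(z <- s) disc_bump z (r z) x.
have S0 x : 0 <= S x by apply: sumr_ge0 => z _; exact: bump_ge0.
have [g Sg] : exists g, has_grad S g.
  by apply: has_grad_exists_sum => z; exact: has_grad_bump.
have SK x : K x -> 0 < S x.
  move=> /Dc[z /= zD zx]; rewrite /S (bigD1_seq z) ?finmap.fset_uniq //=.
  by rewrite ltr_pwDl // sumr_ge0 // => y _; exact: bump_ge0.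
have [m m0 mS] : exists2 m, 0 < m & forall x, K x -> m <= S x.
  have [|c cK' cP] := compact_EVT_min K0 cK (f := S).
    by apply: continuous_subspaceT; exact: (has_grad_continuous Sg).
  exists (S c); first by apply: SK; exact: set_mem.
  by move=> x Kx; apply: cP; exact: mem_set.
(* [L] is positive everywhere and coincides with [S] on [K]. *)
pose L x := S x + (2 / m) * (pos (m - S x) ^+ 2 / 2).
have Lpos x : 0 < L x.
  rewrite /L; have [h|h] := ltP (S x) m; last first.
    rewrite ltr_pwDl ?(lt_le_trans m0) // mulr_ge0 ?divr_ge0 ?sqr_ge0 //; exact: ltW.
  rewrite ltr_wpDl // mulr_gt0 ?divr_gt0 ?exprn_gt0 // pos_id ?subr_ge0 ?ltW //.
  by rewrite subr_gt0.
have [g' Lg] : exists g, has_grad L g.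
  have dg := has_gradD (has_grad_cst m) (has_gradZ (-1) Sg).
  have pg := has_grad_comp (f := fun t => pos t ^+ 2 / 2) (f' := pos) dg
    (fun x => is_derive_pos_sq _) (fun x => @continuous_pos R _).
  eexists; apply: has_grad_ext (has_gradD Sg (has_gradZ (2 / m) pg)) _ _ => //.
  by move=> x; rewrite /L /= mulN1r.
exists s, r, (fun z x => disc_bump z (r z) x * (L x)^-1); split.
- by move=> z /DK /set_mem /rP.
- move=> z; have [h bg] := has_grad_bump z (r z); eexists.
  exact: (has_gradM bg (has_gradV Lg Lpos)).
- by move=> z x; rewrite mulf_eq0 negb_or => /andP[/bump_supp].
- move=> x Kx; rewrite -mulr_suml -/(S x) /L pos_le0 ?subr_le0 ?mS //.
  by rewrite expr0n /= mul0r mulr0 addr0 divff // gt_eqF // SK.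
Qed.

End Partition.

Lemma ecvg0_le {R : realType} (a : nat -> \bar R) (e : R) :
  a @ \oo --> 0%E -> 0 < e -> \forall n \near \oo, (a n <= e%:E)%E.
Proof.
move=> /fine_cvgP[fa /cvgrPdist_le/(_ e)] /[apply]; move: fa.
apply: filterS2 => n fan; rewrite sub0r normrN /= => le.
by rewrite -(fineK fan) lee_fin (le_trans (ler_norm _)).
Qed.

(** * The average of an admissible gradient *)

Section Gradient_average.
Context {R : realType}.
Notation RR := (measurableTypeR R).
Notation mu1 := (@lebesgue_measure R).
Notation mu2 := (@lebesgue2 R).
Variables (Omega : set (R * R)) (M : R).
Hypotheses (oO : open Omega) (O0 : Omega !=set0) (OM : Omega `<=` box M).

Let mO : measurable (Omega : set (RR * RR)). Proof. exact: open_measurable2. Qed.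
Let Ooo : (mu2 Omega < +oo)%E. Proof. exact: finite_measure_box OM. Qed.

Lemma chart_patch_measure (c : chart R) : boundary_chart Omega c ->
  (mu1 (chart_patch c) <= (2 * Defs.radius c)%:E)%E.
Proof.
move=> cO; have [_ _ r0 _ _] := cO.
have <- : mu1 `](- Defs.radius c)%R, (Defs.radius c)%R[%classic = (2 * Defs.radius c)%:E.
  rewrite lebesgue_measure_itv /= lte_fin gtrN //.
  by rewrite -EFinB; congr EFin; ring.
apply: le_measure; rewrite ?inE.
- exact: (measurable_chart_patch cO).
- exact: measurable_itv.
- by move=> s [+ _]; rewrite /= in_itv /= ltr_norml.
Qed.

(* The pointwise bound |v| <= lam / 2 + v^2 / (2 lam) replaces the
   Cauchy-Schwarz inequality. *)
Lemma patch_L1_bound (c : chart R) (v phi : R * R -> R) (C lam : R) :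
  boundary_chart Omega c -> continuous v -> continuous phi ->
  0 <= C -> (forall x, `|phi x| <= C) -> 0 < lam ->
  (\int[mu1]_(s in chart_patch c) ((v (boundary_point c s)) ^+ 2)%:E <= (lam ^+ 2)%:E)%E ->
  (\int[mu1]_(s in chart_patch c) `|v (boundary_point c s) * phi (boundary_point c s)|%:E
    <= (C * (Defs.radius c + 2^-1) * lam)%:E)%E.
Proof.
move=> cO cv cphi C0 phiC lam0 vlam; have [_ _ r0 _ _] := cO.
have mp := measurable_chart_patch cO.
have cb := boundary_point_continuous cO.
have mcomp (u : R * R -> R) : continuous u ->
    measurable_fun (chart_patch c : set RR) ((fun s => u (boundary_point c s)) : RR -> RR).
  move=> cu; apply: measurable_funTS; apply: continuous_measurable_fun => s.
  by apply: continuous_comp; [exact: cb|exact: cu].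
have mv2 : measurable_fun (chart_patch c : set RR)
    (fun s => ((v (boundary_point c s)) ^+ 2)%:E).
  by apply/measurable_EFinP; apply: measurable_funX; exact: mcomp.
apply: (@le_trans _ _ (\int[mu1]_(s in chart_patch c)
   ((C * (lam / 2))%:E + (C / (2 * lam))%:E * ((v (boundary_point c s)) ^+ 2)%:E))%E).
  apply: ge0_le_integral => //.
  - apply/measurable_EFinP; apply: measurableT_comp => //.
    by apply: measurable_funM; exact: mcomp.
  - apply: emeasurable_funD; first exact: measurable_cst.
    by apply: emeasurable_funM => //; exact: measurable_cst.
  - move=> s _; rewrite -EFinM -EFinD lee_fin normrM.
    move: (v _) (phiC (boundary_point c s)) => y yC.
    apply: (@le_trans _ _ (`|y| * C)); first exact: ler_wpM2l.
    rewrite -subr_ge0.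
    rewrite (_ : _ - _ = C / (2 * lam) * (lam - `|y|) ^+ 2).
      by rewrite mulr_ge0 ?sqr_ge0 // divr_ge0 // mulr_ge0 // ltW.
    rewrite -[y ^+ 2]real_normK ?num_real //; field.
    by rewrite gt_eqF.
rewrite ge0_integralD //.
- rewrite integral_cst // ge0_integralZl_EFin //.
  + apply: (@le_trans _ _ ((C * (lam / 2))%:E * (2 * Defs.radius c)%:E +
      (C / (2 * lam))%:E * (lam ^+ 2)%:E)%E).
      apply: leeD; apply: lee_wpmul2l => //.
      * by rewrite lee_fin mulr_ge0 // divr_ge0 // ltW.
      * exact: chart_patch_measure.
      * by rewrite lee_fin divr_ge0 // mulr_ge0 // ltW.
    rewrite -!EFinM -EFinD lee_fin le_eqVlt; apply/orP; left; apply/eqP; field.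
    by rewrite gt_eqF.
  + by move=> s _; rewrite lee_fin sqr_ge0.
  + by rewrite divr_ge0 // mulr_ge0 // ltW.
- by move=> s _; rewrite lee_fin mulr_ge0 // divr_ge0 // ltW.
- move=> s _; rewrite -EFinM lee_fin mulr_ge0 ?sqr_ge0 //.
  by rewrite divr_ge0 // mulr_ge0 // ltW.
- by apply: emeasurable_funM => //; exact: measurable_cst.
Qed.

(** On a disc inside Omega the flux of v_n phi is zero. On a chart disc it is controlled by the L^1
    norm of v_n phi on the patch, hence by the L^2 norm of v_n there, which tends to 0. *)
Lemma flux_cvg0 (v : nat -> R * R -> R) (gv : nat -> 'I_2 -> R * R -> R)
    (phi : R * R -> R) gphi z r i :
  (forall n, has_grad (v n) (gv n)) -> has_grad phi gphi ->
  supp_in (disc z r) phi -> 0 < r ->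
  (disc z r `<=` Omega \/ exists c, [/\ boundary_chart Omega c, base c = z &
     r < Defs.radius c]) ->
  (forall c, boundary_chart Omega c ->
    (fun n => \int[mu1]_(s in chart_patch c) ((v n (boundary_point c s)) ^+ 2)%:E)%E
      @ \oo --> 0%E) ->
  (fun n => \int[mu2]_(x in Omega) (v n x * gphi i x + phi x * gv n i x)) @ \oo --> 0.
Proof.
move=> vg phig sphi r0 loc tr.
have sw n : supp_in (disc z r) (fun x => v n x * phi x).
  by move=> x; rewrite mulf_eq0 negb_or => /andP[_ /sphi].
have wg n := has_gradM (vg n) phig.
case: loc => [dO|[c [cO cz rc]]].
  under eq_fun do rewrite (interior_flux _ (ltW r0) dO (wg _) (sw _)).
  exact: cvg_cst.
have [C C0 phiC] := continuous_bounded (has_grad_continuous phig)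
  (supp_in_sub (disc_box (ltW r0)) sphi).
have [K K0 KP] := boundary_flux oO cO (ltW r0) rc.
have [_ _ rad0 _ _] := cO.
pose B := K * (C * (Defs.radius c + 2^-1)).
have B0 : 0 <= B.
  by rewrite mulr_ge0 // mulr_ge0 // addr_ge0 // ?invr_ge0 // ltW.
apply/cvgrPdist_le => e e0.
have lam0 : 0 < e / (B + 1) by rewrite divr_gt0 // ltr_wpDl.
have lam20 : (0 < (e / (B + 1)) ^+ 2) by rewrite exprn_gt0.
have ev : \forall n \near \oo,
   (\int[mu1]_(s in chart_patch c) ((v n (boundary_point c s)) ^+ 2)%:E <=
      ((e / (B + 1)) ^+ 2)%:E)%E.
  exact: ecvg0_le (tr c cO) lam20.
apply: filterS ev => n evn.
have := patch_L1_bound cO (has_grad_continuous (vg n)) (has_grad_continuous phig)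
  C0 phiC lam0 evn.
move=> /(KP _ _ i _ (wg n)); rewrite cz => /(_ (sw n)).
rewrite sub0r normrN => /le_trans; apply.
rewrite (_ : _ * _ = B * (e / (B + 1))); last by rewrite /B; ring.
by rewrite mulrCA ger_pMr // ler_pdivrMr ?ltr_wpDl // mul1r lerDl.
Qed.

(** Use |g| <= 1 + g^2 on a set of finite measure. *)
Lemma L2_integrable (g : R * R -> R) : L2 Omega g -> mu2.-integrable Omega (EFin \o g).
Proof.
move=> [mg g2]; have mEg : measurable_fun (Omega : set (RR * RR)) (EFin \o g).
  exact/measurable_EFinP.
have mg2 : measurable_fun (Omega : set (RR * RR)) (fun x => (g x ^+ 2)%:E).
  by apply/measurable_EFinP; exact: measurable_funX.
apply/integrableP; split => //.
apply: (@le_lt_trans _ _ (\int[mu2]_(x in Omega) (1 + (g x ^+ 2)%:E))%E).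
  apply: ge0_le_integral => //.
  - exact: measurableT_comp.
  - by apply: emeasurable_funD => //; exact: measurable_cst.
  - move=> x _; rewrite /= lee_fin -(real_normK (num_real (g x))).
    by have := normr_ge0 (g x); move: `|g x| => y y0; nra.
rewrite ge0_integralD //; last by move=> x _; rewrite lee_fin sqr_ge0.
by rewrite integral_cst // mul1e lte_add_pinfty.
Qed.

Lemma L2_cvg_integral (F : nat -> R * R -> R) (g : R * R -> R) :
  (forall n, bounded_measurable Omega (F n)) -> L2 Omega g ->
  (fun n => \int[mu2]_(x in Omega) ((F n x - g x) ^+ 2)%:E)%E @ \oo --> 0%E ->
  (fun n => \int[mu2]_(x in Omega) F n x) @ \oo --> \int[mu2]_(x in Omega) g x.
Proof.
move=> bF L2g cvg; have ig := L2_integrable L2g; have [mg _] := L2g.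
have iF n := bounded_measurable_integrable mO Ooo (bF n).
pose V := fine (mu2 Omega).
have VE : mu2 Omega = V%:E by rewrite fineK // ge0_fin_numE.
have V0 : 0 <= V by exact: fine_ge0.
apply/cvgrPdist_le => e e0.
(* The pointwise bound |y| <= lam / 2 + y^2 / (2 lam), with the integral of y^2 at most lam^2,
   integrates to lam (V + 1) / 2 = e / 2. *)
pose lam := e / (V + 1).
have lam0 : 0 < lam by rewrite divr_gt0 // ltr_wpDl.
have lam20 : 0 < lam ^+ 2 by rewrite exprn_gt0.
have := ecvg0_le cvg lam20; apply: filterS => n le.
have [mF _] := bF n.
have mh : measurable_fun (Omega : set (RR * RR)) (fun x => F n x - g x).
  exact: measurable_funB.
rewrite distrC -RintegralB // -lee_fin EFin_normr_Rintegral //; last first.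
  rewrite (_ : EFin \o _ = ((EFin \o F n) \- (EFin \o g))%E) //.
  exact: integrableB.
have mEh : measurable_fun (Omega : set (RR * RR)) (EFin \o (fun x => F n x - g x)).
  exact/measurable_EFinP.
apply: le_trans (le_abse_integral mu2 mO mEh) _.
have mh2 : measurable_fun (Omega : set (RR * RR)) (fun x => ((F n x - g x) ^+ 2)%:E).
  by apply/measurable_EFinP; exact: measurable_funX.
apply: (@le_trans _ _ (\int[mu2]_(x in Omega)
   ((lam / 2)%:E + ((2 * lam)^-1)%:E * ((F n x - g x) ^+ 2)%:E))%E).
  apply: ge0_le_integral => //.
  - exact: measurableT_comp.
  - apply: emeasurable_funD; first exact: measurable_cst.
    by apply: emeasurable_funM => //; exact: measurable_cst.
  - move=> x _; rewrite -EFinM -EFinD lee_fin; move: (F n x - g x) => y.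
    rewrite -subr_ge0 (_ : _ - _ = (2 * lam)^-1 * (lam - `|y|) ^+ 2).
      by rewrite mulr_ge0 ?sqr_ge0 // invr_ge0 mulr_ge0 // ltW.
    rewrite -[y ^+ 2]real_normK ?num_real //; field.
    by rewrite gt_eqF.
rewrite ge0_integralD //.
- rewrite integral_cst // ge0_integralZl_EFin //.
  + rewrite VE; apply: (@le_trans _ _ ((lam / 2)%:E * V%:E +
      ((2 * lam)^-1)%:E * (lam ^+ 2)%:E)%E).
      by apply: leeD => //; apply: lee_wpmul2l => //; rewrite lee_fin invr_ge0 mulr_ge0 // ltW.
    rewrite -!EFinM -EFinD lee_fin.
    have V1 : V + 1 != 0 by rewrite gt_eqF // ltr_wpDl.
    rewrite (_ : _ + _ = lam * ((V + 1) / 2)); last by field; rewrite gt_eqF.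
    rewrite (_ : lam * _ = e / 2); last by rewrite /lam; field.
    by lra.
  + by move=> x _; rewrite lee_fin sqr_ge0.
  + by rewrite invr_ge0 mulr_ge0 // ltW.
- by move=> x _; rewrite lee_fin divr_ge0 // ltW.
- move=> x _; rewrite -EFinM lee_fin mulr_ge0 ?sqr_ge0 //.
  by rewrite invr_ge0 mulr_ge0 // ltW.
- by apply: emeasurable_funM => //; exact: measurable_cst.
Qed.

Lemma sum_integral_cvg0 (s : seq (R * R)) (F : R * R -> nat -> R * R -> R) :
  (forall z n, bounded_measurable Omega (F z n)) ->
  (forall z, z \in s -> (fun n => \int[mu2]_(x in Omega) F z n x) @ \oo --> 0) ->
  (forall n, bounded_measurable Omega (fun x => \sum_(z <- s) F z n x)) /\
  (fun n => \int[mu2]_(x in Omega) (\sum_(z <- s) F z n x)) @ \oo --> 0.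
Proof.
move=> bF; elim: s => [|z s IH] Fs.
  split=> [n|].
    by under eq_fun do rewrite big_nil; exact: bounded_measurable_cst.
  rewrite (_ : (fun n => _) = fun=> 0); first exact: cvg_cst.
  apply/funext => n; under eq_Rintegral do rewrite big_nil.
  by rewrite Rintegral_cst // mul0r.
have [|bs cs] := IH; first by move=> y ys; apply: Fs; rewrite inE ys orbT.
have cz : (fun n => \int[mu2]_(x in Omega) F z n x) @ \oo --> 0.
  by apply: Fs; exact: mem_head.
split=> [n|].
  by under eq_fun do rewrite big_cons; exact: bounded_measurableD.
rewrite (_ : (fun n => _) = fun n => \int[mu2]_(x in Omega) F z n x +
    \int[mu2]_(x in Omega) (\sum_(y <- s) F y n x)).
  by rewrite -[X in _ --> X](addr0 (0 : R)); apply: cvgD; [exact: cz|exact: cs].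
apply/funext => n; rewrite -bounded_RintegralD //.
by apply: eq_Rintegral => x _; rewrite big_cons.
Qed.

Lemma closure_compact : compact (closure Omega).
Proof.
apply: (subclosed_compact (@closed_closure _ _) (@box_compact R M)).
by rewrite closureE; apply: smallest_sub => //; exact: box_closed.
Qed.

Lemma local_disc z : lipschitz_boundary Omega -> closure Omega z ->
  exists r, 0 < r /\ (disc z r `<=` Omega \/
    exists c, [/\ boundary_chart Omega c, base c = z & r < Defs.radius c]).
Proof.
move=> lip cz; have [Oz|nOz] := pselect (Omega z).
  have /nbhs_ballP[e /= e0 eO] := oO Oz.
  exists (e / 2); split; first by rewrite divr_gt0.
  left=> x xz; apply: eO; rewrite ball_prod_normE /ball_ /= distrC.
  have e2 : 0 <= e / 2 by rewrite divr_ge0 // ltW.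
  by apply: le_lt_trans (sqdist_norm e2 xz) _; lra.
have [|c [cO cz']] := lip z; first by split=> // /interior_subset.
have [_ _ r0 _ _] := cO.
exists (Defs.radius c / 2); split; first by rewrite divr_gt0.
by right; exists c; split => //; lra.
Qed.

(** Let v_n = u_n - f.x. On Omega the partition functions sum to 1 and their derivatives to 0, so
    the derivatives of the localized products add up to that of v_n. Each localized integral tends
    to 0, while the integrals of the derivatives of u_n tend to that of G by L^2 convergence. *)
Lemma gradient_average (f : 'cV[R]_2) (G : R * R -> 'cV[R]_2) i :
  lipschitz_boundary Omega -> admissible_gradient Omega f G ->
  \int[mu2]_(x in Omega) G x i 0 = f i 0 * fine (mu2 Omega).
Proof.
move=> lip [eta [[_ GL2 _] [T [Tm [u [uC1 _ du utr]]] Tae]]].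
pose v n x := u n x - dot f (vec x).
pose gv n (j : 'I_2) x := partial j (u n) x - f j 0.
have ug n : has_grad (u n) (fun j => partial j (u n)) by exact/C1P.
have vg n : has_grad (v n) (gv n).
  apply: has_grad_ext (has_gradD (ug n) (has_gradZ (-1) (has_grad_affine f))) _ _.
    by move=> x; rewrite mulN1r.
  by move=> j x; rewrite mulN1r.
have vtr c : boundary_chart Omega c ->
    (fun n => \int[mu1]_(s in chart_patch c) ((v n (boundary_point c s)) ^+ 2)%:E)%E
      @ \oo --> 0%E.
  move=> cO; have := utr c cO.
  set A := (X in fmap X _ --> _ -> _); set B := (X in _ -> fmap X _ --> _).
  (* The trace [T] equals f.x almost everywhere on each patch, so it can be replaced under the
     integral. *)
  suff -> : B = A by [].
  apply/esym/funext => n; rewrite /A /B.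
  have mp := measurable_chart_patch cO.
  have mcomp (w : R * R -> R) : continuous w ->
      measurable_fun (chart_patch c : set RR) ((fun s => w (boundary_point c s)) : RR -> RR).
    move=> cw; apply: measurable_funTS; apply: continuous_measurable_fun => s.
    by apply: continuous_comp; [exact: (boundary_point_continuous cO)|exact: cw].
  apply: ae_eq_integral => //.
  - apply/measurable_EFinP; apply: measurable_funX; apply: measurable_funB.
      by apply: mcomp; exact: (has_grad_continuous (ug n)).
    exact: Tm.
  - apply/measurable_EFinP; apply: measurable_funX; apply: mcomp.
    exact: (has_grad_continuous (vg n)).
  - have := Tae c cO; apply: filterS; first exact: (ae_filter_ringOfSetsType mu1).
    by move=> s sT sp; rewrite sT.
have Kne : closure Omega !=set0 by have [x Ox] := O0; exists x; exact: subset_closure.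
have [s [r [phi [srP phig sphi phi1]]]] := partition_of_unity
  (P := fun z r => disc z r `<=` Omega \/
    exists c, [/\ boundary_chart Omega c, base c = z & r < Defs.radius c])
  closure_compact Kne (fun z cz => local_disc lip cz).
have /choice[gphi phiG] := phig.
pose F z n x := v n x * gphi z i x + phi z x * gv n i x.
have bF z n : bounded_measurable Omega (F z n).
  have [_ _ cF] := has_gradM (vg n) (phiG z).
  exact: (bounded_measurable_continuous OM (cF i)).
have cF z : z \in s -> (fun n => \int[mu2]_(x in Omega) F z n x) @ \oo --> 0.
  by move=> /srP[r0 loc]; exact: (flux_cvg0 i vg (phiG z) (sphi z) r0 loc vtr).
have [_ cS] := sum_integral_cvg0 bF cF.
have sum_g x : Omega x -> \sum_(z <- s) gphi z i x = 0.
  move=> Ox; have [_ sp _] := has_grad_sum s phiG.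
  rewrite -sp /partial (@near_eq_derive R _ R _ (cst (1 : R)) x); first exact: derive_cst.
  have : nbhs x Omega by exact: open_nbhs_nbhs.
  by apply: filterS => y Oy; apply: phi1; exact: subset_closure.
have SE n x : Omega x -> \sum_(z <- s) F z n x = gv n i x.
  move=> Ox; rewrite /F big_split /= -mulr_sumr sum_g // mulr0 add0r -mulr_suml.
  by rewrite phi1 ?mul1r //; exact: subset_closure.
have bpu n : bounded_measurable Omega (partial i (u n)).
  by have [_ _ cu] := ug n; exact: (bounded_measurable_continuous OM (cu i)).
have cG := L2_cvg_integral bpu (GL2 i) (du i).
have cG' : (fun n => \int[mu2]_(x in Omega) partial i (u n) x) @ \oo --> f i 0 * fine (mu2 Omega).
  rewrite -[X in _ --> X]add0r.
  rewrite (_ : (fun n => _) = fun n => \int[mu2]_(x in Omega) (\sum_(z <- s) F z n x) +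
      f i 0 * fine (mu2 Omega)).
    by apply: cvgD => //; exact: cvg_cst.
  apply/funext => n; rewrite (_ : \int[mu2]_(x in Omega) (\sum_(z <- s) F z n x) =
      \int[mu2]_(x in Omega) gv n i x).
    rewrite /gv bounded_RintegralB //; last exact: bounded_measurable_cst.
    by rewrite Rintegral_csts // subrK.
  by apply: eq_Rintegral => x /set_mem; exact: SE.
exact: (cvg_unique (@Rhausdorff R) cG cG').
Qed.

End Gradient_average.

(** * Elastic energies *)

Section Elastic.
Context {R : realType}.
Implicit Types (A B : 'M[R]_2) (u v e fT : 'cV[R]_2).

Lemma cV2P u v : u 0 0 = v 0 0 -> u 1 0 = v 1 0 -> u = v.
Proof.
move=> e0 e1; apply/matrixP => i j; rewrite (ord1 j).
case: (unliftP 0 i) => [k|] -> //; rewrite (ord1 k).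
by rewrite (_ : lift 0 0 = 1) //; exact: val_inj.
Qed.

Lemma mulmx2E A v i : (A *m v) i 0 = A i 0 * v 0 0 + A i 1 * v 1 0.
Proof.
rewrite mxE big_ord_recl big_ord1; congr (_ + A _ _ * v _ _); exact: val_inj.
Qed.

Lemma elastic_energyE A fT w v : elastic_energy A fT w v =
  2^-1 * ((A 0 0 * (v 0 0 - fT 0 0) + A 0 1 * (v 1 0 - fT 1 0)) * (v 0 0 - fT 0 0) +
          (A 1 0 * (v 0 0 - fT 0 0) + A 1 1 * (v 1 0 - fT 1 0)) * (v 1 0 - fT 1 0)) + w.
Proof. by rewrite /elastic_energy dotE !mulmx2E !mxE. Qed.

Lemma posdef_ge0 A v : sym_posdef A -> 0 <= dot (A *m v) v.
Proof.
move=> [_ Ap]; have [->|/Ap/ltW//] := eqVneq v 0.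
by rewrite dotE !mxE !mulr0 addr0.
Qed.

Lemma elastic_energy_ge A fT w v : sym_posdef A -> 0 <= w -> 0 <= elastic_energy A fT w v.
Proof. by move=> Ap w0; rewrite addr_ge0 // mulr_ge0 // posdef_ge0. Qed.

Lemma elastic_energy_expand A fT w e v : A^T = A ->
  elastic_energy A fT w v = elastic_energy A fT w e + dot (A *m (e - fT)) (v - e) +
    2^-1 * dot (A *m (v - e)) (v - e).
Proof.
move=> As; have A10 : A 1 0 = A 0 1 by rewrite -[in LHS]As mxE.
by rewrite !elastic_energyE !dotE !mulmx2E !mxE A10; field.
Qed.

Lemma quadratic_le A v : 2^-1 * dot (A *m v) v <=
  (`|A 0 0| + `|A 0 1| + `|A 1 0| + `|A 1 1|) * ((v 0 0) ^+ 2 + (v 1 0) ^+ 2).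
Proof.
rewrite dotE !mulmx2E; move: (v 0 0) (v 1 0) => x y.
have sq : 0 <= x ^+ 2 /\ 0 <= y ^+ 2 by rewrite !sqr_ge0.
have [x2 y2] := sq; pose s := x ^+ 2 + y ^+ 2.
have b (a t : R) : `|t| <= s -> 2^-1 * (a * t) <= `|a| * s.
  move=> ts; apply: (@le_trans _ _ (`|a * t|)).
    apply: (@le_trans _ _ (2^-1 * `|a * t|)); first by rewrite ler_wpM2l // ler_norm.
    by rewrite ler_piMl // invf_le1 // ler1n.
  by rewrite normrM ler_wpM2l.
have h1 := b (A 0 0) (x * x); have h2 := b (A 0 1) (y * x).
have h3 := b (A 1 0) (x * y); have h4 := b (A 1 1) (y * y).
have n1 : `|x * x| <= s by rewrite -expr2 ger0_norm // lerDl.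
have n4 : `|y * y| <= s by rewrite -expr2 ger0_norm // lerDr.
have n2 : `|x * y| <= s.
  by rewrite ler_norml /s; apply/andP; split; have := sqr_ge0 (x + y); have := sqr_ge0 (x - y); nra.
have n3 : `|y * x| <= s by rewrite mulrC.
rewrite -/s; move: (h1 n1) (h2 n3) (h3 n2) (h4 n4).
rewrite !mulrDl !mulrDr !mulrA => *.
by rewrite !addrA; lra.
Qed.

Lemma posdef_unitmx A : sym_posdef A -> A \in unitmx.
Proof.
move=> [As Ap]; rewrite -row_free_unit -kermx_eq0; apply/rowV0P => v /sub_kermxP vA.
apply/eqP/negPn/negP => v0.
have vT0 : v^T != 0 by rewrite -trmx0 (inj_eq trmx_inj).
have AvT : A *m v^T = 0 by rewrite -[A]As -trmx_mul vA trmx0.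
by have := Ap _ vT0; rewrite AvT dotE !mxE !mul0r addr0 ltxx.
Qed.

Lemma posdef_combination A B (d : R) : sym_posdef A -> sym_posdef B -> 0 <= d <= 1 ->
  sym_posdef ((1 - d) *: A + d *: B).
Proof.
move=> [As Ap] [Bs Bp] /andP[d0 d1]; split.
  by rewrite linearD !linearZ /= As Bs.
move=> v v0.
have -> : dot (((1 - d) *: A + d *: B) *m v) v =
    (1 - d) * dot (A *m v) v + d * dot (B *m v) v.
  by rewrite !dotE !mulmx2E !mxE; ring.
have := Ap v v0; have := Bp v v0; move: (dot _ _) (dot _ _) => x y x0 y0.
have [d12|d12] := leP d (1 / 2).
  have d' : 0 < 1 - d by lra.
  by apply: ltr_pwDl; [exact: mulr_gt0|by rewrite mulr_ge0 // ltW].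
have d' : 0 < d by lra.
have d'' : 0 <= 1 - d by lra.
by apply: ltr_wpDl; [by rewrite mulr_ge0 // ltW|exact: mulr_gt0].
Qed.

Section Optimal_strains.
Variables (A1 A2 : 'M[R]_2) (f1 f2 f : 'cV[R]_2) (d : R).
Hypotheses (p1 : sym_posdef A1) (p2 : sym_posdef A2) (d01 : 0 <= d <= 1).
Let B := (1 - d) *: A1 + d *: A2.
Let e1 := invmx B *m (A2 *m f - (1 - d) *: (A2 *m f2 - A1 *m f1)).
Let e2 := invmx B *m (A1 *m f + d *: (A2 *m f2 - A1 *m f1)).

Let Bu : B \in unitmx. Proof. exact/posdef_unitmx/posdef_combination. Qed.

(** In the weighted sum of the two brackets the transformation strains cancel and [B *m f]
    remains. *)
Lemma optimal_average : d *: e1 + (1 - d) *: e2 = f.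
Proof.
rewrite /e1 /e2 !scalemxAr -mulmxDr.
have -> : d *: (A2 *m f - (1 - d) *: (A2 *m f2 - A1 *m f1)) +
    (1 - d) *: (A1 *m f + d *: (A2 *m f2 - A1 *m f1)) = B *m f.
  by apply: cV2P; rewrite !(mulmx2E, mxE); ring.
by rewrite mulKmx.
Qed.

(** With f written as the average, the equation for [e1] is 1 - d times the equality of stresses,
    and the one for [e2] is d times it. One of the two weights is nonzero, so the equality also
    holds for pure phases. *)
Lemma optimal_stress : A1 *m (e1 - f1) = A2 *m (e2 - f2).
Proof.
have Be1 : B *m e1 = A2 *m f - (1 - d) *: (A2 *m f2 - A1 *m f1) by rewrite mulKVmx.
have Be2 : B *m e2 = A1 *m f + d *: (A2 *m f2 - A1 *m f1) by rewrite mulKVmx.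
have av := optimal_average; move: e1 e2 av Be1 Be2 => x1 x2 av.
have fE i : f i 0 = d * x1 i 0 + (1 - d) * x2 i 0 by rewrite -av !mxE.
move=> /matrixP Be1 /matrixP Be2.
have E i : (A1 *m (x1 - f1)) i 0 = (A2 *m (x2 - f2)) i 0.
  have := Be1 i 0; have := Be2 i 0; rewrite !(mulmx2E, mxE) !fE => h2 h1.
  have [d1|d1] := eqVneq d 1.
    by move: h2; rewrite d1 => h2; lra.
  apply: (@mulfI _ (1 - d)); first by rewrite subr_eq0 eq_sym.
  by lra.
by apply/matrixP => i j; rewrite (ord1 j); exact: E.
Qed.

End Optimal_strains.

End Elastic.

(** * Lower and upper bounds for the energy *)

Section Relaxation.
Context {R : realType}.
Notation RR := (measurableTypeR R).
Notation mu2 := (@lebesgue2 R).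
Variables (Omega : set (R * R)) (M : R).
Hypotheses (oO : open Omega) (O0 : Omega !=set0) (M0 : 0 < M) (OM : Omega `<=` box M).
Hypothesis lip : lipschitz_boundary Omega.
Variables (A1 A2 : 'M[R]_2) (f1 f2 e1 e2 f : 'cV[R]_2) (w1 w2 d : R).
Hypotheses (p1 : sym_posdef A1) (p2 : sym_posdef A2) (w1_ge0 : 0 <= w1) (w2_ge0 : 0 <= w2).
Hypothesis d01 : 0 <= d <= 1.
Hypothesis average_e : d *: e1 + (1 - d) *: e2 = f.
Hypothesis stress_e : A1 *m (e1 - f1) = A2 *m (e2 - f2).

Let W1 := elastic_energy A1 f1 w1.
Let W2 := elastic_energy A2 f2 w2.
Let sigma := A1 *m (e1 - f1).
Let mO : measurable (Omega : set (RR * RR)). Proof. exact: open_measurable2. Qed.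
Let Ooo : (mu2 Omega < +oo)%E. Proof. exact: finite_measure_box OM. Qed.
Let V := fine (mu2 Omega).
Let V0 : 0 < V. Proof. by apply: fine_gt0; rewrite Ooo open_measure_gt0. Qed.

Definition density (X : R) (g : 'cV[R]_2) : R := X * W1 g + (1 - X) * W2 g.

(** For X = 1 and X = 0 this is the tangent plane of [W1] at e1 and of [W2] at e2. Both have slope
    sigma, so no product of X and g occurs, and the integral depends only on the averages of chi and
    G. *)
Definition affine_part (X : R) (g : 'cV[R]_2) : R :=
  (W2 e2 - dot sigma e2) + (W1 e1 - W2 e2 - dot sigma (e1 - e2)) * X +
  (sigma 0 0 * g 0 0 + sigma 1 0 * g 1 0).

Lemma density_ge0 X g : X = 0 \/ X = 1 -> 0 <= density X g.
Proof.
by rewrite /density; move=> [->|->];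
  rewrite ?subr0 ?subrr ?mul0r ?mul1r ?addr0 ?add0r elastic_energy_ge.
Qed.

Lemma density_expand X g : X = 0 \/ X = 1 ->
  density X g = affine_part X g +
    (X * (2^-1 * dot (A1 *m (g - e1)) (g - e1)) +
     (1 - X) * (2^-1 * dot (A2 *m (g - e2)) (g - e2))).
Proof.
have E1 := elastic_energy_expand f1 w1 e1 g (proj1 p1).
have E2 := elastic_energy_expand f2 w2 e2 g (proj1 p2).
rewrite -stress_e -/sigma -/W1 -/W2 in E2; rewrite -/sigma -/W1 in E1.
move: E1 E2; rewrite /density /affine_part => -> ->.
move: (2^-1 * dot _ _) (2^-1 * dot _ _) (W1 e1) (W2 e2) => q1 q2 x1 x2.
by move=> [->|->]; rewrite !dotE !mxE; ring.
Qed.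

Lemma density_ge X g : X = 0 \/ X = 1 -> affine_part X g <= density X g.
Proof.
move=> X01; rewrite density_expand // lerDl.
by case: X01 => ->; rewrite ?subr0 ?subrr ?mul0r ?mul1r ?addr0 ?add0r;
  rewrite mulr_ge0 // posdef_ge0.
Qed.

(** Since f is the average, f + (X - d) (e1 - e2) is e1 for X = 1 and e2 for X = 0. The squares are
    thus those of the distance of g to the strain of its own phase. *)
Lemma density_le : exists2 C, 0 <= C & forall X g, X = 0 \/ X = 1 ->
  density X g <= affine_part X g + C *
   ((g 0 0 - f 0 0 - (X - d) * (e1 - e2) 0 0) ^+ 2 +
    (g 1 0 - f 1 0 - (X - d) * (e1 - e2) 1 0) ^+ 2).
Proof.
pose C (A : 'M[R]_2) := `|A 0 0| + `|A 0 1| + `|A 1 0| + `|A 1 1|.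
have C0 A : 0 <= C A by rewrite !addr_ge0.
exists (C A1 + C A2) => [|X g X01]; first by rewrite addr_ge0.
rewrite density_expand // lerD2l -average_e !mxE.
have q A u : 2^-1 * dot (A *m u) u <= C A * (u 0 0 ^+ 2 + u 1 0 ^+ 2) by exact: quadratic_le.
case: X01 => ->; rewrite ?subr0 ?subrr ?mul0r ?mul1r ?addr0 ?add0r.
  apply: (le_trans (q A2 _)); rewrite !mxE.
  apply: (@le_trans _ _ ((C A1 + C A2) *
    ((g 0 0 - e2 0 0) ^+ 2 + (g 1 0 - e2 1 0) ^+ 2))).
    by rewrite ler_wpM2r ?addr_ge0 ?sqr_ge0 // lerDr.
  by rewrite le_eqVlt; apply/orP; left; apply/eqP; congr (_ * (_ ^+ 2 + _ ^+ 2)); ring.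
apply: (le_trans (q A1 _)); rewrite !mxE.
apply: (@le_trans _ _ ((C A1 + C A2) *
  ((g 0 0 - e1 0 0) ^+ 2 + (g 1 0 - e1 1 0) ^+ 2))).
  by rewrite ler_wpM2r ?addr_ge0 ?sqr_ge0 // lerDl.
by rewrite le_eqVlt; apply/orP; left; apply/eqP; congr (_ * (_ ^+ 2 + _ ^+ 2)); ring.
Qed.

Lemma phase_bounded chi : phase_distribution Omega d chi -> bounded_measurable Omega chi.
Proof.
move=> [[/integrableP[mchi _] _] chi01 _]; split; first exact/measurable_EFinP.
by exists 1 => x /chi01[->|->]; rewrite ?normr0 ?normr1.
Qed.

Lemma phase_integral chi : phase_distribution Omega d chi ->
  \int[mu2]_(x in Omega) chi x = d * V.
Proof.
by move=> [_ _ <-]; rewrite /average -/V mulrAC mulVf ?mul1r // gt_eqF.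
Qed.

Lemma affine_part_integral chi (G : R * R -> 'cV[R]_2) :
  phase_distribution Omega d chi -> admissible_gradient Omega f G ->
  mu2.-integrable Omega (EFin \o (fun x => affine_part (chi x) (G x))) /\
  \int[mu2]_(x in Omega) affine_part (chi x) (G x) = V * (d * W1 e1 + (1 - d) * W2 e2).
Proof.
move=> chiP Gf; have bchi := phase_bounded chiP.
have GL2 : forall i, L2 Omega (fun x => G x i 0) by have [eta [[_ ? _] _]] := Gf.
have Gi i := L2_integrable oO OM (GL2 i).
have av i := gradient_average oO O0 OM i lip Gf.
pose c0 := W2 e2 - dot sigma e2; pose c1 := W1 e1 - W2 e2 - dot sigma (e1 - e2).
have bc : bounded_measurable Omega (fun x => c0 + c1 * chi x).
  apply: bounded_measurableD; first exact: bounded_measurable_cst.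
  by apply: bounded_measurableM => //; exact: bounded_measurable_cst.
have i1 := bounded_measurable_integrable mO Ooo bc.
have iZ i (k : R) : mu2.-integrable Omega (EFin \o (fun x => k * G x i 0)).
  have := integrableZl mO k (Gi i).
  by apply: eq_integrable => // x _; rewrite /= EFinM.
have i2 : mu2.-integrable Omega
    (EFin \o (fun x => sigma 0 0 * G x 0 0 + sigma 1 0 * G x 1 0)).
  have := integrableD mO (iZ 0 (sigma 0 0)) (iZ 1 (sigma 1 0)).
  by apply: eq_integrable => // x _; rewrite /= EFinD.
split.
  have := integrableD mO i1 i2.
  by apply: eq_integrable => // x _; rewrite /= -EFinD.
have E2 : \int[mu2]_(x in Omega) (sigma 0 0 * G x 0 0 + sigma 1 0 * G x 1 0) =
    sigma 0 0 * (f 0 0 * V) + sigma 1 0 * (f 1 0 * V).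
  rewrite RintegralD //.
  rewrite (RintegralZl _ mO (Gi 0)) (RintegralZl _ mO (Gi 1)).
  by rewrite (av 0) (av 1).
have E1 : \int[mu2]_(x in Omega) (c0 + c1 * chi x) = c0 * V + c1 * (d * V).
  rewrite bounded_RintegralD //; last 2 first.
  - exact: bounded_measurable_cst.
  - by apply: bounded_measurableM => //; exact: bounded_measurable_cst.
  by rewrite bounded_RintegralZ // Rintegral_csts // phase_integral.
rewrite RintegralD // E1 E2 /c0 /c1.
by rewrite -average_e !dotE !mxE; ring.
Qed.

Lemma measurable_density chi (G : R * R -> 'cV[R]_2) :
  phase_distribution Omega d chi -> admissible_gradient Omega f G ->
  measurable_fun (Omega : set (RR * RR))
    ((fun x => density (chi x) (G x)) : RR * RR -> RR).
Proof.
move=> /phase_bounded[mchi _] [eta [[_ GL2 _] _]].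
have mG i : measurable_fun (Omega : set (RR * RR)) ((fun x => G x i 0) : RR * RR -> RR).
  by have [] := GL2 i.
have mcst (k : R) : measurable_fun (Omega : set (RR * RR)) ((fun=> k) : RR * RR -> RR).
  exact: measurable_cst.
have mE A (fT : 'cV[R]_2) w : measurable_fun (Omega : set (RR * RR))
    ((fun x => elastic_energy A fT w (G x)) : RR * RR -> RR).
  under eq_fun do rewrite elastic_energyE.
  have mB i : measurable_fun (Omega : set (RR * RR))
      ((fun x => G x i 0 - fT i 0) : RR * RR -> RR).
    exact: (measurable_funB (mG i) (mcst _)).
  have mL (a b : R) := measurable_funD (measurable_funM (mcst a) (mB 0))
    (measurable_funM (mcst b) (mB 1)).
  have mQ := measurable_funD (measurable_funM (mL (A 0 0) (A 0 1)) (mB 0))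
    (measurable_funM (mL (A 1 0) (A 1 1)) (mB 1)).
  exact: (measurable_funD (measurable_funM (mcst 2^-1) mQ) (mcst w)).
apply: measurable_funD.
  exact: (measurable_funM mchi (mE A1 f1 w1)).
exact: (measurable_funM (measurable_funB (mcst 1) mchi) (mE A2 f2 w2)).
Qed.

Lemma energy_ge chi G :
  phase_distribution Omega d chi -> admissible_gradient Omega f G ->
  ((d * W1 e1 + (1 - d) * W2 e2)%:E <= energy Omega W1 W2 chi G)%E.
Proof.
move=> chiP Gf; have [ia aE] := affine_part_integral chiP Gf.
have [_ chi01 _] := chiP; have md := measurable_density chiP Gf.
have -> : (d * W1 e1 + (1 - d) * W2 e2)%:E =
    (V^-1%:E * (V * (d * W1 e1 + (1 - d) * W2 e2))%:E)%E.
  by rewrite -EFinM mulKf // gt_eqF.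
rewrite /energy -/V; apply: lee_wpmul2l; first by rewrite lee_fin invr_ge0 ltW.
rewrite -aE fineK; last exact: integrable_fin_num.
(* To avoid integrability of the density, nonnegative functions are compared: the density is
   nonnegative, so it dominates the positive part of the affine part as well. *)
rewrite integralE.
have [mia _] := integrableP _ _ _ ia.
apply: (@le_trans _ _ (\int[mu2]_(x in Omega)
    (EFin \o (fun x => affine_part (chi x) (G x)))^\+ x)%E).
  by rewrite geeDl // oppe_le0; exact: integral_ge0.
apply: ge0_le_integral => //.
- exact: measurable_funepos.
- exact/measurable_EFinP.
- move=> x Ox; rewrite funeposE ge_max !lee_fin density_ge0 ?density_ge //; exact: chi01.
Qed.

Lemma energy_le (e : R) : 0 < e -> exists chi G,
  [/\ phase_distribution Omega d chi, admissible_gradient Omega f G &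
   (energy Omega W1 W2 chi G <= (d * W1 e1 + (1 - d) * W2 e2)%:E + e%:E)%E].
Proof.
move=> e0; have [C C0 CP] := density_le.
have [K K0 KP] := laminate_approximation (e1 - e2) oO O0 M0 OM d01.
(* [B * eta] is going to bound the excess energy: [K * eta] for each of the two components, times
   the constant of [density_le], averaged over Omega. *)
pose B := V^-1 * (C * (K + K)).
have B0 : 0 <= B by rewrite !mulr_ge0 ?addr_ge0 // invr_ge0 ltW.
pose eta := Num.min 1 (e / (B + 1)).
have B1 : 0 < B + 1 by rewrite ltr_wpDl.
have eta01 : 0 < eta <= 1 by rewrite /eta lt_min ltr01 divr_gt0 //= ge_min lexx.
have Beta : B * eta <= e.
  apply: (@le_trans _ _ (B * (e / (B + 1)))).
    by rewrite ler_wpM2l // /eta ge_min lexx orbT.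
  by rewrite mulrCA ger_pMr // ler_pdivrMr // mul1r lerDl.
have [chi [zeta [chiP zetaC err]]] := KP eta eta01.
pose G x : 'cV[R]_2 := \col_i (f i 0 + partial i zeta x).
have Gf : admissible_gradient Omega f G := admissible_C1c oO OM f zetaC.
exists chi, G; split => //.
have [ia aE] := affine_part_integral chiP Gf.
have [_ chi01 _] := chiP; have md := measurable_density chiP Gf.
have bchi := phase_bounded chiP.
pose D i x := (partial i zeta x - (chi x - d) * (e1 - e2) i 0) ^+ 2.
have bD i : bounded_measurable Omega (D i).
  have [/C1P[_ _ cz] _ _] := zetaC.
  have bz := bounded_measurable_continuous OM (cz i).
  have bcst (k : R) := bounded_measurable_cst Omega k.
  have b1 := bounded_measurableB bz (bounded_measurableM
    (bounded_measurableB bchi (bcst d)) (bcst ((e1 - e2) i 0))).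
  exact: (bounded_measurableM b1 b1).
have bDD : bounded_measurable Omega (fun x => C * (D 0 x + D 1 x)).
  apply: bounded_measurableM; first exact: bounded_measurable_cst.
  exact: bounded_measurableD.
have iDD := bounded_measurable_integrable mO Ooo bDD.
have le x : Omega x -> density (chi x) (G x) <= affine_part (chi x) (G x) + C * (D 0 x + D 1 x).
  move=> /chi01 X01; apply: (le_trans (CP _ _ X01)).
  by rewrite /G /D ![(\col_i _) _ _]mxE ![f _ _ + _]addrC !addrK.
have isum : mu2.-integrable Omega
   (EFin \o (fun x => affine_part (chi x) (G x) + C * (D 0 x + D 1 x))).
  have := integrableD mO ia iDD.
  by apply: eq_integrable => // x _; rewrite /= EFinD.
rewrite /energy -/V.
apply: (@le_trans _ _ (V^-1%:E * (V * (d * W1 e1 + (1 - d) * W2 e2) + C * (K * eta + K * eta))%:E)%E).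
  apply: lee_wpmul2l; first by rewrite lee_fin invr_ge0 ltW.
  apply: (@le_trans _ _ (\int[mu2]_(x in Omega)
      (affine_part (chi x) (G x) + C * (D 0 x + D 1 x))%:E)%E).
    have [misum _] := integrableP _ _ _ isum.
    apply: ge0_le_integral => //.
    - by move=> x Ox; rewrite lee_fin density_ge0 //; exact: chi01.
    - exact/measurable_EFinP.
  have fin := integrable_fin_num mO isum; rewrite -(fineK fin).
  rewrite lee_fin -[leLHS]/(\int[mu2]_(x in Omega)
    (affine_part (chi x) (G x) + C * (D 0 x + D 1 x))) RintegralD //.
  rewrite aE lerD2l bounded_RintegralZ //; last exact: bounded_measurableD.
  by rewrite ler_wpM2l // bounded_RintegralD // lerD // err.
rewrite -EFinM -EFinD lee_fin mulrDr mulKf ?gt_eqF // lerD2l.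
by apply: le_trans Beta; rewrite le_eqVlt; apply/orP; left; apply/eqP; rewrite /B; ring.
Qed.

End Relaxation.

Theorem theorem3 (R : realType) (Omega : set (R * R))
    (Omega_open : open Omega) (Omega_nonempty : Omega !=set0)
    (Omega_bounded : bounded_set Omega)
    (Omega_lipschitz : lipschitz_boundary Omega)
    (alpha1 alpha2 : 'M[R]_2)
    (alpha1_posdef : sym_posdef alpha1) (alpha2_posdef : sym_posdef alpha2)
    (f1T f2T : 'cV[R]_2) (w1 w2 : R) (w1_ge0 : 0 <= w1) (w2_ge0 : 0 <= w2)
    (d : R) (d_ge0 : 0 <= d) (d_le1 : d <= 1) (f : 'cV[R]_2) :
  let W1 := elastic_energy alpha1 f1T w1 in
  let W2 := elastic_energy alpha2 f2T w2 in
  let d1 := d in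
  let d2 := 1 - d in
  let grad_eta1 := invmx (d2 *: alpha1 + d1 *: alpha2) *m
        (alpha2 *m f - d2 *: (alpha2 *m f2T - alpha1 *m f1T)) in
  let grad_eta2 := invmx (d2 *: alpha1 + d1 *: alpha2) *m
        (alpha1 *m f + d1 *: (alpha2 *m f2T - alpha1 *m f1T)) in
  relaxed_energy Omega W1 W2 d f =
  (d1 * W1 grad_eta1 + d2 * W2 grad_eta2)%:E.
Proof.
move=> W1 W2 d1 d2 e1 e2; have [M M0 OM] := bounded_box Omega_bounded.
have d01 : 0 <= d <= 1 by rewrite d_ge0.
have av : d *: e1 + (1 - d) *: e2 = f by exact: optimal_average.
have st : alpha1 *m (e1 - f1T) = alpha2 *m (e2 - f2T) by exact: optimal_stress.
apply/eqP; rewrite eq_le; apply/andP; split.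
  apply/lee_addgt0Pr => e e0.
  have [chi [G [chiP Gf le]]] := energy_le Omega_open Omega_nonempty M0 OM Omega_lipschitz
    alpha1_posdef alpha2_posdef w1_ge0 w2_ge0 d01 av st e0.
  apply: le_trans le; apply: (@le_trans _ _ (ereal_inf
    [set energy Omega W1 W2 chi G | G in admissible_gradient Omega f])).
    by apply: ereal_inf_lbound; exists chi.
  by apply: ereal_inf_lbound; exists G.
apply: le_ereal_inf_tmp => _ [chi chiP <-].
apply: le_ereal_inf_tmp => _ [G Gf <-].
exact: (energy_ge Omega_open Omega_nonempty OM Omega_lipschitz
    alpha1_posdef alpha2_posdef w1_ge0 w2_ge0 av st chiP Gf).
Qed.
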